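(* Let $P_T\subseteq P\subseteq G$ be the monoids attached to a graph of monoids as described in the context, and assume that condition (LCM) is satisfied. If $C^*_\lambda(P)$ is nuclear, then $C^*_\lambda(P_T)$ is nuclear.
   Context: Setting. $(V,E)$ is a connected graph in the sense of Serre: every edge $e\in E$ has an origin $o(e)$, a target $t(e)$ and an inverse edge $\bar e\neq e$ with $\bar{\bar e}=e$, $o(\bar e)=t(e)$. A graph of groups on $(V,E)$ is given: groups $G_v$ ($v\in V$), groups $G_e=G_{\bar e}$ ($e\in E$), and injective homomorphisms $G_e\to G_{t(e)},\ x\mapsto x^e$ and $G_e\to G_{o(e)},\ x\mapsto x^{\bar e}$. For $S\subseteq G_e$, $S^e$ and $S^{\bar e}$ denote the images of $S$. The identity of a group is $\epsilon$. Fix a decomposition $E=A\amalg\bar A\amalg T$, where $T$ is a maximal subtree (containing with each edge its inverse; $T$ also denotes its set of edges). Let $$G=\langle \{G_v\}_{v\in V}\cup A \mid g^{\bar e}e=eg^e\ \forall g\in G_e, e\in A;\ g^{\bar e}=g^e\ \forall g\in G_e, e\in T\rangle .$$ Each $G_v$ is a totally ordered group with positive cone $P_v$ (a submonoid with $G_v=P_v\cup P_v^{-1}$, $P_v\cap P_v^{-1}=\{\epsilon\}$). For $e\in E$ put $P_e:=\{g\in G_e: g^e\in P_{t(e)}\}$ and $P_{\bar e}:=\{g\in G_e: g^{\bar e}\in P_{o(e)}\}$. It is assumed that $P_e=P_{\bar e}$ for all $e\in T$, and that $A=A_+\amalg A_-$ with $P_{\bar e}^e\subseteq P_{t(e)}$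 for $e\in A_+$ and $P_{\bar e}^e\subseteq P_{t(e)}^{-1}$ for $e\in A_-$. $P$ is the submonoid of $G$ generated by $\bigcup_{v}P_v\cup A$, and $P_T\subseteq P$ is the submonoid generated by $\bigcup_vP_v$. Standing assumption: $V$, $E$ and all $G_v$ are countable. Condition (LCM): for all $e\in T\amalg A$ and $p\in P_{o(e)}$, the set $\{x\in P_{o(e)}: px\in P_{\bar e}^{\bar e}\}$ is either empty or equal to $qP_{\bar e}^{\bar e}$ for some $q\in P_{o(e)}$. For a left cancellative monoid $Q$, $C^*_\lambda(Q)$ is the C*-subalgebra of $B(\ell^2Q)$ generated by the isometries $\lambda_q$, $q\in Q$, with $\lambda_q(\delta_x)=\delta_{qx}$. *)

(* Defs.v *)
From HB Require Import structures.
From mathcomp Require Import all_boot all_order all_algebra.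
From mathcomp Require Import generic_quotient.
From mathcomp Require Import all_classical all_reals.
From mathcomp Require Import ereal numfun esum.
From mathcomp Require Import complex ring.

Set Implicit Arguments.
Unset Strict Implicit.
Unset Printing Implicit Defensive.

Import Order.TTheory GRing.Theory Num.Theory ComplexField.Normc.
Local Open Scope classical_set_scope.

(* A letter (x, true) stands for the generator x, and (x, false) for its
   formal inverse. *)
Definition gword (X : Type) := seq (X * bool).

Inductive gcongr (X : Type) (rel : gword X -> gword X -> Prop) :
    gword X -> gword X -> Prop :=
| gcongr_rel u v : rel u v -> gcongr rel u v
| gcongr_cancel x b : gcongr rel [:: (x, b); (x, ~~ b)] [::]
| gcongr_refl u : gcongr rel u u
| gcongr_sym u v : gcongr rel u v -> gcongr rel v u
| gcongr_trans v u w : gcongr rel u v -> gcongr rel v w -> gcongr rel u w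
| gcongr_cat u u' v v' :
    gcongr rel u u' -> gcongr rel v v' -> gcongr rel (u ++ v) (u' ++ v').

Section PresentedGroup.
Variables (X : choiceType) (rel : gword X -> gword X -> Prop).
Implicit Types u v w : gword X.

Definition gcongrb u v : bool := `[< gcongr rel u v >].

Lemma gcongrb_refl : reflexive gcongrb.
Proof. by move=> u; apply/asboolP; exact: gcongr_refl. Qed.

Lemma gcongrb_sym : symmetric gcongrb.
Proof. by move=> u v; apply/asboolP/asboolP => /gcongr_sym. Qed.

Lemma gcongrb_trans : transitive gcongrb.
Proof.
by move=> v u w /asboolP uv /asboolP vw; apply/asboolP/(gcongr_trans uv vw).
Qed.

Canonical gcongr_equiv :=
  EquivRel gcongrb gcongrb_refl gcongrb_sym gcongrb_trans.

Definition presGroup := {eq_quot gcongr_equiv}%qT.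
HB.instance Definition _ := Choice.on presGroup.
HB.instance Definition _ := EqQuotient.on presGroup.

Definition pres_word u : presGroup := (\pi_presGroup u)%qT.

Lemma pres_wordP u v : pres_word u = pres_word v <-> gcongr rel u v.
Proof.
split=> [/eqP|uv]; first by rewrite piE => /asboolP.
by apply/eqP; rewrite piE; apply/asboolP.
Qed.

Lemma pres_word_repr (a : presGroup) : pres_word (repr a) = a.
Proof. exact: reprK. Qed.

Definition inv_word u : gword X := rev [seq (l.1, ~~ l.2) | l <- u].

Definition pres_mul (a b : presGroup) := pres_word (repr a ++ repr b).
Definition pres_one := pres_word [::].
Definition pres_inv (a : presGroup) := pres_word (inv_word (repr a)).

Lemma pres_mulE u v : pres_mul (pres_word u) (pres_word v) = pres_word (u ++ v).
Proof.
by apply/pres_wordP/gcongr_cat; apply/pres_wordP; rewrite pres_word_repr.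
Qed.

Lemma pres_mulA : associative pres_mul.
Proof.
move=> a b c; rewrite -(pres_word_repr a) -(pres_word_repr b).
by rewrite -(pres_word_repr c) !pres_mulE catA.
Qed.

Lemma pres_mul1g : left_id pres_one pres_mul.
Proof. by move=> a; rewrite -(pres_word_repr a) pres_mulE. Qed.

Lemma pres_mulg1 : right_id pres_one pres_mul.
Proof. by move=> a; rewrite -(pres_word_repr a) pres_mulE cats0. Qed.

Lemma inv_wordK : involutive inv_word.
Proof.
move=> u; rewrite /inv_word map_rev revK -map_comp.
by rewrite -[RHS]map_id; apply: eq_map => -[x b] /=; rewrite negbK.
Qed.

Lemma gcongr_invl u : gcongr rel (inv_word u ++ u) [::].
Proof.
elim: u => [|[x b] u IHu]; first exact: gcongr_refl.
rewrite /inv_word /= rev_cons cat_rcons -cat1s.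
apply: gcongr_trans IHu; apply: gcongr_cat; first exact: gcongr_refl.
have := gcongr_cat (gcongr_cancel rel x (~~ b)) (gcongr_refl rel u).
by rewrite negbK.
Qed.

Lemma pres_mulVg : left_inverse pres_one pres_inv pres_mul.
Proof.
move=> a; rewrite -[a in X in pres_mul _ X](pres_word_repr a) pres_mulE.
exact/pres_wordP/gcongr_invl.
Qed.

Lemma pres_mulgV : right_inverse pres_one pres_inv pres_mul.
Proof.
move=> a; rewrite -[a in X in pres_mul X _](pres_word_repr a) pres_mulE.
apply/pres_wordP; rewrite -[X in X ++ _]inv_wordK.
exact: gcongr_invl.
Qed.

HB.instance Definition _ := isGroup.Build presGroup
  pres_mulA pres_mul1g pres_mulg1 pres_mulVg pres_mulgV.

Definition pres_gen (x : X) : presGroup := pres_word [:: (x, true)].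

End PresentedGroup.

Section Monoids.
Local Open Scope group_scope.

Definition is_submonoid (M : monoidType) (S : set M) :=
  S 1 /\ forall x y, S x -> S y -> S (x * y).

Definition gen_submonoid (M : monoidType) (S : set M) : set M :=
  smallest (@is_submonoid M) S.

Lemma gen_submonoid_closed (M : monoidType) (S : set M) :
  monoid_closed (mem (gen_submonoid S)).
Proof.
split=> [|x y].
  by rewrite inE => N [[N1 _] _].
rewrite !inE => Sx Sy N NS; have [[_ NM] _] := NS.
by apply: NM; [exact: Sx|exact: Sy].
Qed.

Definition genMonoid (M : monoidType) (S : set M) := set_type (gen_submonoid S).
HB.instance Definition _ (M : monoidType) (S : set M) :=
  Choice.on (genMonoid S).
HB.instance Definition _ (M : monoidType) (S : set M) :=
  SubChoice.on (genMonoid S).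
HB.instance Definition _ (M : monoidType) (S : set M) :=
  SubChoice_isSubMonoid.Build M (mem (gen_submonoid S)) (genMonoid S)
    (gen_submonoid_closed S).

Definition positive_cone (G : groupType) (P : set G) :=
  [/\ is_submonoid P, forall g, P g \/ P g^-1
    & forall g, P g -> P g^-1 -> g = 1].

End Monoids.

Record serreGraph := SerreGraph {
  vert : choiceType;
  edge : choiceType;
  org : edge -> vert;
  einv : edge -> edge;
  einv_neq : forall e, einv e <> e;
  einvK : involutive einv }.

(* The target is defined by t(e) = o(e bar), so that o(e bar) = t(e) holds by
   conversion and t(e bar) = o(e) follows from einvK. *)
Definition tgt (Gam : serreGraph) (e : edge Gam) : vert Gam := org (einv e).

Record subgraph (Gam : serreGraph) := Subgraph {
  sverts : set (vert Gam);
  sedges : set (edge Gam);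
  sedges_einv : forall e, sedges e -> sedges (einv e);
  sedges_org : forall e, sedges e -> sverts (org e) }.

Section Graphs.
Variable Gam : serreGraph.
Implicit Types (e f : edge Gam) (p : seq (edge Gam)) (u v : vert Gam).
Implicit Types (D : set (edge Gam)) (S T : subgraph Gam).

(* [epath D u p v] : p is an edge path from u to v with edges in D. *)
Fixpoint epath D u p v : Prop :=
  if p is e :: p' then [/\ D e, org e = u & epath D (tgt e) p' v] else u = v.

Definition connected_graph := forall u v, exists p, epath setT u p v.

(* A circuit is a closed path of positive length without backtracking that
   visits pairwise distinct vertices; loops are the circuits of length 1. *)
Definition circuit D p :=
  [/\ p <> [::], exists u, epath D u p u,
      uniq [seq tgt e | e <- p] & sorted (fun e f => f != einv e) p].

Definition is_tree S :=
  [/\ sverts S !=set0,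
      forall u v, sverts S u -> sverts S v -> exists p, epath (sedges S) u p v
    & forall p, ~ circuit (sedges S) p].

Definition subgraph_le S T :=
  sverts S `<=` sverts T /\ sedges S `<=` sedges T.

Definition maximal_subtree T :=
  is_tree T /\ forall S, is_tree S -> subgraph_le T S -> subgraph_le S T.

End Graphs.

Record graphOfGroups (Gam : serreGraph) := GraphOfGroups {
  gvert : vert Gam -> groupType;
  gedge : edge Gam -> groupType;
  gedge_einv : forall e, gedge (einv e) = gedge e;
  emb_org : forall e, {multiplicative gedge e -> gvert (org e)};
  emb_org_inj : forall e, injective (emb_org e) }.

Section GraphOfGroups.
Variables (Gam : serreGraph) (GG : graphOfGroups Gam).

(* The identification of G_e with G_(e bar). *)
Definition eflip (e : edge Gam) (x : gedge GG e) : gedge GG (einv e) :=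
  eq_rect_r (fun H : groupType => H) x (gedge_einv GG e).

(* For x in G_e, [emb_org e x] is x^(e bar) in G_o(e), and [emb_tgt e x] is
   x^e in G_t(e): as G_e = G_(e bar) and t(e) = o(e bar), the map attached to
   t(e) for the edge e is the one attached to o(e bar) for the edge e bar. *)
Definition emb_tgt (e : edge Gam) (x : gedge GG e) : gvert GG (tgt e) :=
  emb_org GG (einv e) (eflip x).

Variables (A : set (edge Gam)) (T : subgraph Gam).

Definition ggen := ({v : vert Gam & gvert GG v} + A)%type.

Definition gvgen (v : vert Gam) (g : gvert GG v) : gword ggen :=
  [:: (inl (existT _ v g), true)].
Definition gegen (e : A) : gword ggen := [:: (inr e, true)].

Local Open Scope group_scope.

(* The first clause makes the product of G_v the product of the presented
   group; the other two are the relations attached to the edges. *)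
Inductive grel : gword ggen -> gword ggen -> Prop :=
| grel_vert v (g h : gvert GG v) : grel (gvgen g ++ gvgen h) (gvgen (g * h))
| grel_edge (e : A) (g : gedge GG (val e)) :
    grel (gvgen (emb_org GG _ g) ++ gegen e) (gegen e ++ gvgen (emb_tgt g))
| grel_tree (e : edge Gam) (g : gedge GG e) :
    sedges T e -> grel (gvgen (emb_org GG _ g)) (gvgen (emb_tgt g)).

Definition fundGroup : groupType := presGroup grel.

Definition fg_vert (v : vert Gam) (g : gvert GG v) : fundGroup :=
  pres_gen grel (inl (existT _ v g)).
Definition fg_edge (e : A) : fundGroup := pres_gen grel (inr e).

Variable P : forall v : vert Gam, set (gvert GG v).

Definition pos_tgt (e : edge Gam) : set (gedge GG e) :=
  [set g | P (emb_tgt g)].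
Definition pos_org (e : edge Gam) : set (gedge GG e) :=
  [set g | P (emb_org GG e g)].
Arguments pos_tgt : clear implicits.
Arguments pos_org : clear implicits.

Definition gensPT : set fundGroup :=
  [set x | exists v, exists2 g : gvert GG v, P g & x = fg_vert g].
Definition gensP : set fundGroup := gensPT `|` range fg_edge.

Definition monP : monoidType := genMonoid gensP.
Definition monPT : monoidType := genMonoid gensPT.

Definition condLCM := forall e, sedges T e \/ A e ->
  forall p : gvert GG (org e), P p ->
  let PE := emb_org GG e @` pos_org e in
  let S := [set x | P x /\ PE (p * x)] in
  S = set0 \/ exists2 q, P q & S = [set q * y | y in PE].

End GraphOfGroups.

Arguments pos_tgt {Gam GG} P e.
Arguments pos_org {Gam GG} P e.
Arguments fundGroup {Gam} GG A T.
Arguments monP {Gam} GG A T P.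
Arguments monPT {Gam} GG A T P.
Arguments condLCM {Gam} GG A T P.

Local Open Scope ring_scope.
Local Open Scope complex_scope.

Section L2.
Variables (R : realType) (X : choiceType).

Definition square_summable : set (X -> R[i]^o) :=
  [set f | (\esum_(x in [set: X]) (normc (f x) ^+ 2)%:E < +oo)%E].

Lemma normc_ge0 (z : R[i]) : 0 <= normc z.
Proof. by case: z => a b; exact: sqrtr_ge0. Qed.

Lemma normcZD_sqr (k a b : R[i]) : normc (k * a + b) ^+ 2 <=
  2 * normc k ^+ 2 * normc a ^+ 2 + 2 * normc b ^+ 2.
Proof.
have h : normc (k * a + b) <= normc k * normc a + normc b.
  by apply: le_trans (le_normcD _ _) _; rewrite -normcM.
apply: (@le_trans _ _ ((normc k * normc a + normc b) ^+ 2)).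
  by rewrite lerXn2r// nnegrE ?addr_ge0 ?mulr_ge0 ?normc_ge0.
rewrite -mulrA -exprMn -subr_ge0.
set x := normc k * _; set y := normc _.
have -> : 2 * x ^+ 2 + 2 * y ^+ 2 - (x + y) ^+ 2 = (x - y) ^+ 2 by ring.
exact: sqr_ge0.
Qed.

Lemma square_summable_closed : submod_closed (mem square_summable).
Proof.
split=> [|k f g].
  rewrite inE /square_summable /= esum1// => x _.
  by transitivity ((normc (0%C : R[i]) ^+ 2)%:E); rewrite // normc0 expr0n.
rewrite !inE /square_summable /= => Ff Fg.
pose c := 2 * normc k ^+ 2.
have c0 : 0 <= c by rewrite mulr_ge0 // sqr_ge0.
apply: (@le_lt_trans _ _
  (\esum_(x in [set: X]) (c%:E * (normc (f x) ^+ 2)%:E +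
                          2%:E * (normc (g x) ^+ 2)%:E))%E).
  apply: le_esum => x _; rewrite -!EFinM -EFinD lee_fin.
  exact: normcZD_sqr.
have esumZ (r : R) (h : X -> R[i]^o) : 0 <= r -> square_summable h ->
    (\esum_(x in [set: X]) (r%:E * (normc (h x) ^+ 2)%:E) < +oo)%E.
  move=> r0 Fh; pose t := (\esum_(x in [set: X]) (normc (h x) ^+ 2)%:E)%E.
  have t_oo : (t < +oo)%E := Fh.
  apply: (@le_lt_trans _ _ (r%:E * t)%E).
    apply: ge_ereal_sup => _ [F [finF _] <-].
    rewrite -ge0_mule_fsumr; last by move=> x; rewrite lee_fin sqr_ge0.
    apply: lee_wpmul2l; first by rewrite lee_fin.
    by apply: ereal_sup_ubound; exists F.
  by rewrite lte_mul_pinfty ?lee_fin.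
rewrite esumD; first by rewrite lte_add_pinfty// esumZ.
- by move=> x _; rewrite mule_ge0// lee_fin ?sqr_ge0.
- by move=> x _; rewrite mule_ge0// lee_fin ?sqr_ge0.
Qed.

Definition l2 := set_type square_summable.
HB.instance Definition _ := Choice.on l2.
HB.instance Definition _ := SubChoice.on l2.
HB.instance Definition _ := GRing.SubChoice_isSubLmodule.Build
  R[i] (X -> R[i]^o) (mem square_summable) l2
  (GRing.submod_closed_semi square_summable_closed).

Lemma delta_square_summable (x : X) :
  (fun y => (y == x)%:R) \in square_summable.
Proof.
rewrite inE /square_summable /= (esumID [set x])//=; last first.
  by move=> y _; rewrite lee_fin sqr_ge0.
rewrite setTI esum_set1 ?lee_fin ?sqr_ge0// esum1 ?adde0 ?ltry//.
move=> y [_ /= yx]; case: eqP => // _.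
by transitivity ((normc (0%C : R[i]) ^+ 2)%:E); rewrite // normc0 expr0n.
Qed.

Definition delta (x : X) : l2 := SigSub (delta_square_summable x).

Implicit Types (f g : l2) (a b : l2 -> l2).

(* Unconditional sums; they are only meaningful for absolutely summable
   families, such as those defining the inner product. *)
Definition rsum (h : X -> R) : R :=
  fine (\esum_(x in [set: X]) (Num.max (h x) 0)%:E) -
  fine (\esum_(x in [set: X]) (Num.max (- h x) 0)%:E).
Definition csum (h : X -> R[i]) : R[i] :=
  rsum (fun x => complex.Re (h x)) +i* rsum (fun x => complex.Im (h x)).

Definition l2dot f g : R[i] := csum (fun x => val f x * (val g x)^*).
Definition l2norm f : R :=
  Num.sqrt (fine (\esum_(x in [set: X]) (normc (val f x) ^+ 2)%:E)).

Definition bounded_op : set (l2 -> l2) :=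
  [set a | linear a /\ exists c : R, forall f, l2norm (a f) <= c * l2norm f].

Definition opnorm a : R := sup [set l2norm (a f) | f in [set f | l2norm f <= 1]].

Definition is_adjoint a b := forall f g, l2dot (b f) g = l2dot f (a g).

(* Concrete C*-algebras: norm-closed self-adjoint subalgebras of B(l^2(X)). *)
Definition is_cstar_subalgebra (S : set (l2 -> l2)) :=
  [/\ S `<=` bounded_op,
      S 0 /\ (forall (k : R[i]) a b, S a -> S b -> S (k *: a + b)),
      forall a b, S a -> S b -> S (a \o b),
      forall a b, S a -> bounded_op b -> is_adjoint a b -> S b
    & forall a, bounded_op a ->
        (forall eps : R, 0 < eps -> exists2 b, S b & opnorm (b - a) < eps) ->
        S a].

Definition cstar_generated (S : set (l2 -> l2)) : set (l2 -> l2) :=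
  smallest is_cstar_subalgebra S.

(* Positivity of a matrix of operators, acting on the direct sum of k copies
   of l^2(X). *)
Definition mx_positive (k : nat) (a : 'I_k -> 'I_k -> (l2 -> l2)) :=
  forall f : 'I_k -> l2, 0 <= \sum_i \sum_j l2dot (a i j (f j)) (f i).

End L2.

Arguments bounded_op : clear implicits.

Section Nuclear.
Variable R : realType.

(* phi, restricted to S, is a contractive completely positive map S -> S'. *)
Definition is_ccp (X Y : choiceType) (S : set (l2 R X -> l2 R X))
    (S' : set (l2 R Y -> l2 R Y)) (phi : (l2 R X -> l2 R X) -> l2 R Y -> l2 R Y) :=
  [/\ forall a, S a -> S' (phi a),
      forall (k : R[i]) a b, S a -> S b ->
        phi (k *: a + b) = k *: phi a + phi b,
      forall a, S a -> opnorm (phi a) <= opnorm a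
    & forall (k : nat) (a : 'I_k -> 'I_k -> (l2 R X -> l2 R X)),
        (forall i j, S (a i j)) -> mx_positive a ->
        mx_positive (fun i j => phi (a i j))].

(* The identity of S is a point-norm limit of contractive completely positive
   maps that factor through matrix algebras; M_n(C) is the algebra of all
   (bounded) operators on l^2({0, .., n-1}). *)
Definition nuclear (X : choiceType) (S : set (l2 R X -> l2 R X)) :=
  forall F : set (l2 R X -> l2 R X), finite_set F -> F `<=` S ->
  forall eps : R, 0 < eps ->
  exists (n : nat) phi psi,
    [/\ is_ccp S (bounded_op R 'I_n) phi, is_ccp (bounded_op R 'I_n) S psi
      & forall a, F a -> opnorm (psi (phi a) - a) < eps].

(* lambda_q, characterized among the bounded operators by its values on the
   orthonormal basis; is_lambda_lshift below gives its existence when left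
   multiplication by q is injective. *)
Definition is_lambda (Q : monoidType) (q : Q) (a : l2 R Q -> l2 R Q) :=
  bounded_op R Q a /\ forall x, a (delta R x) = delta R (q * x)%g.

Section Lambda.
Variables (Q : monoidType) (q : Q).
Hypothesis qI : injective (fun x : Q => (q * x)%g).
Definition lshift_fun (f : l2 R Q) : Q -> R[i]^o := fun y =>
  if pselect (exists x, (q * x)%g = y) is left h then val f (sval (cid h)) else 0.
Lemma lshift_funE f x : lshift_fun f (q * x)%g = val f x.
Proof. rewrite /lshift_fun; case: pselect => [h|[]]; last by exists x.
by case: cid => z /= /qI ->. Qed.
Lemma lshift_fun0 f y : ~ (exists x, (q * x)%g = y) -> lshift_fun f y = 0.
Proof. by move=> h; rewrite /lshift_fun; case: pselect. Qed.
Lemma lshift_sum f : (\esum_(x in [set: Q]) (normc (lshift_fun f x) ^+ 2)%:E = 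
  \esum_(x in [set: Q]) (normc (val f x) ^+ 2)%:E)%E.
Proof.
have -> : (\esum_(x in [set: Q]) (normc (val f x) ^+ 2)%:E =
    \esum_(y in range (fun x : Q => (q * x)%g)) (normc (lshift_fun f y) ^+ 2)%:E)%E.
  rewrite esum_image; last by move=> x y _ _ /qI.
  by apply: eq_esum => x _; rewrite lshift_funE.
rewrite [RHS]esum_mkcond; apply: eq_esum => y _.
case: ifPn => //; rewrite notin_setE => ny.
rewrite lshift_fun0; last by case=> x xy; apply: ny; exists x.
by transitivity ((normc (0%C : R[i]) ^+ 2)%:E); rewrite // normc0 expr0n.
Qed.
Lemma lshift_square_summable f : lshift_fun f \in @square_summable R Q.
Proof. by have := set_valP f; rewrite inE /square_summable /= lshift_sum. Qed.
Definition lshift_op f : l2 R Q := SigSub (lshift_square_summable f).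
Lemma is_lambda_lshift : is_lambda q lshift_op.
Proof.
split; last first.
  move=> x; apply/val_inj/funext => y /=.
  have [[z <-]|ny] := pselect (exists x, (q * x)%g = y).
    rewrite lshift_funE /=; congr (_%:R); congr nat_of_bool.
    by apply/eqP/eqP => [->|/qI].
  rewrite lshift_fun0//; case: eqP => // yE; case: ny; exists x; by rewrite yE.
split.
  move=> k f g; apply/val_inj/funext => y /=.
  have [[z <-]|ny] := pselect (exists x, (q * x)%g = y).
    by rewrite lshift_funE /GRing.add/= /GRing.scale /= !lshift_funE.
  rewrite lshift_fun0//. rewrite /GRing.add/= /GRing.scale /= !lshift_fun0//.
  by rewrite /GRing.scale /= mulr0 addr0.
by exists 1 => f; rewrite mul1r /l2norm /= lshift_sum.
Qed.
End Lambda.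

Definition cstar_lambda (Q : monoidType) : set (l2 R Q -> l2 R Q) :=
  cstar_generated [set a | exists q, is_lambda q a].

End Nuclear.

Arguments cstar_lambda : clear implicits.

(* Main.v *)
From HB Require Import structures.
Require Import Defs.
From mathcomp Require Import all_boot all_order all_algebra.
From mathcomp Require Import all_classical all_reals.
From mathcomp Require Import ereal esum complex ring lra zify.

(** Two facts are combined: a permanence property of nuclearity for reduced
    algebras of monoids, and a description of the divisibility order of P.

    Let Q be a submonoid of a cancellative monoid M, both right LCM: elements
    with a common right multiple have a least one. Then the reduced algebra of M
    is the closed span of the operators lambda_p lambda_q^*, and similarly for Q
    ([cstar_lambda_dense]). Suppose moreover that Q is a face (a product lies
    in Q only if both factors do) and that any two overlapping translates Qz lie
    in a common one. Compression to l^2(Q) sends lambda_p lambda_q^* to itself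
    or to 0, according as p and q both lie in Q or not. In the other direction,
    a combination of operators lambda_p lambda_q^* with p and q in Q acts on
    l^2(M), near any finite set of coordinates, as a direct sum of copies of its
    action on l^2(Q), one for each of finitely many disjoint translates
    ([merge_translates], [ext_norm]); hence it has the same norm on both spaces,
    and the resulting inflation map is completely positive
    ([inflates_positive]). Inflation followed by compression is the identity, so
    approximations of the identity of the algebra of M through matrix algebras
    yield such approximations for Q ([nuclear_submonoid]).

    It remains to verify these hypotheses for P_T in P. Normal forms in G are
    avoided. The vertex groups embed in G because free actions of a countable
    group on the natural numbers with infinitely many orbits are all isomorphic,
    so that such actions of the vertex groups can be made compatible along the
    edges ([fg_vert_inj]). Each edge of the Bass-Serre tree cuts it into two
    sides, and the side on which a translate of the base lies is found by
    counting modulo 2 the crossings of the edge along a word ([skew_primitive],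
    [cut_edge], [cut_tree]). A chain for the order x <= y iff x^-1 y lies in P_T
    that leads from one side of an edge to the other meets the coset of the edge
    group ([interpolate]).

    From this it follows that P_T induces on every vertex group the given order
    ([pword_VG]); that the upper bounds in a vertex group of an element of P_T,
    if any, have a minimum, by condition (LCM) applied along a path of T
    ([vertex_min]); and that two elements of P_T with an upper bound have a least
    one, by induction on the length of the paths representing them
    ([PT_joinable]). The element of P_T preceding the first letter from A of an
    element of P is unique up to the edge group of that letter ([edge_split]),
    which reduces least upper bounds in P to those in P_T
    ([PT_PP_joinable], [edge_joinable]). That P_T is a face of P is seen from the
    exponent sum of the letters from A ([PT_face]), and that overlapping
    translates of P_T lie in a common one follows from [edge_split], since the
    edge groups are totally ordered ([PP_directed]). *)

Set Implicit Arguments.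
Unset Strict Implicit.
Unset Printing Implicit Defensive.

Import Order.TTheory GRing.Theory Num.Theory ComplexField.Normc.
Local Open Scope classical_set_scope.

Local Open Scope complex_scope.
Local Open Scope ring_scope.

(** * Unconditional sums *)

Section UnconditionalSums.
Variables (R : realType) (X : choiceType).
Implicit Types (h : X -> R) (Y : seq X).

Lemma fsum_le_esum h Y : uniq Y -> (forall x, 0 <= h x) ->
  ((\sum_(y <- Y) h y)%:E <= \esum_(x in [set: X]) (h x)%:E)%E.
Proof.
move=> uY h0; apply: esum_ge; exists [set` Y].
  by split=> //; apply/finite_seqP; exists Y.
by rewrite -fsbig_seq// sumEFin.
Qed.

Lemma esum_le_fsum h C : (forall Y, uniq Y -> \sum_(y <- Y) h y <= C) ->
  (\esum_(x in [set: X]) (h x)%:E <= C%:E)%E.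
Proof.
move=> hC; apply: ge_ereal_sup => _ [F [/finite_seqP [Y ->] _] <-].
have -> : [set` Y] = [set` undup Y] by apply/seteqP; split=> x /=; rewrite mem_undup.
by rewrite -fsbig_seq ?undup_uniq// sumEFin lee_fin hC// undup_uniq.
Qed.

Lemma fsum_sub h Y Y' : uniq Y -> uniq Y' -> {subset Y <= Y'} ->
  (forall x, 0 <= h x) -> \sum_(y <- Y) h y <= \sum_(y <- Y') h y.
Proof.
move=> uY uY' sub h0.
rewrite [leRHS](bigID (fun y => y \in Y)) /=.
have -> : \sum_(y <- Y' | y \in Y) h y = \sum_(y <- Y) h y.
  rewrite -big_filter; apply: perm_big; apply: uniq_perm => //.
    by rewrite filter_uniq.
  by move=> x; rewrite mem_filter; case: (boolP (x \in Y)) => // /sub ->.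
by rewrite lerDl sumr_ge0.
Qed.

Lemma esum_fin_num h C : (forall x, 0 <= h x) ->
  (forall Y, uniq Y -> \sum_(y <- Y) h y <= C) ->
  (\esum_(x in [set: X]) (h x)%:E < +oo)%E.
Proof. by move=> h0 /esum_le_fsum hC; apply: le_lt_trans hC (ltry _). Qed.

Lemma fine_esum h : (forall x, 0 <= h x) ->
  (\esum_(x in [set: X]) (h x)%:E < +oo)%E ->
  ((fine (\esum_(x in [set: X]) (h x)%:E))%:E = \esum_(x in [set: X]) (h x)%:E)%E.
Proof.
move=> h0 hoo; rewrite fineK// ge0_fin_numE//.
by apply: esum_ge0 => x _; rewrite lee_fin.
Qed.

Lemma esum_approx h e : (forall x, 0 <= h x) ->
  (\esum_(x in [set: X]) (h x)%:E < +oo)%E -> 0 < e ->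
  exists2 Y, uniq Y & forall Y', uniq Y' -> {subset Y <= Y'} ->
    `|fine (\esum_(x in [set: X]) (h x)%:E) - \sum_(y <- Y') h y| < e.
Proof.
move=> h0 hoo e0; have fE := fine_esum h0 hoo; set s := fine _ in fE *.
apply/not_exists2P => nY.
have : (\esum_(x in [set: X]) (h x)%:E <= (s - e)%:E)%E.
  apply: esum_le_fsum => Y uY; rewrite leNgt; apply/negP => sY.
  have [|] := nY Y; first by case.
  apply=> Y' uY' sub.
  have le1 := fsum_sub uY uY' sub h0.
  have : ((\sum_(y <- Y') h y)%:E <= s%:E)%E by rewrite fE fsum_le_esum.
  by rewrite lee_fin => le2; rewrite ltr_norml; apply/andP; split; lra.
by rewrite -fE lee_fin; lra.
Qed.

Definition abs_summable h := exists C, forall Y, uniq Y -> \sum_(y <- Y) `|h y| <= C.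

(** The positive and the negative part of h have finite sums, each of which is
    approximated by finite partial sums. *)
Lemma rsum_approx h e : abs_summable h -> 0 < e ->
  exists2 Y, uniq Y & forall Y', uniq Y' -> {subset Y <= Y'} ->
    `|rsum h - \sum_(y <- Y') h y| < e.
Proof.
move=> [C hC] e0.
have aux (g : X -> R) : (forall x, 0 <= g x <= `|h x|) ->
    exists2 Y, uniq Y & forall Y', uniq Y' -> {subset Y <= Y'} ->
    `|fine (\esum_(x in [set: X]) (g x)%:E) - \sum_(y <- Y') g y| < e / 2.
  move=> gh; apply: esum_approx; last by lra.
    by move=> x; case/andP: (gh x).
  apply: (@esum_fin_num _ C) => [x|Y uY]; first by case/andP: (gh x).
  by apply: le_trans (hC Y uY); apply: ler_sum => x _; case/andP: (gh x).
have [|Y1 uY1 H1] := aux (fun x => Num.max (h x) 0).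
  by move=> x; apply/andP; split; rewrite ?le_max ?ge_max ?lexx ?orbT// normr_ge0 ler_norm.
have [|Y2 uY2 H2] := aux (fun x => Num.max (- h x) 0).
  by move=> x; apply/andP; split; rewrite ?le_max ?ge_max ?lexx ?orbT// normr_ge0 -normrN ler_norm.
exists (undup (Y1 ++ Y2)); first exact: undup_uniq.
move=> Y' uY' sub.
have {}H1 : `|_| < _ := H1 Y' uY' _.
have {}H2 : `|_| < _ := H2 Y' uY' _.
have /H1 {}H1 : {subset Y1 <= Y'}.
  by move=> x xY; apply: sub; rewrite mem_undup mem_cat xY.
have /H2 {}H2 : {subset Y2 <= Y'}.
  by move=> x xY; apply: sub; rewrite mem_undup mem_cat xY orbT.
have -> : \sum_(y <- Y') h y =
    \sum_(y <- Y') Num.max (h y) 0 - \sum_(y <- Y') Num.max (- h y) 0.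
  rewrite -sumrB; apply: eq_bigr => y _.
  by rewrite !maxEle oppr_le0; case: (leP (h y) 0) => hy0; case: leP => ?; lra.
move: H1 H2; rewrite /rsum; set a := fine _; set b := fine _.
set c := \sum_(_ <- _) _; set d := \sum_(_ <- _) _.
rewrite !ltr_norml => /andP[? ?] /andP[? ?]; apply/andP; split; lra.
Qed.

End UnconditionalSums.

(** * The Hilbert space l^2 *)

Section Complex.
Variable R : realType.
Implicit Types (z w : R[i]).

Lemma normc_zero : normc (0 : R[i]) = 0. Proof. exact: normc0. Qed.

Lemma normc_zero2 : normc (0 : R[i]) ^+ 2 = 0.
Proof. by rewrite normc_zero expr0n. Qed.

Lemma normc_Re z : `|complex.Re z| <= normc z.
Proof.
case: z => a b /=; rewrite -sqrtr_sqr ler_wsqrtr//.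
by rewrite lerDl sqr_ge0.
Qed.

Lemma normc_Im z : `|complex.Im z| <= normc z.
Proof.
case: z => a b /=; rewrite -sqrtr_sqr ler_wsqrtr//.
by rewrite lerDr sqr_ge0.
Qed.

Lemma normc_le_ReIm z : normc z <= `|complex.Re z| + `|complex.Im z|.
Proof.
case: z => a b /=.
rewrite -(@ler_pXn2r _ 2) ?nnegrE ?sqrtr_ge0 ?addr_ge0//.
rewrite sqr_sqrtr ?addr_ge0 ?sqr_ge0//.
rewrite -[a ^+ 2]real_normK ?num_real// -[b ^+ 2]real_normK ?num_real//.
have : 0 <= `|a| * `|b| by rewrite mulr_ge0.
by nra.
Qed.

Lemma normc_conj z : normc z^* = normc z.
Proof. by case: z => a b /=; rewrite sqrrN. Qed.

Lemma conjcD z w : (z + w)^* = z^* + w^*. Proof. exact: rmorphD. Qed.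
Lemma conjcN z : (- z)^* = - z^*. Proof. exact: rmorphN. Qed.
Lemma conjcM z w : (z * w)^* = z^* * w^*. Proof. exact: rmorphM. Qed.

Lemma normc_near s z w d e : normc (z - s) <= d -> normc (w - s) <= e ->
  normc (z - w) <= d + e.
Proof.
move=> zs ws; have -> : z - w = (z - s) + - (w - s) by ring.
by apply: le_trans (le_normcD _ _) _; rewrite normcN; apply: lerD.
Qed.

Lemma normc_le0 z : normc z <= 0 -> z = 0.
Proof. by move=> z0; apply: eq0_normc; apply/le_anti; rewrite z0 normc_ge0. Qed.

Lemma normc_eps z : (forall e, 0 < e -> normc z <= e) -> z = 0.
Proof.
by move=> ze; apply: normc_le0; rewrite leNgt; apply/negP => z0;
  have := ze (normc z / 2); rewrite divr_gt0// => /(_ isT); lra.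
Qed.

Lemma normc_sum (I : Type) (s : seq I) (F : I -> R[i]) :
  normc (\sum_(i <- s) F i) <= \sum_(i <- s) normc (F i).
Proof.
elim/big_ind2: _ => [|a b c d ab cd|//]; first by rewrite normc0.
by apply: le_trans (le_normcD _ _) _; apply: lerD.
Qed.

Lemma mulc_conj z : z * z^* = (normc z ^+ 2)%:C.
Proof.
case: z => a b /=; rewrite sqr_sqrtr ?addr_ge0 ?sqr_ge0//.
by apply/eqP; rewrite eq_complex /=; apply/andP; split; apply/eqP; ring.
Qed.

Lemma ReB z w : complex.Re (z - w) = complex.Re z - complex.Re w.
Proof. by case: z w => a b []. Qed.
Lemma ImB z w : complex.Im (z - w) = complex.Im z - complex.Im w.
Proof. by case: z w => a b []. Qed.

(** The cone of nonnegative complex numbers is closed; this turns approximate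
    positivity of matrices of operators into positivity. *)
Lemma complex_ge0_eps z :
  (forall e, 0 < e -> exists2 w, 0 <= w & normc (z - w) <= e) -> 0 <= z.
Proof.
move=> H; rewrite lecE /=; apply/andP; split.
  rewrite -normr_le0 leNgt; apply/negP => z0.
  have [|w] := H (`|complex.Im z| / 2); first by lra.
  rewrite lecE /= => /andP[/eqP w0 _] /(le_trans (normc_Im _)).
  by rewrite ImB w0 subr0; lra.
rewrite leNgt; apply/negP => z0.
have [|w] := H (- complex.Re z / 2); first by lra.
rewrite lecE /= => /andP[_ w0] /(le_trans (normc_Re _)).
by rewrite ReB; have := ler_norm (- (complex.Re z - complex.Re w)); rewrite normrN; lra.
Qed.

End Complex.

Section FiniteCauchySchwarz.
Variables (R : realType) (I : Type).
Implicit Types (s : seq I) (a b : I -> R).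

Lemma fsum_cauchy s a b : (forall i, 0 <= a i) -> (forall i, 0 <= b i) ->
  \sum_(i <- s) a i * b i <=
  Num.sqrt (\sum_(i <- s) a i ^+ 2) * Num.sqrt (\sum_(i <- s) b i ^+ 2).
Proof.
move=> a0 b0; elim: s => [|i s IH]; first by rewrite !big_nil sqrtr0 mul0r.
rewrite !big_cons.
have A0 : 0 <= \sum_(i <- s) a i ^+ 2 by apply: sumr_ge0 => j _; rewrite sqr_ge0.
have B0 : 0 <= \sum_(i <- s) b i ^+ 2 by apply: sumr_ge0 => j _; rewrite sqr_ge0.
move: A0 B0 IH; set A := \sum_(_ <- _) _; set B := \sum_(_ <- _) _.
set S := \sum_(_ <- _) _ => A0 B0 IH.
rewrite -sqrtrM ?addr_ge0 ?sqr_ge0//.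
have [x0 y0] := (sqrtr_ge0 A, sqrtr_ge0 B).
have [xA yB] := (sqr_sqrtr A0, sqr_sqrtr B0).
set x := Num.sqrt A in IH x0 xA *; set y := Num.sqrt B in IH y0 yB *.
apply: (@le_trans _ _ (a i * b i + x * y)); first by rewrite lerD2l.
have ab0 : 0 <= a i * b i + x * y by rewrite addr_ge0// mulr_ge0.
rewrite -[leLHS]ger0_norm// -sqrtr_sqr ler_wsqrtr// -xA -yB -subr_ge0.
have -> : (a i ^+ 2 + x ^+ 2) * (b i ^+ 2 + y ^+ 2) - (a i * b i + x * y) ^+ 2
   = (a i * y - b i * x) ^+ 2 by ring.
exact: sqr_ge0.
Qed.

Lemma fsum_minkowski s a b : (forall i, 0 <= a i) -> (forall i, 0 <= b i) ->
  Num.sqrt (\sum_(i <- s) (a i + b i) ^+ 2) <=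
  Num.sqrt (\sum_(i <- s) a i ^+ 2) + Num.sqrt (\sum_(i <- s) b i ^+ 2).
Proof.
move=> a0 b0; have := fsum_cauchy s a0 b0.
have A0 : 0 <= \sum_(i <- s) a i ^+ 2 by apply: sumr_ge0 => j _; rewrite sqr_ge0.
have B0 : 0 <= \sum_(i <- s) b i ^+ 2 by apply: sumr_ge0 => j _; rewrite sqr_ge0.
have -> : \sum_(i <- s) (a i + b i) ^+ 2 = \sum_(i <- s) a i ^+ 2 +
    2 * (\sum_(i <- s) a i * b i) + \sum_(i <- s) b i ^+ 2.
  by rewrite mulr_sumr -!big_split /=; apply: eq_bigr => i _; ring.
move: A0 B0; set A := \sum_(_ <- _) _; set B := \sum_(_ <- _) _.
set S := \sum_(_ <- _) _ => A0 B0 AB.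
have [x0 y0] := (sqrtr_ge0 A, sqrtr_ge0 B).
rewrite -[leRHS]ger0_norm ?addr_ge0// -sqrtr_sqr ler_wsqrtr//.
by rewrite sqrrD !sqr_sqrtr// -addrA -[leRHS]addrA lerD2l lerD2r; lra.
Qed.

End FiniteCauchySchwarz.

Section Coordinates.
Variables (R : realType) (X : choiceType).
Implicit Types (f g h : l2 R X) (x y : X) (Y : seq X).

(** Coordinates are read in the field R[i] and not in its regular module, so
    that they can be multiplied and conjugated. *)
Definition cf f x : R[i] := val f x.

Lemma l2P f g : cf f =1 cf g -> f = g.
Proof. by move=> fg; apply/val_inj/funext => x; exact: fg. Qed.

Lemma cfD f g x : cf (f + g) x = cf f x + cf g x. Proof. by []. Qed.
Lemma cfZ k f x : cf (k *: f) x = k * cf f x. Proof. by []. Qed.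
Lemma cfB f g x : cf (f - g) x = cf f x - cf g x. Proof. by []. Qed.
Lemma cf0 x : cf 0 x = 0. Proof. by []. Qed.
Lemma cf_delta x y : cf (delta R x) y = (y == x)%:R. Proof. by []. Qed.

Lemma cf_sum (I : Type) (s : seq I) (F : I -> l2 R X) x :
  cf (\sum_(i <- s) F i) x = \sum_(i <- s) cf (F i) x.
Proof. by elim/big_rec2: _ => [//|i u v _ <-]. Qed.

Lemma l2norm_ge0 f : 0 <= l2norm f. Proof. exact: sqrtr_ge0. Qed.

Lemma l2norm_fin f : (\esum_(x in [set: X]) (normc (cf f x) ^+ 2)%:E < +oo)%E.
Proof. exact: (set_valP f). Qed.

Lemma l2norm_sqr f :
  l2norm f ^+ 2 = fine (\esum_(x in [set: X]) (normc (cf f x) ^+ 2)%:E).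
Proof.
rewrite /l2norm sqr_sqrtr// fine_ge0// esum_ge0// => x _.
by rewrite lee_fin sqr_ge0.
Qed.

Lemma l2norm_fsum f Y : uniq Y ->
  \sum_(y <- Y) normc (cf f y) ^+ 2 <= l2norm f ^+ 2.
Proof.
move=> uY; rewrite -lee_fin l2norm_sqr fine_esum ?l2norm_fin//.
  by apply: fsum_le_esum => // x; rewrite sqr_ge0.
by move=> x; rewrite sqr_ge0.
Qed.

Lemma l2norm_fsqrt f Y : uniq Y ->
  Num.sqrt (\sum_(y <- Y) normc (cf f y) ^+ 2) <= l2norm f.
Proof.
move=> uY; rewrite -[leRHS]ger0_norm ?l2norm_ge0// -sqrtr_sqr ler_wsqrtr//.
exact: l2norm_fsum.
Qed.

Lemma l2norm_le f C : 0 <= C ->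
  (forall Y, uniq Y -> \sum_(y <- Y) normc (cf f y) ^+ 2 <= C ^+ 2) ->
  l2norm f <= C.
Proof.
move=> C0 hC; rewrite -(@ler_pXn2r _ 2) ?nnegrE ?l2norm_ge0// l2norm_sqr.
rewrite -lee_fin fine_esum ?l2norm_fin//; first exact: esum_le_fsum.
by move=> x; rewrite sqr_ge0.
Qed.

Lemma l2norm_approx f e : 0 < e -> exists2 Y, uniq Y &
  forall Y', uniq Y' -> {subset Y <= Y'} ->
  `|l2norm f ^+ 2 - \sum_(y <- Y') normc (cf f y) ^+ 2| < e.
Proof.
move=> e0; rewrite l2norm_sqr; apply: esum_approx => //; last exact: l2norm_fin.
by move=> x; rewrite sqr_ge0.
Qed.

Lemma cf_le f x : normc (cf f x) <= l2norm f.
Proof.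
have := @l2norm_fsqrt f [:: x] isT.
by rewrite big_seq1 sqrtr_sqr ger0_norm// normc_ge0.
Qed.

Lemma l2norm0 : l2norm (0 : l2 R X) = 0.
Proof.
apply/le_anti/andP; split; last exact: l2norm_ge0.
apply: l2norm_le => // Y _; rewrite big1 ?expr0n// => y _.
by rewrite cf0 normc0 expr0n.
Qed.

Lemma l2norm_eq0 f : l2norm f <= 0 -> f = 0.
Proof.
by move=> f0; apply: l2P => x; apply: normc_le0; apply: le_trans (cf_le f x) f0.
Qed.

Lemma l2normZ k f : l2norm (k *: f) = normc k * l2norm f.
Proof.
have le1 k' f' : l2norm (k' *: f') <= normc k' * l2norm f'.
  apply: l2norm_le => [|Y uY]; first by rewrite mulr_ge0 ?normc_ge0 ?l2norm_ge0.
  under eq_bigr => y _ do rewrite cfZ normcM exprMn.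
  by rewrite -mulr_sumr exprMn ler_wpM2l ?sqr_ge0// l2norm_fsum.
apply/le_anti/andP; split=> //.
have [->|k0] := eqVneq k 0; first by rewrite normc0 mul0r l2norm_ge0.
have -> : l2norm f = l2norm (k^-1 *: (k *: f)) by rewrite scalerA mulVf// scale1r.
apply: (@le_trans _ _ (normc k * (normc k^-1 * l2norm (k *: f)))).
  by rewrite ler_wpM2l ?normc_ge0.
by rewrite mulrA -normcM divff// normc1 mul1r.
Qed.

Lemma l2normN f : l2norm (- f) = l2norm f.
Proof. by rewrite -scaleN1r l2normZ normcN normc1 mul1r. Qed.

Lemma l2normD f g : l2norm (f + g) <= l2norm f + l2norm g.
Proof.
apply: l2norm_le => [|Y uY]; first by rewrite addr_ge0 ?l2norm_ge0.
set S := \sum_(_ <- _) _.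
have S0 : 0 <= S by apply: sumr_ge0 => i _; rewrite sqr_ge0.
rewrite -[leLHS]sqr_sqrtr// lerXn2r ?nnegrE ?sqrtr_ge0 ?addr_ge0 ?l2norm_ge0//.
apply: (@le_trans _ _ (Num.sqrt (\sum_(y <- Y) (normc (cf f y) + normc (cf g y)) ^+ 2))).
  rewrite ler_wsqrtr//; apply: ler_sum => y _.
  by rewrite lerXn2r ?nnegrE ?addr_ge0 ?normc_ge0// cfD le_normcD.
apply: le_trans (fsum_minkowski _ _ _) _ => [y|y|]; try exact: normc_ge0.
by apply: lerD; exact: l2norm_fsqrt.
Qed.

Lemma l2normB f g : l2norm (f - g) = l2norm (g - f).
Proof. by rewrite -opprB l2normN. Qed.

Lemma square_summableP (u : X -> R[i]) C :
  (forall Y, uniq Y -> \sum_(y <- Y) normc (u y) ^+ 2 <= C) ->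
  (u : X -> R[i]^o) \in @square_summable R X.
Proof.
by move=> uC; rewrite inE; apply: esum_fin_num uC => x; rewrite sqr_ge0.
Qed.

(** A total constructor; the value 0 is only returned when the finite partial
    sums of the squares are unbounded. *)
Definition l2of (u : X -> R[i]) : l2 R X :=
  if pselect ((u : X -> R[i]^o) \in @square_summable R X) is left uP
  then SigSub uP else 0.

Lemma cf_l2of u C : (forall Y, uniq Y -> \sum_(y <- Y) normc (u y) ^+ 2 <= C) ->
  cf (l2of u) =1 u.
Proof. by move=> /square_summableP uP x; rewrite /l2of; case: pselect. Qed.

End Coordinates.

Section InnerProduct.
Variables (R : realType) (X : choiceType).
Implicit Types (f g h : l2 R X) (x y : X) (Y : seq X).

Lemma fdot_le f g Y : uniq Y ->
  \sum_(y <- Y) normc (cf f y) * normc (cf g y) <= l2norm f * l2norm g.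
Proof.
move=> uY; apply: le_trans (fsum_cauchy _ _ _) _ => [y|y|]; try exact: normc_ge0.
by apply: ler_pM; rewrite ?sqrtr_ge0//; exact: l2norm_fsqrt.
Qed.

(** Every identity or estimate for the inner product below is obtained from
    the corresponding statement for finite partial sums through this
    approximation. *)
Lemma l2dot_approx f g e : 0 < e -> exists2 Y, uniq Y &
  forall Y', uniq Y' -> {subset Y <= Y'} ->
  normc (l2dot f g - \sum_(y <- Y') cf f y * (cf g y)^*) < e.
Proof.
move=> e0; have e20 : 0 < e / 2 by lra.
have summ (p : R[i] -> R) : (forall z, `|p z| <= normc z) ->
    abs_summable (fun x => p (cf f x * (cf g x)^*)).
  move=> hp; exists (l2norm f * l2norm g) => Y uY.
  apply: le_trans (fdot_le f g uY); apply: ler_sum => y _.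
  by apply: le_trans (hp _) _; rewrite normcM normc_conj.
have [Y1 uY1 H1] := rsum_approx (summ _ (@normc_Re R)) e20.
have [Y2 uY2 H2] := rsum_approx (summ _ (@normc_Im R)) e20.
exists (undup (Y1 ++ Y2)); first exact: undup_uniq.
move=> Y' uY' sub.
have {}H1 : `|_| < _ := H1 Y' uY' _.
have {}H2 : `|_| < _ := H2 Y' uY' _.
have /H1 {}H1 : {subset Y1 <= Y'}.
  by move=> x xY; apply: sub; rewrite mem_undup mem_cat xY.
have /H2 {}H2 : {subset Y2 <= Y'}.
  by move=> x xY; apply: sub; rewrite mem_undup mem_cat xY orbT.
apply: le_lt_trans (normc_le_ReIm _) _.
have Rebig (F : X -> R[i]) : complex.Re (\sum_(y <- Y') F y) = \sum_(y <- Y') complex.Re (F y).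
  by elim/big_rec2: _ => [//|i u v _ <-]; case: (F i) v => a b [].
have Imbig (F : X -> R[i]) : complex.Im (\sum_(y <- Y') F y) = \sum_(y <- Y') complex.Im (F y).
  by elim/big_rec2: _ => [//|i u v _ <-]; case: (F i) v => a b [].
by rewrite ReB ImB Rebig Imbig; move: H1 H2; rewrite /l2dot /csum /= => ? ?; lra.
Qed.

Lemma l2dot_uniq f g z :
  (forall Y, uniq Y -> exists2 Y', uniq Y' & {subset Y <= Y'} /\
    \sum_(y <- Y') cf f y * (cf g y)^* = z) -> l2dot f g = z.
Proof.
move=> H; apply/eqP; rewrite -subr_eq0; apply/eqP/normc_eps => e e0.
have [Y uY HY] := l2dot_approx f g e0.
by have [Y' uY' [sub <-]] := H Y uY; apply/ltW/HY.
Qed.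

Lemma l2dot_cat f g f' g' e : 0 < e -> exists2 Y, uniq Y &
  forall Y', uniq Y' -> {subset Y <= Y'} ->
  normc (l2dot f g - \sum_(y <- Y') cf f y * (cf g y)^*) < e /\
  normc (l2dot f' g' - \sum_(y <- Y') cf f' y * (cf g' y)^*) < e.
Proof.
move=> e0; have [Y1 _ H1] := l2dot_approx f g e0.
have [Y2 _ H2] := l2dot_approx f' g' e0.
exists (undup (Y1 ++ Y2)); first exact: undup_uniq.
move=> Y' uY' sub; split; [apply: H1 => // x xY|apply: H2 => // x xY];
  by apply: sub; rewrite mem_undup mem_cat xY ?orbT.
Qed.

Lemma l2dotPl k f g h : l2dot (k *: f + g) h = k * l2dot f h + l2dot g h.
Proof.
apply/eqP; rewrite -subr_eq0; apply/eqP/normc_eps => e e0.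
pose d := e / (normc k + 2).
have k2 : 0 < normc k + 2 by have := normc_ge0 k; lra.
have d0 : 0 < d by rewrite divr_gt0.
have [Y1 _ H1] := l2dot_approx (k *: f + g) h d0.
have [Y2 _ H2] := l2dot_cat f h g h d0.
pose Y := undup (Y1 ++ Y2).
have [||{}H2 H3] := H2 Y; first exact: undup_uniq.
  by move=> x xY; rewrite mem_undup mem_cat xY orbT.
have {}H1 : normc _ < _ := H1 Y (undup_uniq _) _.
have /H1 {}H1 : {subset Y1 <= Y} by move=> x xY; rewrite mem_undup mem_cat xY.
move: H1 H2 H3; under eq_bigr => y _ do rewrite cfD cfZ mulrDl -mulrA.
rewrite big_split /= -mulr_sumr.
set a := l2dot _ _; set b := l2dot _ _; set c := l2dot _ _.
set B := \sum_(_ <- _) _; set C := \sum_(_ <- _) _ => H1 H2 H3.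
have -> : a - (k * b + c) = (a - (k * B + C)) + (- k * (b - B) - (c - C)).
  by ring.
apply: le_trans (le_normcD _ _) _.
apply: (@le_trans _ _ (d + (normc k * d + d))); last first.
  by rewrite le_eqVlt; apply/orP; left; apply/eqP; rewrite /d; field; rewrite gt_eqF.
apply: lerD; first exact: ltW.
apply: le_trans (le_normcD _ _) _; rewrite normcM !normcN.
by apply: lerD; [apply: ler_wpM2l; rewrite ?normc_ge0//|]; exact: ltW.
Qed.

Lemma l2dotC f g : l2dot g f = (l2dot f g)^*.
Proof.
apply/eqP; rewrite -subr_eq0; apply/eqP/normc_eps => e e0.
have e20 : 0 < e / 2 by lra.
have [Y uY /(_ _ uY) [//|H1 H2]] := l2dot_cat f g g f e20.
move: H1 H2; set A := \sum_(_ <- _) _; set B := \sum_(_ <- _) _.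
have -> : B = A^*.
  rewrite /A rmorph_sum; apply: eq_bigr => y _.
  by rewrite [RHS]conjcM conjCK mulrC.
move=> H1 H2; have {}H1 : normc ((l2dot f g)^* - A^*) < e / 2.
  by rewrite -conjcN -conjcD normc_conj.
have -> : l2dot g f - (l2dot f g)^* =
  (l2dot g f - A^*) + - ((l2dot f g)^* - A^*) by ring.
by apply: le_trans (le_normcD _ _) _; rewrite normcN; lra.
Qed.

Lemma l2dotDl f g h : l2dot (f + g) h = l2dot f h + l2dot g h.
Proof. by have := l2dotPl 1 f g h; rewrite scale1r mul1r. Qed.
Lemma l2dot0l h : l2dot 0 h = 0.
Proof.
have := l2dotPl 1 0 0 h; rewrite scaler0 addr0 mul1r => /eqP.
by rewrite -subr_eq subrr => /eqP <-.
Qed.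
Lemma l2dotZl k f h : l2dot (k *: f) h = k * l2dot f h.
Proof. by have := l2dotPl k f 0 h; rewrite addr0 l2dot0l addr0. Qed.
Lemma l2dotNl f h : l2dot (- f) h = - l2dot f h.
Proof. by rewrite -scaleN1r l2dotZl mulN1r. Qed.
Lemma l2dotBl f g h : l2dot (f - g) h = l2dot f h - l2dot g h.
Proof. by rewrite l2dotDl l2dotNl. Qed.
Lemma l2dotDr f g h : l2dot h (f + g) = l2dot h f + l2dot h g.
Proof. by rewrite l2dotC l2dotDl conjcD -!l2dotC. Qed.
Lemma l2dotNr f h : l2dot h (- f) = - l2dot h f.
Proof. by rewrite l2dotC l2dotNl conjcN -l2dotC. Qed.
Lemma l2dotBr f g h : l2dot h (f - g) = l2dot h f - l2dot h g.
Proof. by rewrite l2dotDr l2dotNr. Qed.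
Lemma l2dotZr k f h : l2dot h (k *: f) = k^* * l2dot h f.
Proof. by rewrite l2dotC l2dotZl conjcM -l2dotC. Qed.
Lemma l2dot0r h : l2dot h 0 = 0.
Proof. by rewrite l2dotC l2dot0l conjC0. Qed.

Lemma l2_cauchy_schwarz f g : normc (l2dot f g) <= l2norm f * l2norm g.
Proof.
rewrite leNgt; apply/negP => lt.
have e0 : 0 < normc (l2dot f g) - l2norm f * l2norm g by lra.
have [Y uY /(_ _ uY) /(_ (fun _ => id))] := l2dot_approx f g e0.
have := fdot_le f g uY; set S := \sum_(_ <- _) _; set A := \sum_(_ <- _) _ => leS.
have leA : normc A <= S.
  apply: le_trans (normc_sum _ _) _; apply: ler_sum => y _.
  by rewrite normcM normc_conj.
have := le_normcD (l2dot f g - A) A; rewrite subrK; lra.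
Qed.

Lemma l2dotxx f : l2dot f f = (l2norm f ^+ 2)%:C.
Proof.
apply/eqP; rewrite -subr_eq0; apply/eqP/normc_eps => e e0.
have e20 : 0 < e / 2 by lra.
have [Y1 _ H1] := l2dot_approx f f e20.
have [Y2 _ H2] := l2norm_approx f e20.
pose Y := undup (Y1 ++ Y2); have uY : uniq Y by exact: undup_uniq.
have {}H1 : normc _ < _ := H1 Y uY _.
have {}H2 : `|_| < _ := H2 Y uY _.
have /H1 {}H1 : {subset Y1 <= Y} by move=> x xY; rewrite mem_undup mem_cat xY.
have /H2 {}H2 : {subset Y2 <= Y} by move=> x xY; rewrite mem_undup mem_cat xY orbT.
move: H1 H2; under eq_bigr => y _ do rewrite mulc_conj.
rewrite -rmorph_sum; set S := \sum_(_ <- _) _ => H1 H2.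
have -> : l2dot f f - (l2norm f ^+ 2)%:C =
  (l2dot f f - S%:C) + (S - l2norm f ^+ 2)%:C by rewrite rmorphB /=; ring.
apply: le_trans (le_normcD _ _) _.
have nR (r : R) : normc r%:C = `|r| by rewrite /= expr0n addr0 sqrtr_sqr.
by rewrite nR distrC; lra.
Qed.

End InnerProduct.

(** * Operators on l^2 *)

Section Transport.
Variables (R : realType) (X Y : choiceType) (j : X -> Y).
Hypothesis jI : injective j.

Definition preim_of (y : Y) : option X :=
  if pselect (exists x, j x = y) is left h then Some (sval (cid h)) else None.

Lemma preim_ofK : pcancel j preim_of.
Proof.
move=> x; rewrite /preim_of; case: pselect => [h|[]]; last by exists x.
by congr Some; apply: jI; case: cid.
Qed.

Lemma preim_of_oK : ocancel preim_of j.
Proof. by move=> y; rewrite /preim_of; case: pselect => //= h; case: cid. Qed.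

Lemma preim_of_out y : ~ (exists x, j x = y) -> preim_of y = None.
Proof. by rewrite /preim_of; case: pselect. Qed.

Lemma fsum_preim (V : zmodType) (F : Y -> V) (G : X -> V) (s : seq Y) :
  (forall x, F (j x) = G x) -> (forall y, ~ (exists x, j x = y) -> F y = 0) ->
  \sum_(y <- s) F y = \sum_(x <- pmap preim_of s) G x.
Proof.
move=> FG F0; elim: s => [|y s IH]; first by rewrite !big_nil.
rewrite big_cons /= {}IH; have [[x <-]|ny] := pselect (exists x, j x = y).
  by rewrite preim_ofK /= big_cons FG.
by rewrite (preim_of_out ny) /= F0// add0r.
Qed.

Lemma uniq_preim (s : seq Y) : uniq s -> uniq (pmap preim_of s).
Proof. exact: (pmap_uniq preim_of_oK). Qed.

Lemma mem_preim (s : seq Y) x : (x \in pmap preim_of s) = (j x \in s).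
Proof.
rewrite mem_pmap; apply/mapP/idP => [[y ys jy]|xs].
  by have := preim_of_oK y; rewrite -jy /= => ->.
by exists (j x) => //; rewrite preim_ofK.
Qed.

(** The isometry of l^2 spaces induced by an injection of bases, and its
    adjoint, the restriction map. *)
Definition push (f : l2 R X) : l2 R Y := l2of (fun y => oapp (cf f) 0 (preim_of y)).
Definition pull (g : l2 R Y) : l2 R X := l2of (fun x => cf g (j x)).

Lemma cf_push_sum (f : l2 R X) s : uniq s ->
  \sum_(y <- s) normc (oapp (cf f) 0 (preim_of y)) ^+ 2 <= l2norm f ^+ 2.
Proof.
move=> us; rewrite (@fsum_preim _ _ (fun x => normc (cf f x) ^+ 2)).
- by apply: l2norm_fsum; exact: uniq_preim.
- by move=> x; rewrite preim_ofK.
- by move=> y /preim_of_out ->; exact: normc_zero2.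
Qed.

Lemma cf_pushE (f : l2 R X) y : cf (push f) y = oapp (cf f) 0 (preim_of y).
Proof. exact: (cf_l2of (cf_push_sum f)). Qed.

Lemma cf_push (f : l2 R X) x : cf (push f) (j x) = cf f x.
Proof. by rewrite cf_pushE preim_ofK. Qed.

Lemma cf_push0 (f : l2 R X) y : ~ (exists x, j x = y) -> cf (push f) y = 0.
Proof. by move=> ny; rewrite cf_pushE preim_of_out. Qed.

Lemma cf_pull (g : l2 R Y) x : cf (pull g) x = cf g (j x).
Proof.
rewrite (@cf_l2of _ _ _ (l2norm g ^+ 2))// => s us.
by rewrite -(big_map j xpredT (fun y => normc (cf g y) ^+ 2)) l2norm_fsum// map_inj_uniq.
Qed.

Lemma push_linear : linear push.
Proof.
move=> k f g; apply: l2P => y; rewrite cfD cfZ !cf_pushE.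
by case: preim_of => [x|] /=; rewrite ?cfD ?cfZ// mulr0 addr0.
Qed.

Lemma pull_linear : linear pull.
Proof. by move=> k f g; apply: l2P => x; rewrite cfD cfZ !cf_pull. Qed.

Lemma pushK : cancel push pull.
Proof. by move=> f; apply: l2P => x; rewrite cf_pull cf_push. Qed.

Lemma pull_norm (g : l2 R Y) : l2norm (pull g) <= l2norm g.
Proof.
apply: l2norm_le => [|s us]; first exact: l2norm_ge0.
under eq_bigr => x _ do rewrite cf_pull.
by rewrite -(big_map j xpredT (fun y => normc (cf g y) ^+ 2)) l2norm_fsum// map_inj_uniq.
Qed.

Lemma push_norm (f : l2 R X) : l2norm (push f) = l2norm f.
Proof.
apply/le_anti/andP; split; last by rewrite -{1}[f]pushK; exact: pull_norm.
apply: l2norm_le => [|s us]; first exact: l2norm_ge0.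
by under eq_bigr => y _ do rewrite cf_pushE; exact: cf_push_sum.
Qed.

Lemma push_delta x : push (delta R x) = delta R (j x).
Proof.
apply: l2P => y; have [[x' <-]|ny] := pselect (exists x, j x = y).
  by rewrite cf_push !cf_delta (inj_eq jI).
rewrite cf_push0// cf_delta; case: eqP => // yE; case: ny; by exists x.
Qed.

(** Both inner products are the sum over the image of j. *)
Lemma push_adjoint f g : l2dot (push f) g = l2dot f (pull g).
Proof.
apply/eqP; rewrite -subr_eq0; apply/eqP/normc_eps => e e0.
have e20 : 0 < e / 2 by lra.
have [Y2 _ H2] := l2dot_approx (push f) g e20.
have [X1 _ H1] := l2dot_approx f (pull g) e20.
pose Y' := undup (Y2 ++ map j X1).
have uY' : uniq Y' by exact: undup_uniq.
have {}H2 : normc _ < _ := H2 Y' uY' _.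
have /H2 {}H2 : {subset Y2 <= Y'} by move=> y yY; rewrite mem_undup mem_cat yY.
have {}H1 : normc _ < _ := H1 _ (uniq_preim uY') _.
have /H1 {}H1 : {subset X1 <= pmap preim_of Y'}.
  by move=> x xX; rewrite mem_preim mem_undup mem_cat (map_f j xX) orbT.
move: H2; rewrite (@fsum_preim _ _ (fun x => cf f x * (cf (pull g) x)^*)).
- by move=> H2; have := normc_near (ltW H2) (ltW H1); lra.
- by move=> x; rewrite cf_push cf_pull.
- by move=> y ny; rewrite cf_push0// mul0r.
Qed.

End Transport.

Section Operators.
Variables (R : realType) (X : choiceType).
Implicit Types (a b : l2 R X -> l2 R X) (f g : l2 R X).

Lemma lin0 (U V : lmodType R[i]) (a : U -> V) : linear a -> a 0 = 0.
Proof.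
by move=> la; have := la (-1) 0 0; rewrite scaler0 addr0 scaleN1r addNr.
Qed.

Lemma linD (U V : lmodType R[i]) (a : U -> V) (f g : U) : linear a -> a (f + g) = a f + a g.
Proof. by move=> la; have := la 1 f g; rewrite !scale1r. Qed.

Lemma linZ (U V : lmodType R[i]) (a : U -> V) k (f : U) : linear a -> a (k *: f) = k *: a f.
Proof. by move=> la; have := la k f 0; rewrite !addr0 (lin0 la) addr0. Qed.

Lemma linB (U V : lmodType R[i]) (a : U -> V) (f g : U) : linear a -> a (f - g) = a f - a g.
Proof. by move=> la; rewrite -scaleN1r (linD _ _ la) (linZ _ _ la) scaleN1r. Qed.

Lemma opnorm_has_sup a : bounded_op R X a ->
  has_sup [set l2norm (a f) | f in [set f | l2norm f <= 1]].
Proof.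
case=> la [c hc]; split.
  by exists (l2norm (a 0)), 0 => //=; rewrite l2norm0.
exists `|c| => _ [f /= f1 <-]; apply: le_trans (hc f) _.
apply: (@le_trans _ _ (`|c| * l2norm f)).
  by rewrite ler_wpM2r ?l2norm_ge0// ler_norm.
by rewrite ler_piMr.
Qed.

Lemma opnorm_ge0 a : bounded_op R X a -> 0 <= opnorm a.
Proof.
move=> ba; have ub := sup_upper_bound (opnorm_has_sup ba).
by apply: le_trans (l2norm_ge0 (a 0)) (ub _ _); exists 0 => //=; rewrite l2norm0.
Qed.

Lemma opnorm_ub a f : bounded_op R X a -> l2norm (a f) <= opnorm a * l2norm f.
Proof.
move=> ba; have la := ba.1; have [f0|f0] := leP (l2norm f) 0.
  by rewrite (l2norm_eq0 f0) (lin0 la) !l2norm0 mulr0.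
have nR (r : R) : normc r%:C = `|r| by rewrite /= expr0n addr0 sqrtr_sqr.
pose g := (l2norm f)^-1%:C *: f.
have g1 : l2norm g = 1.
  by rewrite l2normZ nR ger0_norm ?invr_ge0 ?l2norm_ge0// mulVf// gt_eqF.
have : l2norm (a g) <= opnorm a.
  by apply: sup_upper_bound; [exact: opnorm_has_sup|exists g => //=; rewrite g1].
rewrite (linZ _ _ la) l2normZ nR ger0_norm ?invr_ge0 ?l2norm_ge0//.
by rewrite ler_pdivrMl// mulrC.
Qed.

Lemma opnorm_le a c : 0 <= c -> (forall f, l2norm (a f) <= c * l2norm f) ->
  opnorm a <= c.
Proof.
move=> c0 hc; apply: ge_sup.
  by exists (l2norm (a 0)), 0 => //=; rewrite l2norm0.
move=> _ [f /= f1 <-]; apply: le_trans (hc f) _.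
by rewrite ler_piMr.
Qed.

Lemma bounded0 : bounded_op R X 0.
Proof.
split; first by move=> k f g; rewrite /GRing.zero /= scaler0 addr0.
by exists 0 => f; rewrite l2norm0 mul0r.
Qed.

Lemma bounded_comb k a b : bounded_op R X a -> bounded_op R X b ->
  bounded_op R X (k *: a + b).
Proof.
move=> ba bb; split.
  move=> k' f g; rewrite !fctE ba.1 bb.1 !scalerDr !scalerA mulrC.
  by rewrite -!addrA; congr (_ + _); rewrite addrCA.
exists (normc k * opnorm a + opnorm b) => f; rewrite !fctE.
apply: le_trans (l2normD _ _) _; rewrite l2normZ mulrDl -mulrA.
by apply: lerD; rewrite ?ler_wpM2l ?normc_ge0//; exact: opnorm_ub.
Qed.

Lemma boundedB a b : bounded_op R X a -> bounded_op R X b -> bounded_op R X (a - b).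
Proof. by move=> ba bb; rewrite addrC -scaleN1r; exact: bounded_comb. Qed.

Lemma bounded_comp a b : bounded_op R X a -> bounded_op R X b -> bounded_op R X (a \o b).
Proof.
move=> ba bb; split; first by move=> k f g /=; rewrite bb.1 ba.1.
exists (opnorm a * opnorm b) => f /=; apply: le_trans (opnorm_ub _ ba) _.
by rewrite -mulrA ler_wpM2l ?opnorm_ge0//; exact: opnorm_ub.
Qed.

Lemma opnormD a b : bounded_op R X a -> bounded_op R X b ->
  opnorm (a + b) <= opnorm a + opnorm b.
Proof.
move=> ba bb; apply: opnorm_le => [|f]; first by rewrite addr_ge0 ?opnorm_ge0.
rewrite fctE mulrDl; apply: le_trans (l2normD _ _) _.
by apply: lerD; exact: opnorm_ub.
Qed.

Lemma opnormC a b : opnorm (a - b) = opnorm (b - a).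
Proof.
rewrite /opnorm; congr sup; apply: eq_imagel => f _.
by rewrite !fctE l2normB.
Qed.

Lemma opnormZ k a : bounded_op R X a -> opnorm (k *: a) <= normc k * opnorm a.
Proof.
move=> ba; apply: opnorm_le => [|f]; first by rewrite mulr_ge0 ?normc_ge0 ?opnorm_ge0.
by rewrite fctE l2normZ -mulrA ler_wpM2l ?normc_ge0//; exact: opnorm_ub.
Qed.

Lemma opnorm_comp a b : bounded_op R X a -> bounded_op R X b ->
  opnorm (a \o b) <= opnorm a * opnorm b.
Proof.
move=> ba bb; apply: opnorm_le => [|f /=]; first by rewrite mulr_ge0 ?opnorm_ge0.
apply: le_trans (opnorm_ub _ ba) _.
by rewrite -mulrA ler_wpM2l ?opnorm_ge0//; exact: opnorm_ub.
Qed.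

Lemma adjoint_sym a b : is_adjoint a b -> is_adjoint b a.
Proof. by move=> ab f g; rewrite l2dotC -ab -l2dotC. Qed.

(** From |b f|^2 = <f, a (b f)> and the Cauchy-Schwarz inequality. *)
Lemma adjoint_opnorm a b : bounded_op R X a -> bounded_op R X b ->
  is_adjoint a b -> opnorm b <= opnorm a.
Proof.
move=> ba bb ab; apply: opnorm_le => [|f]; first exact: opnorm_ge0.
have [z|p] := leP (l2norm (b f)) 0.
  by apply: le_trans z _; rewrite mulr_ge0 ?opnorm_ge0 ?l2norm_ge0.
rewrite -(ler_pM2l p) -expr2.
have nR (r : R) : normc r%:C = `|r| by rewrite /= expr0n addr0 sqrtr_sqr.
rewrite -[leLHS]ger0_norm ?sqr_ge0// -nR -l2dotxx ab.
apply: le_trans (l2_cauchy_schwarz _ _) _.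
apply: (@le_trans _ _ (l2norm f * (opnorm a * l2norm (b f)))).
  by rewrite ler_wpM2l ?l2norm_ge0//; exact: opnorm_ub.
by rewrite le_eqVlt; apply/orP; left; apply/eqP; ring.
Qed.

End Operators.

Section Truncation.
Variables (R : realType) (X : choiceType).
Implicit Types (a b : l2 R X -> l2 R X) (f g : l2 R X) (s Y : seq X).

Definition trunc s f : l2 R X := l2of (fun x => if x \in s then cf f x else 0).

Lemma cf_trunc s f x : cf (trunc s f) x = if x \in s then cf f x else 0.
Proof.
rewrite (@cf_l2of _ _ _ (l2norm f ^+ 2))// => Y uY.
apply: le_trans (l2norm_fsum f uY); apply: ler_sum => y _.
by case: ifP => // _; rewrite normc_zero2 sqr_ge0.
Qed.

Lemma trunc_norm s f : l2norm (trunc s f) <= l2norm f.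
Proof.
apply: l2norm_le => [|Y uY]; first exact: l2norm_ge0.
apply: le_trans (l2norm_fsum f uY); apply: ler_sum => y _.
by rewrite cf_trunc; case: ifP => // _; rewrite normc_zero2 sqr_ge0.
Qed.

Lemma trunc_sum s f : uniq s -> trunc s f = \sum_(x <- s) cf f x *: delta R x.
Proof.
move=> us; apply: l2P => y; rewrite cf_trunc cf_sum.
under eq_bigr => x _ do rewrite cfZ cf_delta.
case: ifP => ys; last first.
  rewrite big_seq big1// => x xs; case: eqP => [yx|]; last by rewrite mulr0.
  by rewrite yx xs in ys.
rewrite (bigD1_seq y)//= eqxx mulr1 big1 ?addr0// => x.
by rewrite eq_sym => /negPf ->; rewrite mulr0.
Qed.

(** Finitely supported vectors are dense. *)
Lemma trunc_approx f e : 0 < e -> exists2 Y, uniq Y &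
  forall s, uniq s -> {subset Y <= s} -> l2norm (f - trunc s f) <= e.
Proof.
move=> e0; have e20 : 0 < e ^+ 2 by rewrite exprn_gt0.
have [Y uY HY] := l2norm_approx f e20; exists Y => // s us sub.
apply: l2norm_le => [|Z uZ]; first exact: ltW.
have -> : \sum_(y <- Z) normc (cf (f - trunc s f) y) ^+ 2 =
    \sum_(y <- Z | y \notin s) normc (cf f y) ^+ 2.
  rewrite [RHS]big_mkcond /=; apply: eq_bigr => y _.
  rewrite cfB cf_trunc; case: ifP => _ /=; last by rewrite subr0.
  by rewrite subrr normc_zero2.
rewrite -big_filter; set Z' := [seq y <- Z | y \notin s].
have := HY s us sub; rewrite ltr_norml => /andP[_].
have : \sum_(y <- Z') normc (cf f y) ^+ 2 + \sum_(y <- s) normc (cf f y) ^+ 2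
    <= l2norm f ^+ 2.
  rewrite -big_cat /=; apply: l2norm_fsum; rewrite cat_uniq filter_uniq// us andbT /=.
  by apply/hasPn => x xs; rewrite /= mem_filter xs.
by lra.
Qed.

Lemma l2dot_supp f h Y : uniq Y -> (forall x, x \notin Y -> cf h x = 0) ->
  l2dot f h = \sum_(y <- Y) cf f y * (cf h y)^*.
Proof.
move=> uY h0; apply: l2dot_uniq => Y0 uY0.
exists (undup (Y ++ Y0)); first exact: undup_uniq.
split; first by move=> x xY; rewrite mem_undup mem_cat xY orbT.
rewrite (bigID (fun y => y \in Y)) /= [X in _ + X]big1 ?addr0; last first.
  by move=> x xY; rewrite h0// conjC0 mulr0.
rewrite -big_filter; apply: perm_big; apply: uniq_perm => //.
  by rewrite filter_uniq// undup_uniq.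
by move=> x; rewrite mem_filter mem_undup mem_cat; case: (x \in Y).
Qed.

Lemma bounded_ext a b : bounded_op R X a -> bounded_op R X b ->
  (forall x, a (delta R x) = b (delta R x)) -> a = b.
Proof.
move=> ba bb ab; apply/funext => f; apply/eqP; rewrite -subr_eq0; apply/eqP.
pose c : l2 R X -> l2 R X := a - b; have bc : bounded_op R X c := boundedB ba bb.
have c0 s : uniq s -> c (trunc s f) = 0.
  move=> us; rewrite trunc_sum//.
  elim/big_rec: _ => [|x g _ IH]; first exact: (lin0 bc.1).
  rewrite bc.1 IH addr0; have -> : c (delta R x) = 0.
    by rewrite /c !fctE ab subrr.
  by rewrite scaler0.
apply: l2norm_eq0; rewrite leNgt; apply/negP => n0.
have on0 := opnorm_ge0 bc.
pose e := l2norm (a f - b f) / (2 * (opnorm c + 1)).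
have e0 : 0 < e by rewrite divr_gt0// mulr_gt0//; lra.
have [Y uY /(_ Y uY (fun _ => id)) HY] := trunc_approx f e0.
have := opnorm_ub (f - trunc Y f) bc; rewrite (linB _ _ bc.1) c0// subr0.
rewrite {1}/c !fctE => le1.
have : opnorm c * l2norm (f - trunc Y f) <= opnorm c * e by rewrite ler_wpM2l.
have : (opnorm c + 1) * e = l2norm (a f - b f) / 2.
  by rewrite /e; field; rewrite gt_eqF//; lra.
rewrite mulrDl mul1r; clearbody e; lra.
Qed.

End Truncation.

Section Completeness.
Variable R : realType.

(** The supremum of the lower bounds x n - K / (n + 1) also satisfies all the
    upper bounds, since the two families are separated. *)
Lemma real_limit (x : nat -> R) (K : R) :
  (forall n m, `|x n - x m| <= K / n.+1%:R + K / m.+1%:R) ->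
  exists l, forall n, `|l - x n| <= K / n.+1%:R.
Proof.
move=> H; pose E := range (fun n => x n - K / n.+1%:R).
have ub m : ubound E (x m + K / m.+1%:R).
  move=> _ [n _ <-]; have := le_trans (ler_norm _) (H n m).
  by move: (K / n.+1%:R) (K / m.+1%:R) => u v h; lra.
have hE : has_sup E.
  split; first by exists (x 0%N - K / 1%:R), 0%N.
  by exists (x 0%N + K / 1%:R); exact: (ub 0%N).
exists (sup E) => n; rewrite ler_norml; apply/andP; split.
  have : x n - K / n.+1%:R <= sup E by apply: sup_upper_bound => //; exists n.
  by move: (K / n.+1%:R) => u; lra.
have : sup E <= x n + K / n.+1%:R by apply: ge_sup (ub n); exact: hE.1.
by move: (K / n.+1%:R) => u; lra.
Qed.

Lemma small_inv (K e : R) : 0 < e -> exists n, K / n.+1%:R <= e.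
Proof.
move=> e0; exists (Num.trunc (`|K| / e)).
rewrite ler_pdivrMr ?ltr0n// mulrC.
apply: le_trans (ler_norm K) _.
have := truncnS_gt (`|K| / e).
by rewrite ltr_pdivrMr// => /ltW; rewrite mulrC.
Qed.

Lemma complex_limit (z : nat -> R[i]) (K : R) :
  (forall n m, normc (z n - z m) <= K / n.+1%:R + K / m.+1%:R) ->
  exists l, forall n, normc (l - z n) <= 2 * K / n.+1%:R.
Proof.
move=> H.
have [a Ha] : exists l, forall n, `|l - complex.Re (z n)| <= K / n.+1%:R.
  by apply: real_limit => n m; rewrite -ReB; apply: le_trans (normc_Re _) (H n m).
have [b Hb] : exists l, forall n, `|l - complex.Im (z n)| <= K / n.+1%:R.
  by apply: real_limit => n m; rewrite -ImB; apply: le_trans (normc_Im _) (H n m).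
exists (a +i* b) => n; apply: le_trans (normc_le_ReIm _) _.
rewrite ReB ImB /= -mulrA; have := Ha n; have := Hb n.
by move: (K / n.+1%:R) => u; lra.
Qed.

Lemma limit_uniq (z : nat -> R[i]) (l l' : R[i]) (K : R) :
  (forall n, normc (l - z n) <= K / n.+1%:R) ->
  (forall n, normc (l' - z n) <= K / n.+1%:R) -> l = l'.
Proof.
move=> H H'; apply/eqP; rewrite -subr_eq0; apply/eqP/normc_eps => e e0.
have [|n Hn] := @small_inv K (e / 2); first by lra.
by have := normc_near (H n) (H' n); move: Hn; move: (K / n.+1%:R) => u; lra.
Qed.

(** The limit is taken coordinatewise; the bound on c - b n is first proved on
    finite sets of coordinates, where b m is a good approximation of c for m
    large, and does not depend on the finite set. *)
Lemma bounded_complete (X : choiceType) (b : nat -> l2 R X -> l2 R X) (K : R) :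
  (forall n, bounded_op R X (b n)) ->
  (forall n m, opnorm (b n - b m) <= K / n.+1%:R + K / m.+1%:R) ->
  exists2 c, bounded_op R X c & forall n, opnorm (c - b n) <= K / n.+1%:R.
Proof.
move=> bb bC; have bd n m := boundedB (bb n) (bb m).
have K0 : 0 <= K.
  by have := bC 0%N 0%N; have := opnorm_ge0 (bd 0%N 0%N); rewrite !divr1; lra.
have Kn0 n : 0 <= K / n.+1%:R by rewrite divr_ge0.
have bf f n m : l2norm (b n f - b m f) <= (K * l2norm f) / n.+1%:R + (K * l2norm f) / m.+1%:R.
  apply: le_trans (opnorm_ub f (bd n m)) _.
  apply: (@le_trans _ _ ((K / n.+1%:R + K / m.+1%:R) * l2norm f)).
    by rewrite ler_wpM2r ?l2norm_ge0.
  by rewrite le_eqVlt; apply/orP; left; apply/eqP; ring.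
have pt f x : exists l, forall n,
    normc (l - cf (b n f) x) <= 2 * (K * l2norm f) / n.+1%:R.
  by apply: complex_limit => n m; rewrite -cfB; apply: le_trans (cf_le _ _) (bf f n m).
pose u f x := sval (cid (pt f x)).
have uP f x n : normc (u f x - cf (b n f) x) <= 2 * (K * l2norm f) / n.+1%:R.
  exact: (svalP (cid (pt f x))).
have ub f n s : uniq s -> Num.sqrt (\sum_(x <- s) normc (u f x - cf (b n f) x) ^+ 2)
    <= K * l2norm f / n.+1%:R.
  move=> us; rewrite leNgt; apply/negP; set A := Num.sqrt _; set B := _ / _ => AB.
  pose L := (K * l2norm f) + Num.sqrt (\sum_(x <- s) 1) * (2 * (K * l2norm f)).
  have [|m Hm] := @small_inv L ((A - B) / 2); first by lra.
  have : A <= Num.sqrt (\sum_(x <- s) normc (u f x - cf (b m f) x) ^+ 2) +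
              Num.sqrt (\sum_(x <- s) normc (cf (b m f - b n f) x) ^+ 2).
    apply: le_trans (fsum_minkowski _ _ _) => [|y|y]; try exact: normc_ge0.
    rewrite ler_wsqrtr//; apply: ler_sum => x _.
    rewrite lerXn2r ?nnegrE ?addr_ge0 ?normc_ge0// cfB.
    by apply: le_trans (le_normcD _ _); rewrite subrKA.
  have := le_trans (l2norm_fsqrt (b m f - b n f) us) (bf f m n).
  have : Num.sqrt (\sum_(x <- s) normc (u f x - cf (b m f) x) ^+ 2) <=
      Num.sqrt (\sum_(x <- s) 1) * (2 * (K * l2norm f) / m.+1%:R).
    rewrite -[X in _ * X]ger0_norm ?divr_ge0 ?mulr_ge0 ?l2norm_ge0// -sqrtr_sqr.
    rewrite -sqrtrM ?sumr_ge0// ler_wsqrtr// mulr_suml; apply: ler_sum => x _.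
    by rewrite mul1r lerXn2r ?nnegrE ?normc_ge0 ?uP// divr_ge0 ?mulr_ge0 ?l2norm_ge0.
  move: Hm; rewrite /L mulrDl -[X in _ + X]mulrA.
  move: AB; rewrite -/B; clearbody A B.
  move: (K * l2norm f / m.+1%:R) (Num.sqrt _ * _) => p q.
  by lra.
pose c f := l2of (u f).
have cu f : cf (c f) =1 u f.
  apply: (@cf_l2of _ _ _ ((K * l2norm f / 1%:R + l2norm (b 0%N f)) ^+ 2)) => s us.
  set S := \sum_(_ <- _) _.
  have S0 : 0 <= S by apply: sumr_ge0 => i _; rewrite sqr_ge0.
  have T0 : 0 <= K * l2norm f / 1%:R by rewrite divr_ge0 ?mulr_ge0 ?l2norm_ge0.
  rewrite -[leLHS]sqr_sqrtr// lerXn2r ?nnegrE ?sqrtr_ge0 ?addr_ge0 ?l2norm_ge0//.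
  apply: (@le_trans _ _ (Num.sqrt (\sum_(x <- s) normc (u f x - cf (b 0%N f) x) ^+ 2) +
              Num.sqrt (\sum_(x <- s) normc (cf (b 0%N f) x) ^+ 2))).
    apply: le_trans (fsum_minkowski _ _ _) => [|y|y]; try exact: normc_ge0.
    rewrite ler_wsqrtr//; apply: ler_sum => x _.
    rewrite lerXn2r ?nnegrE ?addr_ge0 ?normc_ge0//.
    by apply: le_trans (le_normcD _ _); rewrite subrK.
  by apply: lerD; [exact: ub|exact: l2norm_fsqrt].
have cn f n : l2norm (c f - b n f) <= K * l2norm f / n.+1%:R.
  have T0 : 0 <= K * l2norm f / n.+1%:R by rewrite divr_ge0 ?mulr_ge0 ?l2norm_ge0.
  apply: l2norm_le => // s us; under eq_bigr => x _ do rewrite cfB cu.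
  set S := \sum_(_ <- _) _.
  have S0 : 0 <= S by apply: sumr_ge0 => i _; rewrite sqr_ge0.
  by rewrite -[leLHS]sqr_sqrtr// lerXn2r ?nnegrE ?sqrtr_ge0//; exact: ub.
have lc : linear c.
  move=> k f g; apply: l2P => x.
  have -> : cf (k *: c f + c g) x = k * cf (c f) x + cf (c g) x by [].
  rewrite (cu (k *: f + g) x) (cu f x) (cu g x).
  pose L := 2 * (K * l2norm (k *: f + g)) +
    (normc k * (2 * (K * l2norm f)) + 2 * (K * l2norm g)).
  have k0 := normc_ge0 k.
  have [f0 [g0 h0]] := (l2norm_ge0 f, (l2norm_ge0 g, l2norm_ge0 (k *: f + g))).
  apply: (@limit_uniq (fun n => cf (b n (k *: f + g)) x) _ _ L) => n.
    apply: le_trans (uP _ _ _) _; rewrite ler_wpM2r ?invr_ge0// /L lerDl.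
    by rewrite addr_ge0 ?mulr_ge0.
  rewrite (bb n).1 cfD cfZ.
  have -> : k * u f x + u g x - (k * cf (b n f) x + cf (b n g) x) =
    k * (u f x - cf (b n f) x) + (u g x - cf (b n g) x) by ring.
  apply: le_trans (le_normcD _ _) _; rewrite normcM.
  apply: (@le_trans _ _ (normc k * (2 * (K * l2norm f) / n.+1%:R) + 2 * (K * l2norm g) / n.+1%:R)).
    by apply: lerD; [apply: ler_wpM2l => //|]; exact: uP.
  rewrite [normc k * (_ / _)]mulrA -mulrDl ler_wpM2r ?invr_ge0// /L lerDr.
  by rewrite !mulr_ge0.
have bc : bounded_op R X c.
  split=> //; exists (K / 1%:R + opnorm (b 0%N)) => f.
  rewrite -[c f](subrK (b 0%N f)); apply: le_trans (l2normD _ _) _.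
  rewrite mulrDl; apply: lerD; last exact: opnorm_ub.
  by apply: le_trans (cn f 0%N) _; rewrite mulrAC.
exists c => // n; apply: opnorm_le => // f; rewrite fctE.
by apply: le_trans (cn f n) _; rewrite mulrAC.
Qed.

End Completeness.

Section CstarGenerated.
Variables (R : realType) (X : choiceType).
Implicit Types (a b : l2 R X -> l2 R X) (S : set (l2 R X -> l2 R X)).

Lemma bounded_is_cstar : is_cstar_subalgebra (bounded_op R X).
Proof.
split=> //.
- by split; [exact: bounded0|move=> k a b; exact: bounded_comb].
- by move=> a b; exact: bounded_comp.
Qed.

Lemma cstar_generated_is_cstar S : S `<=` bounded_op R X ->
  is_cstar_subalgebra (cstar_generated S).
Proof.
move=> Sb; split.
- by move=> a; apply; split=> //; exact: bounded_is_cstar.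
- split=> [C [[_ [C0 _] _ _ _] _]//|k a b Sa Sb' C CS].
  by have [[_ [_ CL] _ _ _] _] := CS; apply: CL; [exact: Sa|exact: Sb'].
- move=> a b Sa Sb' C CS; have [[_ _ CM _ _] _] := CS.
  by apply: CM; [exact: Sa|exact: Sb'].
- move=> a b Sa bb ab C CS; have [[_ _ _ CA _] _] := CS.
  by apply: CA ab => //; exact: Sa.
- move=> a ba H C CS; have [[_ _ _ _ CC] _] := CS.
  by apply: CC => // e e0; have [b Sb' be] := H e e0; exists b => //; exact: Sb'.
Qed.

Lemma sub_cstar_generated S : S `<=` cstar_generated S.
Proof. by move=> a Sa C [_]; apply. Qed.

Lemma cstar_generated_min S S' : is_cstar_subalgebra S' -> S `<=` S' ->
  cstar_generated S `<=` S'.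
Proof. by move=> CS' SS' a; apply. Qed.

End CstarGenerated.

(* From here on these maps are handled through their coordinates only. *)
Opaque push pull l2of trunc.

(** * The reduced C*-algebra of a right LCM monoid *)

(** Tolerances of the form e / (2 (y + 1)) serve to absorb a factor y >= 0
    that may vanish. *)
Lemma mul_half (R : realType) (x y e : R) : 0 <= x -> 0 <= y ->
  x <= e / (2 * (y + 1)) -> x * y <= e / 2.
Proof.
move=> x0 y0 xe; apply: (@le_trans _ _ (e / (2 * (y + 1)) * (y + 1))).
  by apply: ler_pM => //; lra.
by rewrite le_eqVlt; apply/orP; left; apply/eqP; field; rewrite gt_eqF//; lra.
Qed.

Lemma div_pos (R : realType) (x y : R) : 0 < x -> 0 <= y -> 0 < x / (2 * (y + 1)).
Proof. by move=> x0 y0; rewrite divr_gt0// mulr_gt0//; lra. Qed.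

Section SemigroupAlgebra.
Variables (R : realType) (N : monoidType).
Hypothesis mulI : forall p : N, injective (fun x : N => (p * x)%g).
Implicit Types (p q : N) (f g : l2 R N).

Definition Lop p : l2 R N -> l2 R N := push (fun x : N => (p * x)%g).
Definition Rop p : l2 R N -> l2 R N := pull (fun x : N => (p * x)%g).

Lemma Lop_bounded p : bounded_op R N (Lop p).
Proof.
split; first exact: push_linear.
by exists 1 => f; rewrite mul1r push_norm.
Qed.

Lemma Rop_bounded p : bounded_op R N (Rop p).
Proof.
split; first exact: pull_linear.
by exists 1 => f; rewrite mul1r pull_norm.
Qed.

Lemma cf_Lop p f x : cf (Lop p f) (p * x)%g = cf f x.
Proof. by rewrite /Lop cf_push. Qed.

Lemma cf_Lop0 p f y : ~ (exists x, (p * x)%g = y) -> cf (Lop p f) y = 0.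
Proof. exact: cf_push0. Qed.

Lemma cf_Rop p f x : cf (Rop p f) x = cf f (p * x)%g.
Proof. by rewrite /Rop cf_pull. Qed.

Lemma Rop_adjoint p : is_adjoint (Rop p) (Lop p).
Proof. by move=> f g; exact: push_adjoint. Qed.

Lemma is_lambda_Lop p : is_lambda p (Lop p).
Proof. by split; [exact: Lop_bounded|move=> x; exact: push_delta]. Qed.

Lemma is_lambdaE p a : @is_lambda R N p a -> a = Lop p.
Proof.
move=> [ba aE]; apply: bounded_ext => //; first exact: Lop_bounded.
by move=> x; rewrite aE /Lop push_delta.
Qed.

Lemma Rop1 f : Rop 1%g f = f.
Proof. by apply: l2P => x; rewrite cf_Rop mul1g. Qed.

Lemma RopM p q f : Rop p (Rop q f) = Rop (q * p)%g f.
Proof. by apply: l2P => x; rewrite !cf_Rop mulgA. Qed.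

Lemma LopM p q f : Lop p (Lop q f) = Lop (p * q)%g f.
Proof.
apply: l2P => y; have [[x <-]|ny] := pselect (exists x, (p * q * x)%g = y).
  by rewrite cf_Lop -mulgA !cf_Lop.
rewrite [RHS]cf_Lop0//; have [[x xy]|ny'] := pselect (exists x, (p * x)%g = y).
  rewrite -xy cf_Lop cf_Lop0// => -[x' x'x]; apply: ny; exists x'.
  by rewrite -mulgA x'x.
by rewrite cf_Lop0.
Qed.

(** A formal linear combination of the operators lambda_p lambda_q^*, kept as
    a list so that it can be read in several representations. *)
Definition comb (c : seq (R[i] * (N * N))) : l2 R N -> l2 R N :=
  fun f => \sum_(t <- c) t.1 *: Lop t.2.1 (Rop t.2.2 f).

Lemma comb_nil : comb [::] = 0.
Proof. by apply/funext => f; rewrite /comb big_nil. Qed.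

Lemma comb_cons t c : comb (t :: c) = t.1 *: (Lop t.2.1 \o Rop t.2.2) + comb c.
Proof. by apply/funext => f; rewrite /comb big_cons. Qed.

Lemma comb_lin k c d :
  comb ([seq (k * t.1, t.2) | t <- c] ++ d) = k *: comb c + comb d.
Proof.
apply/funext => f; rewrite !fctE /comb big_cat big_map scaler_sumr /=.
by congr (_ + _); apply: eq_bigr => t _; rewrite scalerA.
Qed.

Lemma comb_bounded c : bounded_op R N (comb c).
Proof.
elim: c => [|t c IH]; first by rewrite comb_nil; exact: bounded0.
rewrite comb_cons; apply: bounded_comb => //.
by apply: bounded_comp; [exact: Lop_bounded|exact: Rop_bounded].
Qed.

Lemma comb_cstar c : cstar_lambda R N (comb c).
Proof.
have lb : [set a | exists q, @is_lambda R N q a] `<=` bounded_op R N.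
  by move=> a [q []].
have [_ [C0 CL] CM CA _] := cstar_generated_is_cstar lb.
elim: c => [|t c IH]; first by rewrite comb_nil.
rewrite comb_cons; apply: (CL) => //; apply: CM.
  by apply: sub_cstar_generated; exists t.2.1; exact: is_lambda_Lop.
apply: (CA (Lop t.2.2)); last exact: adjoint_sym (Rop_adjoint _).
  by apply: sub_cstar_generated; exists t.2.2; exact: is_lambda_Lop.
exact: Rop_bounded.
Qed.

Lemma comb_adjoint c : is_adjoint (comb c) (comb [seq (t.1^*, (t.2.2, t.2.1)) | t <- c]).
Proof.
elim: c => [|t c IH] f g.
  by rewrite /= comb_nil /GRing.zero /= l2dot0l l2dot0r.
rewrite [map _ _]/= !comb_cons.
change (l2dot (t.1^* *: Lop t.2.2 (Rop t.2.1 f) +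
    comb [seq (u.1^*, (u.2.2, u.2.1)) | u <- c] f) g =
  l2dot f (t.1 *: Lop t.2.1 (Rop t.2.2 g) + comb c g)).
rewrite l2dotPl IH l2dotDr l2dotZr; congr (_ * _ + _).
rewrite (Rop_adjoint t.2.2 _ g) (adjoint_sym (Rop_adjoint t.2.1)) //.
Qed.

Definition right_lcm := forall p q : N, (exists x y, p * x = q * y)%g ->
  exists a b, (p * a = q * b)%g /\
    forall x y, (p * x = q * y)%g -> exists c, x = (a * c)%g /\ y = (b * c)%g.

Hypothesis lcmN : right_lcm.

(** If p b = q a is the least common right multiple, then
    lambda_q^* lambda_p = lambda_a lambda_b^*, because a vector q x lies in the
    range of lambda_p exactly when x is a right multiple of a. *)
Lemma Rop_Lop p q : (forall f, Rop q (Lop p f) = 0) \/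
  exists a b, forall f, Rop q (Lop p f) = Lop a (Rop b f).
Proof.
have [h|h] := pselect (exists x y, q * x = p * y)%g; last first.
  left=> f; apply: l2P => x; rewrite cf_Rop cf_Lop0 ?cf0// => -[y yx].
  by apply: h; exists x, y.
right; have [a [b [ab H]]] := lcmN h; exists a, b => f; apply: l2P => x.
rewrite cf_Rop; have [[y yx]|ny] := pselect (exists y, p * y = q * x)%g.
  have [c [-> yc]] := H _ _ (esym yx).
  have -> : (q * (a * c) = p * (b * c))%g by rewrite !mulgA ab.
  rewrite (cf_Lop p f).
  rewrite (cf_Lop a).
  by rewrite (cf_Rop b f).
rewrite !cf_Lop0// => -[c cx]; apply: ny; exists (b * c)%g.
by rewrite -cx !mulgA ab.
Qed.

Lemma comb_comp c d : exists e, comb c \o comb d = comb e.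
Proof.
have term p q p' q' k : exists e, forall f,
   Lop p (Rop q (k *: Lop p' (Rop q' f))) = comb e f.
  have lR := (Rop_bounded q).1; have lL := (Lop_bounded p).1.
  have [RL|[a [b RL]]] := Rop_Lop p' q.
    exists [::] => g; rewrite (linZ _ _ lR) RL scaler0 (lin0 lL) comb_nil.
    by [].
  exists [:: (k, (p * a, q' * b)%g)] => g.
  rewrite (linZ _ _ lR) (linZ _ _ lL) RL LopM RopM /comb big_seq1 /=.
  by [].
have row p q : exists e, forall f, Lop p (Rop q (comb d f)) = comb e f.
  have lR := (Rop_bounded q).1; have lL := (Lop_bounded p).1.
  elim: d => [|t d [e IH]].
    by exists [::] => f; rewrite comb_nil /GRing.zero /= (lin0 lR) (lin0 lL).
  have [e' He'] := term p q t.2.1 t.2.2 t.1.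
  exists (e' ++ e) => f.
  rewrite comb_cons fctE (linD _ _ lR) (linD _ _ lL) IH.
  have -> : comb (e' ++ e) f = comb e' f + comb e f by rewrite /comb big_cat.
  by rewrite -He'.
elim: c => [|t c [e IH]].
  by exists [::]; apply/funext => f; rewrite comb_nil.
have [e' He'] := row t.2.1 t.2.2.
exists ([seq (t.1 * u.1, u.2) | u <- e'] ++ e); rewrite comb_lin -IH.
by apply/funext => f; rewrite /= comb_cons !fctE /= He'.
Qed.

(** With right LCMs the combinations form a self-adjoint algebra, whose norm
    closure is therefore a C*-algebra. *)
Lemma cstar_lambda_dense a : cstar_lambda R N a ->
  bounded_op R N a /\ forall e : R, 0 < e -> exists c, opnorm (a - comb c) <= e.
Proof.
pose D : set (l2 R N -> l2 R N) := [set a | bounded_op R N a /\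
   forall e : R, 0 < e -> exists c, opnorm (a - comb c) <= e].
suff : cstar_lambda R N `<=` D by apply.
apply: cstar_generated_min; last first.
  move=> {}a [q /is_lambdaE ->]; split; first exact: Lop_bounded.
  move=> e e0; exists [:: (1, (q, 1%g))].
  have -> : comb [:: (1, (q, 1%g))] = Lop q.
    by apply/funext => f; rewrite /comb big_seq1 /= Rop1 scale1r.
  by rewrite subrr opnorm_le// ?ltW// => f; rewrite l2norm0 mulr_ge0 ?l2norm_ge0// ltW.
split.
- by move=> b [].
- split.
    split; first exact: bounded0.
    move=> e e0; exists [::]; rewrite comb_nil subrr.
    by rewrite opnorm_le// ?ltW// => f; rewrite l2norm0 mulr_ge0 ?l2norm_ge0// ltW.
  move=> k b b' [bb Hb] [bb' Hb']; split; first exact: bounded_comb.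
  move=> e e0; have k0 := normc_ge0 k.
  have [|c Hc] := Hb (e / (2 * (normc k + 1))); first by apply: div_pos => //; rewrite ?opnorm_ge0.
  have [|d Hd] := Hb' (e / 2); first by lra.
  exists ([seq (k * t.1, t.2) | t <- c] ++ d); rewrite comb_lin.
  have -> : k *: b + b' - (k *: comb c + comb d) = k *: (b - comb c) + (b' - comb d).
    by rewrite scalerBr opprD addrACA.
  have B1 := boundedB bb (comb_bounded c); have B2 := boundedB bb' (comb_bounded d).
  have kB := bounded_comb k B1 (bounded0 R N); rewrite addr0 in kB.
  apply: le_trans (opnormD kB B2) _; rewrite [leRHS]splitr; apply: lerD => //.
  apply: le_trans (opnormZ k B1) _; rewrite mulrC.
  exact: mul_half (opnorm_ge0 B1) k0 Hc.
- move=> b b' [bb Hb] [bb' Hb']; split; first exact: bounded_comp.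
  move=> e e0; have n0 := opnorm_ge0 bb'.
  have [|c Hc] := Hb (e / (2 * (opnorm b' + 1))); first by apply: div_pos => //; rewrite ?opnorm_ge0.
  have m0 := opnorm_ge0 (comb_bounded c).
  have [|d Hd] := Hb' (e / (2 * (opnorm (comb c) + 1))); first by apply: div_pos => //; rewrite ?opnorm_ge0.
  have [h hE] := comb_comp c d; exists h; rewrite -hE.
  have B1 := boundedB bb (comb_bounded c); have B2 := boundedB bb' (comb_bounded d).
  have -> : (b \o b') - (comb c \o comb d) = ((b - comb c) \o b') + (comb c \o (b' - comb d)).
    apply/funext => f.
    change (b (b' f) - comb c (comb d f) =
      (b (b' f) - comb c (b' f)) + comb c (b' f - comb d f)).
    by rewrite (linB _ _ (comb_bounded c).1) addrA subrK.
  have C1 := bounded_comp B1 bb'; have C2 := bounded_comp (comb_bounded c) B2.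
  apply: le_trans (opnormD C1 C2) _; rewrite [leRHS]splitr; apply: lerD.
    apply: le_trans (opnorm_comp B1 bb') _.
    exact: mul_half (opnorm_ge0 B1) n0 Hc.
  apply: le_trans (opnorm_comp (comb_bounded c) B2) _; rewrite mulrC.
  exact: mul_half (opnorm_ge0 B2) m0 Hd.
- move=> b b' [bb Hb] bb' bb'A; split; [exact: bb'|move=> e e0]; have [c Hc] := Hb e e0.
  exists [seq (t.1^*, (t.2.2, t.2.1)) | t <- c]; apply: le_trans Hc.
  apply: adjoint_opnorm; try exact: boundedB (comb_bounded _).
  by move=> f g; rewrite !fctE l2dotBl l2dotBr bb'A comb_adjoint.
- move=> b bb H; split; [exact: bb|move=> e e0]; have [|b' [bb' Hb'] bb'e] := H (e / 2); first by lra.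
  have [|c Hc] := Hb' (e / 2); first by lra.
  exists c; have -> : b - comb c = (b - b') + (b' - comb c) by rewrite addrA subrK.
  apply: le_trans (opnormD _ _) _; try exact: boundedB (comb_bounded _).
    exact: boundedB.
  by move: bb'e; rewrite opnormC; lra.
Qed.

Lemma cstar_lambda_closed a : bounded_op R N a ->
  (forall e : R, 0 < e -> exists2 b, cstar_lambda R N b & opnorm (a - b) <= e) ->
  cstar_lambda R N a.
Proof.
move=> ba H; have lb : [set a | exists q, @is_lambda R N q a] `<=` bounded_op R N.
  by move=> b [q []].
have [_ _ _ _ CC] := cstar_generated_is_cstar lb.
apply: CC => // e e0; have [|b Sb be] := H (e / 2); first by lra.
by exists b => //; rewrite opnormC; lra.
Qed.

End SemigroupAlgebra.

(** * Nuclearity passes to a submonoid *)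

Section Submonoid.
Variables (R : realType) (Q M : monoidType) (io : Q -> M).
Hypothesis io_inj : injective io.
Hypothesis ioM : forall x y : Q, io (x * y)%g = (io x * io y)%g.
Hypothesis io1 : io 1%g = 1%g.
Hypothesis mulMI : forall p : M, injective (fun x : M => (p * x)%g).
Hypothesis mulIM : forall p : M, injective (fun x : M => (x * p)%g).
Hypothesis lcmM : right_lcm M.
Hypothesis io_face : forall (x y : M) (q : Q), (x * y)%g = io q ->
  exists x' y', x = io x' /\ y = io y'.
Hypothesis io_dir : forall (q q' : Q) (z z' : M), (io q * z)%g = (io q' * z')%g ->
  exists r r' w, z = (io r * w)%g /\ z' = (io r' * w)%g.

Lemma mulQI (p : Q) : injective (fun x : Q => (p * x)%g).
Proof. by move=> x y xy; apply/io_inj/(mulMI (p := io p)); rewrite -!ioM xy. Qed.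

Lemma lcmQ : right_lcm Q.
Proof.
move=> p q [x [y xy]].
have [|a [b [ab H]]] := lcmM (p := io p) (q := io q).
  by exists (io x), (io y); rewrite -!ioM xy.
have [|c [xa yb]] := H (io x) (io y); first by rewrite -!ioM xy.
have [a' [_ [aE _]]] := io_face (esym xa).
have [b' [_ [bE _]]] := io_face (esym yb).
exists a', b'; split; first by apply: io_inj; rewrite !ioM -aE -bE.
move=> u v uv; have [|d [ua vb]] := H (io u) (io v); first by rewrite -!ioM uv.
have [_ [d' [_ dE]]] := io_face (esym ua).
exists d'; split; apply: io_inj; rewrite ioM -dE.
  by rewrite -aE.
by rewrite -bE.
Qed.

(** ** Compression to l^2(Q) *)

Definition compress (a : l2 R M -> l2 R M) : l2 R Q -> l2 R Q :=
  fun f => pull io (a (push io f)).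

Lemma compress_bounded a : bounded_op R M a -> bounded_op R Q (compress a).
Proof.
move=> ba; split.
  by move=> k f g; rewrite /compress (@push_linear _ _ _ _ io_inj) ba.1 (@pull_linear _ _ _ _ io_inj).
exists (opnorm a) => f; apply: le_trans (pull_norm io_inj _) _.
by rewrite -[l2norm f](push_norm io_inj); exact: opnorm_ub.
Qed.

Lemma compress_opnorm a : bounded_op R M a -> opnorm (compress a) <= opnorm a.
Proof.
move=> ba; apply: opnorm_le => [|f]; first exact: opnorm_ge0.
apply: le_trans (pull_norm io_inj _) _.
by rewrite -[l2norm f](push_norm io_inj); exact: opnorm_ub.
Qed.

Lemma compress_lin k a b : compress (k *: a + b) = k *: compress a + compress b.
Proof. by apply/funext => f; rewrite /compress !fctE (@pull_linear _ _ _ _ io_inj). Qed.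

Lemma compressB a b : compress (a - b) = compress a - compress b.
Proof.
apply/funext => f; rewrite /compress !fctE.
exact: (linB _ _ (@pull_linear R _ _ _ io_inj)).
Qed.

Lemma compress_positive k (a : 'I_k -> 'I_k -> l2 R M -> l2 R M) :
  mx_positive a -> mx_positive (fun i j => compress (a i j)).
Proof.
move=> pa f; have := pa (fun i => push io (f i)).
congr (0 <= _); apply: eq_bigr => i _; apply: eq_bigr => j _.
by rewrite l2dotC (push_adjoint io_inj) -l2dotC.
Qed.

(** Only the terms lambda_p lambda_q^* with p and q in Q survive, since Q
    absorbs the factors of its elements. *)
Lemma compress_comb c : exists d, compress (comb c) = comb d.
Proof.
elim: c => [|[k [p q]] c [d IH]].
  exists [::]; apply/funext => f; rewrite /compress !comb_nil.
  exact: (lin0 (@pull_linear R _ _ _ io_inj)).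
have term : exists e, compress (Lop p \o Rop q) = comb e.
  have [[[p' pE] [q' qE]]|npq] := pselect ((exists p', p = io p') /\ (exists q', q = io q')).
    exists [:: (1, (p', q'))]; apply/funext => f.
    rewrite /comb big_seq1 scale1r /=; apply: l2P => y.
    rewrite /compress (cf_pull io_inj) /= pE qE.
    have [[x <-]|ny] := pselect (exists x, (p' * x)%g = y).
      rewrite ioM (cf_Lop mulMI) (cf_Lop mulQI) (cf_Rop mulMI) (cf_Rop mulQI).
      by rewrite -ioM (cf_push io_inj).
    rewrite [RHS](cf_Lop0 mulQI)// (cf_Lop0 mulMI)// => -[x xy].
    have [_ [x' [_ xE]]] := io_face xy.
    by apply: ny; exists x'; apply: io_inj; rewrite ioM -xE.
  exists [::]; rewrite comb_nil; apply/funext => f; apply: l2P => y.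
  rewrite /compress (cf_pull io_inj) /= cf0.
  have [[x xy]|ny] := pselect (exists x, (p * x)%g = io y); last exact: (cf_Lop0 mulMI).
  have [p' [_ [pE _]]] := io_face xy.
  rewrite -xy (cf_Lop mulMI) (cf_Rop mulMI) (cf_push0 io_inj)// => -[z zE].
  have [q' [_ [qE _]]] := io_face (esym zE).
  by apply: npq; split; [exists p'|exists q'].
have [e He] := term.
exists ([seq (k * t.1, t.2) | t <- e] ++ d).
by rewrite comb_cons compress_lin He IH comb_lin.
Qed.

Lemma compress_cstar a : cstar_lambda R M a -> cstar_lambda R Q (compress a).
Proof.
move=> /(cstar_lambda_dense mulMI lcmM) [ba da].
apply: cstar_lambda_closed; first exact: compress_bounded.
move=> e e0; have [c Hc] := da e e0; have [d Hd] := compress_comb c.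
exists (comb d); first exact: (comb_cstar mulQI).
rewrite -Hd -compressB; apply: le_trans (compress_opnorm _) Hc.
exact: boundedB (comb_bounded mulMI _).
Qed.

(** ** Inflation to l^2(M) *)

Definition ext (c : seq (R[i] * (Q * Q))) : seq (R[i] * (M * M)) :=
  [seq (t.1, (io t.2.1, io t.2.2)) | t <- c].

Lemma ext_lin k c d :
  ext ([seq (k * t.1, t.2) | t <- c] ++ d) = [seq (k * t.1, t.2) | t <- ext c] ++ ext d.
Proof. by rewrite /ext map_cat -!map_comp. Qed.

Lemma compress_ext c : compress (comb (ext c)) = comb c.
Proof.
elim: c => [|[k [p q]] c IH].
  rewrite /ext /= !comb_nil; apply/funext => f.
  exact: (lin0 (@pull_linear R _ _ _ io_inj)).
rewrite /ext /= !comb_cons compress_lin IH; congr (_ *: _ + _).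
apply/funext => f; apply: l2P => y; rewrite /compress (cf_pull io_inj) /=.
have [[x <-]|ny] := pselect (exists x, (p * x)%g = y).
  rewrite ioM (cf_Lop mulMI) (cf_Lop mulQI) (cf_Rop mulMI) (cf_Rop mulQI).
  by rewrite -ioM (cf_push io_inj).
rewrite [RHS](cf_Lop0 mulQI)// (cf_Lop0 mulMI)// => -[x xy].
have [_ [x' [_ xE]]] := io_face xy.
by apply: ny; exists x'; apply: io_inj; rewrite ioM -xE.
Qed.

Definition rmul (z : M) (q : Q) : M := (io q * z)%g.

Lemma rmulI z : injective (rmul z).
Proof. by move=> x y /mulIM/io_inj. Qed.

Definition disjoint_translates (Z : seq M) := uniq Z /\
  forall z z' q q', z \in Z -> z' \in Z -> rmul z q = rmul z' q' -> z = z'.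

(** Overlapping translates are contained in a common one, so that finitely
    many of them can be merged until they are disjoint. *)
Lemma merge_translates (Y : seq M) : exists2 Z, disjoint_translates Z &
  forall y, y \in Y -> exists2 z, z \in Z & exists q, y = rmul z q.
Proof.
have [n] := ubnP (size Y); elim: n Y => // n IH Y; rewrite ltnS => sY.
have [uY|nuY] := boolP (uniq Y); last first.
  have [|Z dZ HZ] := IH (undup Y).
    by apply: leq_trans sY; rewrite ltn_size_undup.
  by exists Z => // y yY; apply: HZ; rewrite mem_undup.
have [d|nd] := pselect (disjoint_translates Y).
  by exists Y => // y yY; exists y => //; exists 1%g; rewrite /rmul io1 mul1g.
have [z [z' [q [q' [zY z'Y zz' nzz']]]]] : exists z z' q q',
    [/\ z \in Y, z' \in Y, rmul z q = rmul z' q' & z <> z'].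
  apply: contrapT => h; apply: nd; split=> // z z' q q' zY z'Y zz'.
  by apply: contrapT => nzz'; apply: h; exists z, z', q, q'.
have [r [r' [w [zE z'E]]]] := io_dir zz'.
have z'R : z' \in rem z Y by rewrite (rem_filter _ uY) mem_filter z'Y andbT /= eq_sym; apply/eqP.
have sz : (size (w :: rem z' (rem z Y)) < n)%N.
  rewrite /= !size_rem//; move: sY; case: (Y) zY z'R => // a [|b s] //=.
    by rewrite inE => /eqP ->; rewrite eqxx.
have [Z dZ HZ] := IH _ sz; exists Z => // y yY.
have wZ := HZ w (mem_head _ _).
have lift q0 : (exists2 z, z \in Z & exists q, rmul w q0 = rmul z q).
  have [z0 z0Z [q1 wE]] := wZ; exists z0 => //; exists (q0 * q1)%g.
  by rewrite /rmul ioM -mulgA -/(rmul z0 q1) -wE.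
have [->|yz] := eqVneq y z; first by rewrite zE; exact: lift.
have [->|yz'] := eqVneq y z'; first by rewrite z'E; exact: lift.
apply: HZ; rewrite inE; apply/orP; right.
by rewrite !(rem_filter _ _) ?filter_uniq ?rem_uniq// !mem_filter /= yz yz'.
Qed.

Section Family.
Variable Z : seq M.
Hypothesis dZ : disjoint_translates Z.

Lemma fsum_translates (V : zmodType) (F : M -> V) (Y : seq M) : uniq Y ->
  (forall y, y \in Y -> exists2 z, z \in Z & exists q, y = rmul z q) ->
  \sum_(y <- Y) F y =
  \sum_(z <- Z) \sum_(q <- pmap (preim_of (rmul z)) Y) F (rmul z q).
Proof.
move=> uY cov.
transitivity (\sum_(z <- Z) \sum_(y <- Y) if `[< exists q, rmul z q = y >] then F y else 0).
  rewrite exchange_big /=; apply: eq_big_seq => y yY.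
  have [z zZ [q yE]] := cov y yY.
  rewrite (bigD1_seq z)//=; last exact: dZ.1.
  have -> : `[< exists q, rmul z q = y >] = true by apply/asboolP; exists q.
  rewrite big_seq_cond big1 ?addr0// => z' /andP[z'Z z'z].
  case: asboolP => // -[q' q'y]; move: z'z; rewrite (dZ.2 z' z q' q)//.
    by rewrite eqxx.
  by rewrite q'y.
apply: eq_bigr => z _; apply: (fsum_preim (rmulI (z := z))).
  by move=> q; case: asboolP => // -[]; exists q.
by move=> y ny; case: asboolP.
Qed.

(** Bessel's inequality for the orthogonal subspaces l^2(Q z): the orthogonal
    projection g of f on their sum has |g|^2 = <g, f>. *)
Lemma bessel (f : l2 R M) : \sum_(z <- Z) l2norm (pull (rmul z) f) ^+ 2 <= l2norm f ^+ 2.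
Proof.
pose g := \sum_(z <- Z) push (rmul z) (pull (rmul z) f).
set S := \sum_(_ <- _) _.
have dotg h : l2dot g h = \sum_(z <- Z) l2dot (pull (rmul z) f) (pull (rmul z) h).
  rewrite /g; elim: (Z) => [|z s IH]; first by rewrite !big_nil l2dot0l.
  by rewrite !big_cons l2dotDl IH (push_adjoint (rmulI (z := z))).
have gf : l2dot g f = S%:C.
  by rewrite dotg rmorph_sum; apply: eq_bigr => z _; rewrite l2dotxx.
have gz z : z \in Z -> pull (rmul z) g = pull (rmul z) f.
  move=> zZ; apply: l2P => q; rewrite !(cf_pull (rmulI (z := z))) cf_sum.
  rewrite (bigD1_seq z)//=; last exact: dZ.1.
  rewrite (cf_push (rmulI (z := z)) (pull (rmul z) f) q) (cf_pull (rmulI (z := z)) f q).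
  rewrite big_seq_cond big1 ?addr0// => z' /andP[z'Z z'z].
  rewrite (cf_push0 (rmulI (z := z')))// => -[q' q'q].
  by move: z'z; rewrite (dZ.2 z' z q' q)// eqxx.
have gg : l2dot g g = S%:C.
  rewrite dotg rmorph_sum; apply: eq_big_seq => z zZ.
  by rewrite gz// l2dotxx.
have S0 : 0 <= S by apply: sumr_ge0 => z _; rewrite sqr_ge0.
have ng : l2norm g ^+ 2 = S by have := gg; rewrite l2dotxx => -[].
have nR (r : R) : normc r%:C = `|r| by rewrite /= expr0n addr0 sqrtr_sqr.
have := l2_cauchy_schwarz g f; rewrite gf nR ger0_norm// => le1.
have [f0 g0] := (l2norm_ge0 f, l2norm_ge0 g).
have [g0'|g1] := leP (l2norm g) 0.
  have gE : l2norm g = 0 by apply/le_anti; rewrite g0' g0.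
  by rewrite -ng gE expr0n sqr_ge0.
have gle : l2norm g <= l2norm f by rewrite -(ler_pM2l g1) -expr2 ng.
by rewrite -ng lerXn2r.
Qed.

End Family.

(** Besides covering Y, the translates also contain the left quotients of Y by
    the elements of Ps, so that lambda_p^* may be computed inside them. *)
Definition adapted (Z Y : seq M) (Ps : seq Q) := [/\ disjoint_translates Z,
  forall y, y \in Y -> exists2 z, z \in Z & exists q, y = rmul z q &
  forall p u, p \in Ps -> (io p * u)%g \in Y ->
    exists2 z, z \in Z & exists q, u = rmul z q].

Lemma adapted_exists Y Ps : exists Z, adapted Z Y Ps.
Proof.
pose Y' := Y ++ flatten [seq pmap (preim_of (fun u : M => io p * u)%g) Y | p <- Ps].
have [Z dZ HZ] := merge_translates Y'; exists Z; split=> //.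
  by move=> y yY; apply: HZ; rewrite mem_cat yY.
move=> p u pP puY; apply: HZ; rewrite mem_cat; apply/orP; right.
apply/flattenP; exists (pmap (preim_of (fun u : M => io p * u)%g) Y).
  by apply/mapP; exists p.
by rewrite mem_preim//; exact: mulMI.
Qed.

(** To evaluate lambda_p lambda_q^* f at y = p u one needs u to lie in the same
    translate as y. It lies in some translate by adaptedness, and this one
    contains y too. *)
Lemma ext_local Z Y Ps c f z q : adapted Z Y Ps -> {subset [seq t.2.1 | t <- c] <= Ps} ->
  z \in Z -> rmul z q \in Y ->
  cf (comb (ext c) f) (rmul z q) = cf (comb c (pull (rmul z) f)) q.
Proof.
move=> [dZ _ HZ] + zZ yY; elim: c => [|[k [p p']] c IH] cP; first by rewrite /ext /= !comb_nil.
rewrite /ext /= !comb_cons !fctE !cfD !cfZ -/(ext c) IH; last first.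
  by move=> x xc; apply: cP; rewrite inE xc orbT.
have pP : p \in Ps by apply: cP; rewrite mem_head.
congr (_ * _ + _) => /=.
have [[u uy]|nu] := pselect (exists u, (io p * u)%g = rmul z q); last first.
  rewrite (cf_Lop0 mulMI)// (cf_Lop0 mulQI)// => -[x xq].
  by apply: nu; exists (rmul z x); rewrite /rmul mulgA -ioM xq.
have [|z' z'Z [q' uE]] := HZ p u pP; first by rewrite uy.
have zpq : rmul z q = rmul z' (p * q')%g by rewrite -uy uE /rmul ioM mulgA.
have zz' := dZ.2 _ _ _ _ zZ z'Z zpq.
rewrite -zz' in uE zpq; have qE := rmulI zpq.
rewrite -uy (cf_Lop mulMI) (cf_Rop mulMI) qE (cf_Lop mulQI) (cf_Rop mulQI).
by rewrite (cf_pull (rmulI (z := z))) uE /rmul ioM mulgA.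
Qed.

(** The estimate holds on each finite set Y of coordinates, because there the
    operator acts on orthogonal copies of l^2(Q). *)
Lemma ext_norm c f : l2norm (comb (ext c) f) <= opnorm (comb c) * l2norm f.
Proof.
have bc := comb_bounded mulQI (R := R) c.
have n0 := opnorm_ge0 bc; have f0 := l2norm_ge0 f.
apply: l2norm_le => [|Y uY]; first by rewrite mulr_ge0.
have [Z aZ] := adapted_exists Y [seq t.2.1 | t <- c]; have [dZ cov _] := aZ.
rewrite (fsum_translates dZ _ uY cov).
apply: (@le_trans _ _ (\sum_(z <- Z) (opnorm (comb c) * l2norm (pull (rmul z) f)) ^+ 2)).
  rewrite big_seq [leRHS]big_seq; apply: ler_sum => z zZ.
  have zI := rmulI (z := z).
  rewrite big_seq (eq_bigr (fun q => normc (cf (comb c (pull (rmul z) f)) q) ^+ 2)).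
    rewrite -big_seq; apply: le_trans (l2norm_fsum _ (uniq_preim _ uY)) _.
    rewrite lerXn2r ?nnegrE ?l2norm_ge0 ?mulr_ge0 ?l2norm_ge0//.
    exact: opnorm_ub.
  move=> q; rewrite (mem_preim zI) => qY.
  by rewrite (ext_local f aZ _ zZ qY).
under eq_bigr => z _ do rewrite exprMn.
rewrite -mulr_sumr exprMn ler_wpM2l ?sqr_ge0//.
exact: bessel.
Qed.

Lemma ext_opnorm c : opnorm (comb (ext c) : l2 R M -> l2 R M) <= opnorm (comb c).
Proof.
by apply: opnorm_le => [|f]; [exact: opnorm_ge0 (comb_bounded mulQI c)|exact: ext_norm].
Qed.

Lemma extB c d : comb (ext c) - comb (ext d) =
  comb (ext ([seq (-1 * t.1, t.2) | t <- d] ++ c)) :> (l2 R M -> l2 R M).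
Proof. by rewrite ext_lin comb_lin scaleN1r addrC. Qed.

Lemma combB c d : comb c - comb d =
  comb ([seq (-1 * t.1, t.2) | t <- d] ++ c) :> (l2 R Q -> l2 R Q).
Proof. by rewrite comb_lin scaleN1r addrC. Qed.

Lemma ext_opnormB c d : opnorm (comb (ext c) - comb (ext d) : l2 R M -> l2 R M) <=
  opnorm (comb c - comb d).
Proof. by rewrite extB combB; exact: ext_opnorm. Qed.

(** The inflation map, an isometric embedding of C*(Q) in C*(M), is the closure
    of the map sending a combination of operators lambda_p lambda_q^* on l^2(Q)
    to the same combination on l^2(M). It is first handled through its graph. *)
Definition inflates (a : l2 R Q -> l2 R Q) (b : l2 R M -> l2 R M) :=
  bounded_op R M b /\ forall e : R, 0 < e -> exists c,
    opnorm (a - comb c) <= e /\ opnorm (b - comb (ext c)) <= e.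

Lemma inflates_exists a : cstar_lambda R Q a -> exists b, inflates a b.
Proof.
move=> /(cstar_lambda_dense mulQI lcmQ) [ba da].
have n0 (n : nat) : 0 < 1 / n.+1%:R :> R by rewrite divr_gt0.
pose c n := sval (cid (da _ (n0 n))).
have cP n : opnorm (a - comb (c n)) <= 1 / n.+1%:R := svalP (cid (da _ (n0 n))).
have bE n := comb_bounded mulMI (R := R) (ext (c n)).
have bQ n := comb_bounded mulQI (R := R) (c n).
have [|b bb Hb] := bounded_complete bE (K := 1).
  move=> n m; apply: le_trans (ext_opnormB _ _) _.
  have -> : comb (c n) - comb (c m) = (comb (c n) - a) + (a - comb (c m)).
    by rewrite addrA subrK.
  apply: le_trans (opnormD (boundedB (bQ n) ba) (boundedB ba (bQ m))) _.
  by apply: lerD => //; rewrite opnormC.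
exists b; split=> // e e0; have [n Hn] := small_inv 1 e0.
by exists (c n); split; [apply: le_trans (cP n) Hn|apply: le_trans (Hb n) Hn].
Qed.

Lemma inflates_lin k a a' b b' : bounded_op R Q a -> bounded_op R Q a' ->
  inflates a b -> inflates a' b' -> inflates (k *: a + a') (k *: b + b').
Proof.
move=> ba ba' [bb Hb] [bb' Hb']; split; first exact: bounded_comb.
move=> e e0; have k0 := normc_ge0 k.
have [|c [c1 c2]] := Hb (e / (2 * (normc k + 1))); first exact: div_pos.
have [|d [d1 d2]] := Hb' (e / 2); first by rewrite divr_gt0.
exists ([seq (k * t.1, t.2) | t <- c] ++ d).
have aux (N : monoidType) (u u' v v' : l2 R N -> l2 R N) :
    bounded_op R N u -> bounded_op R N u' -> bounded_op R N v -> bounded_op R N v' ->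
    opnorm (u - v) <= e / (2 * (normc k + 1)) -> opnorm (u' - v') <= e / 2 ->
    opnorm (k *: u + u' - (k *: v + v')) <= e.
  move=> bu bu' bv bv' le1 le2.
  have -> : k *: u + u' - (k *: v + v') = k *: (u - v) + (u' - v').
    by rewrite scalerBr opprD addrACA.
  have B1 := boundedB bu bv; have B2 := boundedB bu' bv'.
  have kB := bounded_comb k B1 (bounded0 R N); rewrite addr0 in kB.
  apply: le_trans (opnormD kB B2) _; rewrite [leRHS]splitr; apply: lerD => //.
  apply: le_trans (opnormZ k B1) _; rewrite mulrC.
  exact: mul_half (opnorm_ge0 B1) k0 le1.
split; first by rewrite comb_lin; apply: aux => //; exact: (comb_bounded mulQI).
by rewrite ext_lin comb_lin; apply: aux => //; exact: (comb_bounded mulMI).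
Qed.

Lemma inflates_opnorm a b : bounded_op R Q a -> inflates a b -> opnorm b <= opnorm a.
Proof.
move=> ba [bb Hb]; rewrite leNgt; apply/negP => lt.
have [|c [c1 c2]] := Hb ((opnorm b - opnorm a) / 3); first by rewrite divr_gt0// subr_gt0.
have bE := comb_bounded mulMI (R := R) (ext c).
have bQ := comb_bounded mulQI (R := R) c.
have := opnormD (boundedB bb bE) bE; rewrite subrK.
have := opnormD (boundedB bQ ba) ba; rewrite subrK opnormC.
have := ext_opnorm c.
move: c1 c2 lt; move: (opnorm (a - _)) (opnorm (b - _)) (opnorm (comb c)) => u v w.
move: (opnorm (comb _)) (opnorm a) (opnorm b) => p q r; lra.
Qed.

Lemma inflates_uniq a b b' : bounded_op R Q a -> inflates a b -> inflates a b' -> b = b'.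
Proof.
move=> ba ab ab'; have := inflates_lin (-1) ba ba ab ab'.
rewrite !scaleN1r addNr => H.
have := inflates_opnorm (bounded0 R Q) H.
have o0 : opnorm (0 : l2 R Q -> l2 R Q) <= 0.
  by apply: opnorm_le => // f; rewrite l2norm0 mul0r.
move=> /le_trans /(_ o0) n0.
apply/funext => f; apply/esym/eqP; rewrite -subr_eq0 addrC; apply/eqP/l2norm_eq0.
have := opnorm_ub f H.1; rewrite !fctE => /le_trans; apply.
by rewrite mulr_le0_ge0 ?l2norm_ge0.
Qed.

Lemma inflates_cstar a b : inflates a b -> cstar_lambda R M b.
Proof.
move=> [bb Hb]; apply: cstar_lambda_closed => // e e0.
have [c [_ c2]] := Hb e e0; exists (comb (ext c)) => //.
exact: (comb_cstar mulMI).
Qed.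

Lemma compress_inflates a b : bounded_op R Q a -> inflates a b -> compress b = a.
Proof.
move=> ba [bb Hb]; have bcb := compress_bounded bb.
have n0 : opnorm (compress b - a) <= 0.
  rewrite leNgt; apply/negP => lt.
  have [|c [c1 c2]] := Hb (opnorm (compress b - a) / 3); first by rewrite divr_gt0.
  have bE := comb_bounded mulMI (R := R) (ext c).
  have bQ := comb_bounded mulQI (R := R) c.
  have := compress_opnorm (boundedB bb bE); rewrite compressB compress_ext.
  have := opnormD (boundedB bcb bQ) (boundedB bQ ba); rewrite addrA subrK.
  rewrite [opnorm (comb c - a)]opnormC; move: c1 c2 lt.
  set u := opnorm (a - comb c); set v := opnorm (b - comb (ext c)).
  set w := opnorm (compress b - comb c); set x := opnorm (compress b - a).
  by clearbody u v w x; lra.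
apply/funext => f; apply/eqP; rewrite -subr_eq0; apply/eqP/l2norm_eq0.
have := opnorm_ub f (boundedB bcb ba); rewrite !fctE => /le_trans; apply.
by rewrite mulr_le0_ge0 ?l2norm_ge0.
Qed.

Lemma bessel_dot Z (g h : l2 R M) : disjoint_translates Z ->
  \sum_(z <- Z) l2norm (pull (rmul z) g) * l2norm (pull (rmul z) h) <=
  l2norm g * l2norm h.
Proof.
move=> dZ; apply: le_trans (fsum_cauchy _ _ _) _ => [z|z|]; try exact: l2norm_ge0.
have sq (f : l2 R M) : Num.sqrt (\sum_(z <- Z) l2norm (pull (rmul z) f) ^+ 2) <= l2norm f.
  by rewrite -[leRHS]ger0_norm ?l2norm_ge0// -sqrtr_sqr ler_wsqrtr// bessel.
by apply: ler_pM; rewrite ?sqrtr_ge0.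
Qed.

Lemma dot_translates Z Y Ps c (g h : l2 R M) : adapted Z Y Ps ->
  {subset [seq t.2.1 | t <- c] <= Ps} -> uniq Y -> (forall y, y \notin Y -> cf h y = 0) ->
  l2dot (comb (ext c) g) h =
  \sum_(z <- Z) l2dot (comb c (pull (rmul z) g)) (pull (rmul z) h).
Proof.
move=> aZ cP uY h0; have [dZ cov _] := aZ.
rewrite (l2dot_supp _ uY h0) (fsum_translates dZ _ uY cov).
apply: eq_big_seq => z zZ; have zI := rmulI (z := z).
rewrite (@l2dot_supp _ _ _ _ (pmap (preim_of (rmul z)) Y)) ?uniq_preim//.
  apply: eq_big_seq => q; rewrite (mem_preim zI) => qY.
  by rewrite (ext_local g aZ cP zZ qY) (cf_pull zI).
by move=> q; rewrite (mem_preim zI) (cf_pull zI); exact: h0.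
Qed.

Lemma inflates_dot a b (g h : l2 R M) e c Z Y Ps : bounded_op R Q a ->
  bounded_op R M b -> opnorm (a - comb c) <= e -> opnorm (b - comb (ext c)) <= e ->
  adapted Z Y Ps -> {subset [seq t.2.1 | t <- c] <= Ps} -> uniq Y ->
  (forall y, y \notin Y -> cf h y = 0) ->
  normc (l2dot (b g) h - \sum_(z <- Z) l2dot (a (pull (rmul z) g)) (pull (rmul z) h))
  <= e * (2 * (l2norm g * l2norm h)).
Proof.
move=> ba bb ac bc aZ cP uY h0; have [dZ _ _] := aZ.
have bE := comb_bounded mulMI (R := R) (ext c).
have bQ := comb_bounded mulQI (R := R) c.
have e0 : 0 <= e by apply: le_trans (opnorm_ge0 (boundedB ba bQ)) ac.
have est (N : monoidType) (u v : l2 R N -> l2 R N) (f f' : l2 R N) :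
    bounded_op R N u -> bounded_op R N v -> opnorm (u - v) <= e ->
    normc (l2dot (u f) f' - l2dot (v f) f') <= e * (l2norm f * l2norm f').
  move=> bu bv uv; rewrite -l2dotBl; apply: le_trans (l2_cauchy_schwarz _ _) _.
  rewrite mulrA ler_wpM2r ?l2norm_ge0//.
  apply: le_trans (opnorm_ub f (boundedB bu bv)) _.
  by rewrite ler_wpM2r ?l2norm_ge0.
have -> : e * (2 * (l2norm g * l2norm h)) =
    e * (l2norm g * l2norm h) + e * (l2norm g * l2norm h) by ring.
apply: (@normc_near _ (l2dot (comb (ext c) g) h)); first exact: est.
rewrite (dot_translates g aZ cP uY h0) -sumrB.
apply: le_trans (normc_sum _ _) _.
apply: (@le_trans _ _ (\sum_(z <- Z) e * (l2norm (pull (rmul z) g) * l2norm (pull (rmul z) h)))).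
  by apply: ler_sum => z _; exact: est.
by rewrite -mulr_sumr ler_wpM2l//; exact: bessel_dot.
Qed.

Section Positivity.
Variables (k : nat) (a : 'I_k -> 'I_k -> l2 R Q -> l2 R Q).
Variable b : 'I_k -> 'I_k -> l2 R M -> l2 R M.
Hypothesis ba : forall i j, bounded_op R Q (a i j).
Hypothesis ab : forall i j, inflates (a i j) (b i j).
Hypothesis pa : mx_positive a.

(** On vectors supported in a finite set the form of the matrix b is close to a
    sum of forms of the matrix a, one for each translate. *)
Lemma inflates_trunc_positive (Y : seq M) (f : 'I_k -> l2 R M) : uniq Y ->
  0 <= \sum_i \sum_j l2dot (b i j (trunc Y (f j))) (trunc Y (f i)).
Proof.
move=> uY; pose g i := trunc Y (f i); rewrite -/(g _).
pose K := \sum_i \sum_j 2 * (l2norm (g j) * l2norm (g i)).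
have K0 : 0 <= K.
  by apply: sumr_ge0 => i _; apply: sumr_ge0 => j _; rewrite !mulr_ge0 ?l2norm_ge0.
apply: complex_ge0_eps => e e0.
have [d d0 dK] : exists2 d : R, 0 < d & d * K <= e.
  exists (e / (2 * (K + 1))); first exact: div_pos.
  by have := mul_half (ltW (div_pos e0 K0)) K0 (lexx _); lra.
pose c i j := sval (cid ((ab i j).2 d d0)).
have cP i j : opnorm (a i j - comb (c i j)) <= d /\ opnorm (b i j - comb (ext (c i j))) <= d.
  exact: (svalP (cid ((ab i j).2 d d0))).
pose Ps := flatten [seq [seq t.2.1 | t <- c ij.1 ij.2] | ij : 'I_k * 'I_k].
have [Z aZ] := adapted_exists Y Ps.
exists (\sum_(z <- Z) \sum_i \sum_j l2dot (a i j (pull (rmul z) (g j))) (pull (rmul z) (g i))).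
  by apply: sumr_ge0 => z _; exact: pa.
have -> : \sum_(z <- Z) \sum_i \sum_j
      l2dot (a i j (pull (rmul z) (g j))) (pull (rmul z) (g i)) =
    \sum_i \sum_j \sum_(z <- Z)
      l2dot (a i j (pull (rmul z) (g j))) (pull (rmul z) (g i)).
  by rewrite exchange_big; apply: eq_bigr => i _; rewrite exchange_big.
apply: le_trans dK.
rewrite -sumrB /K mulr_sumr; apply: le_trans (normc_sum _ _) _; apply: ler_sum => i _.
rewrite -sumrB mulr_sumr; apply: le_trans (normc_sum _ _) _; apply: ler_sum => j _.
have [c1 c2] := cP i j.
apply: (inflates_dot _ (ba i j) (ab i j).1 c1 c2 aZ _ uY).
  move=> x xc; apply/flattenP; exists [seq t.2.1 | t <- c i j] => //.
  by apply/fintype.imageP; exists (i, j).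
by move=> y /negPf yY; rewrite cf_trunc yY.
Qed.

Lemma inflates_positive : mx_positive b.
Proof.
move=> f; have bb i j : bounded_op R M (b i j) := (ab i j).1.
pose K := \sum_i \sum_j opnorm (b i j) * (l2norm (f j) + l2norm (f i)).
have K0 : 0 <= K.
  apply: sumr_ge0 => i _; apply: sumr_ge0 => j _.
  by rewrite mulr_ge0 ?addr_ge0 ?l2norm_ge0 ?opnorm_ge0.
apply: complex_ge0_eps => e e0.
have [d d0 dK] : exists2 d : R, 0 < d & d * K <= e.
  exists (e / (2 * (K + 1))); first exact: div_pos.
  by have := mul_half (ltW (div_pos e0 K0)) K0 (lexx _); lra.
have tY i : exists Y : seq M, forall s : seq M, uniq s -> {subset Y <= s} -> l2norm (f i - trunc s (f i)) <= d.
  by have [Y _ HY] := trunc_approx (f i) d0; exists Y.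
pose Y0 i := sval (cid (tY i)).
pose Y := undup (flatten [seq Y0 i | i : 'I_k]).
have uY : uniq Y by exact: undup_uniq.
have Yf i : l2norm (f i - trunc Y (f i)) <= d.
  apply: (svalP (cid (tY i))) => // x xY; rewrite mem_undup; apply/flattenP.
  by exists (Y0 i) => //; apply/fintype.imageP; exists i.
exists (\sum_i \sum_j l2dot (b i j (trunc Y (f j))) (trunc Y (f i))).
  exact: inflates_trunc_positive.
apply: le_trans dK.
rewrite -sumrB /K mulr_sumr; apply: le_trans (normc_sum _ _) _; apply: ler_sum => i _.
rewrite -sumrB mulr_sumr; apply: le_trans (normc_sum _ _) _; apply: ler_sum => j _.
set gj := trunc Y (f j); set gi := trunc Y (f i).
have -> : l2dot (b i j (f j)) (f i) - l2dot (b i j gj) gi =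
    l2dot (b i j (f j - gj)) (f i) + l2dot (b i j gj) (f i - gi).
  by rewrite (linB _ _ (bb i j).1) l2dotBl l2dotBr addrA subrK.
apply: le_trans (le_normcD _ _) _.
have on0 := opnorm_ge0 (bb i j).
rewrite mulrDr mulrDr addrC; apply: lerD.
  apply: le_trans (l2_cauchy_schwarz _ _) _; rewrite [leRHS]mulrC.
  apply: ler_pM; [exact: l2norm_ge0|exact: l2norm_ge0| |exact: Yf].
  apply: le_trans (opnorm_ub gj (bb i j)) _.
  by apply: ler_wpM2l => //; exact: trunc_norm.
apply: le_trans (l2_cauchy_schwarz _ _) _; rewrite [leRHS]mulrA ler_wpM2r ?l2norm_ge0//.
apply: le_trans (opnorm_ub _ (bb i j)) _.
by rewrite [leLHS]mulrC ler_wpM2r//; exact: Yf.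
Qed.

End Positivity.

Definition inflate (a : l2 R Q -> l2 R Q) : l2 R M -> l2 R M :=
  if pselect (exists b, inflates a b) is left h then sval (cid h) else 0.

Lemma inflateP a : cstar_lambda R Q a -> inflates a (inflate a).
Proof.
by move=> /inflates_exists h; rewrite /inflate; case: pselect => // h'; case: cid.
Qed.

Lemma cstar_bounded (N : monoidType) a : cstar_lambda R N a -> bounded_op R N a.
Proof.
have lb : [set a | exists q, @is_lambda R N q a] `<=` bounded_op R N.
  by move=> b [q []].
by have [H _ _ _ _] := cstar_generated_is_cstar lb; exact: H.
Qed.

Lemma cstar_comb (N : monoidType) k a b : cstar_lambda R N a -> cstar_lambda R N b ->
  cstar_lambda R N (k *: a + b).
Proof.
have lb : [set a | exists q, @is_lambda R N q a] `<=` bounded_op R N.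
  by move=> c [q []].
by have [_ [_ H] _ _ _] := cstar_generated_is_cstar lb; exact: H.
Qed.

Lemma inflate_lin k a b : cstar_lambda R Q a -> cstar_lambda R Q b ->
  inflate (k *: a + b) = k *: inflate a + inflate b.
Proof.
move=> Sa Sb; have ba := cstar_bounded Sa; have bb := cstar_bounded Sb.
apply: (@inflates_uniq (k *: a + b)); first exact: bounded_comb.
  by apply: inflateP; exact: cstar_comb.
by apply: inflates_lin => //; exact: inflateP.
Qed.

(** The identity of C*(Q) factors as inflation followed by compression, two
    contractive completely positive maps through C*(M), so that approximations
    of the identity of C*(M) by matrix algebras induce such for C*(Q). *)
Theorem nuclear_submonoid :
  nuclear (cstar_lambda R M) -> nuclear (cstar_lambda R Q).
Proof.
move=> nM F finF FS e e0.
have [||n [phi [psi [cphi cpsi app]]]] := nM (inflate @` F) _ _ e e0.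
- exact: finite_image.
- by move=> _ [a Fa <-]; exact: inflates_cstar (inflateP (FS a Fa)).
exists n, (phi \o inflate), (compress \o psi).
have [p1 p2 p3 p4] := cphi; have [q1 q2 q3 q4] := cpsi.
have iS a : cstar_lambda R Q a -> cstar_lambda R M (inflate a).
  by move=> Sa; exact: inflates_cstar (inflateP Sa).
split.
- split=> /=.
  + by move=> a /iS; exact: p1.
  + by move=> k a b Sa Sb; rewrite inflate_lin// p2//; exact: iS.
  + move=> a Sa; apply: le_trans (p3 _ (iS _ Sa)) _.
    by apply: inflates_opnorm; [exact: cstar_bounded|exact: inflateP].
  + move=> k a Sa pa; apply: p4; first by move=> i j; exact: iS.
    apply: (inflates_positive (a := a)) => // i j.
      exact: cstar_bounded.
    exact: inflateP.
- split=> /=.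
  + by move=> a Sa; apply: compress_cstar; exact: q1.
  + by move=> k a b Sa Sb; rewrite q2// compress_lin.
  + move=> a Sa; apply: le_trans (compress_opnorm _) (q3 _ Sa).
    by apply: cstar_bounded; exact: q1.
  + by move=> k a Sa pa; apply: compress_positive; exact: q4.
- move=> a Fa; have Sa := FS a Fa; have iSa := iS a Sa.
  rewrite /= -{2}(compress_inflates (cstar_bounded Sa) (inflateP Sa)) -compressB.
  apply: le_lt_trans (compress_opnorm _) _; last by apply: app; exists a.
  by apply: (boundedB _ (cstar_bounded iSa)); apply: cstar_bounded; exact: q1 (p1 _ iSa).
Qed.

End Submonoid.

Local Close Scope ring_scope.
Local Close Scope complex_scope.
Local Open Scope group_scope.

(** * Actions of presented groups *)

Section PresentationActions.
Variables (X : choiceType) (rel : gword X -> gword X -> Prop) (Z : Type).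
Variables act inv : X -> Z -> Z.
Hypothesis actK : forall x z, inv x (act x z) = z.
Hypothesis invK : forall x z, act x (inv x z) = z.

Definition word_act (w : gword X) (z : Z) : Z :=
  foldr (fun l z => if l.2 then act l.1 z else inv l.1 z) z w.

Hypothesis rel_act : forall u v, rel u v -> word_act u =1 word_act v.

Lemma word_act_cat u v z : word_act (u ++ v) z = word_act u (word_act v z).
Proof. by rewrite /word_act foldr_cat. Qed.

Lemma gcongr_act u v : gcongr rel u v -> word_act u =1 word_act v.
Proof.
elim=> {u v}.
- exact: rel_act.
- by move=> x [] z /=; rewrite ?actK ?invK.
- by [].
- by move=> u v _ IH z.
- by move=> v u w _ IH1 _ IH2 z; rewrite IH1.
- by move=> u u' v v' _ IH1 _ IH2 z; rewrite !word_act_cat IH1 IH2.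
Qed.

(** Bijections respecting the relators assemble to an action of the presented
    group; all information on the group below comes from such actions. *)
Definition pres_act (g : presGroup rel) (z : Z) : Z := word_act (repr g) z.

Lemma pres_act_word u z : pres_act (pres_word rel u) z = word_act u z.
Proof. by apply/gcongr_act/pres_wordP; rewrite pres_word_repr. Qed.

Lemma pres_actM g h z : pres_act (g * h) z = pres_act g (pres_act h z).
Proof.
rewrite -(pres_word_repr g) -(pres_word_repr h).
have -> : pres_word rel (repr g) * pres_word rel (repr h) =
  pres_word rel (repr g ++ repr h) by exact: pres_mulE.
by rewrite !pres_act_word word_act_cat.
Qed.

Lemma pres_act1 z : pres_act 1 z = z.
Proof. exact: pres_act_word. Qed.

Lemma pres_act_gen x z : pres_act (pres_gen rel x) z = act x z.
Proof. exact: pres_act_word. Qed.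

End PresentationActions.

(** Induction on the number of generators, which are split off on the left. *)
Lemma gen_submonoid_ind (M : monoidType) (S C : set M) :
  C 1 -> (forall s y, S s -> C y -> C (s * y)) ->
  forall x, gen_submonoid S x -> C x.
Proof.
move=> C1 CM x Sx; rewrite -[x]mulg1.
apply: (Sx [set x | forall y, C y -> C (x * y)]) => //; split.
  split=> [y|y z Cy Cz w Cw]; first by rewrite mul1g.
  by rewrite -mulgA; exact/Cy/Cz.
by move=> s Ss y; exact: CM.
Qed.

Lemma gen_submonoid1 (M : monoidType) (S : set M) : gen_submonoid S 1.
Proof. by move=> C [[]]. Qed.

Lemma gen_submonoidM (M : monoidType) (S : set M) x y :
  gen_submonoid S x -> gen_submonoid S y -> gen_submonoid S (x * y).
Proof. by move=> Sx Sy C CS; apply: (CS.1.2); [exact: Sx|exact: Sy]. Qed.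

Lemma gen_submonoid_sub (M : monoidType) (S : set M) : S `<=` gen_submonoid S.
Proof. by move=> x Sx C [_]; apply. Qed.

(** * Trees *)

Section Trees.
Variable Gam : serreGraph.
Implicit Types (e f : edge Gam) (p q : seq (edge Gam)) (u v w : vert Gam).
Implicit Types (D : set (edge Gam)).

Lemma tgt_einv e : tgt (einv e) = org e.
Proof. by rewrite /tgt einvK. Qed.

Lemma epath_cat D p q u w :
  epath D u (p ++ q) w <-> exists2 v, epath D u p v & epath D v q w.
Proof.
elim: p u => [|e p IH] u /=; first by split=> [h|[v ->]//]; exists u.
split=> [[De ou /IH [v h1 h2]]|[v [De ou h1] h2]]; first by exists v.
by split=> //; apply/IH; exists v.
Qed.

Lemma epath_rcons D p e u w :
  epath D u (rcons p e) w <-> [/\ epath D u p (org e), D e & tgt e = w].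
Proof.
rewrite -cats1 epath_cat /=; split=> [[v h [De ov tw]]|[h De tw]]; first by rewrite ov.
by exists (org e).
Qed.

Lemma epath_sub D D' p u w : (forall e, e \in p -> D e -> D' e) ->
  epath D u p w -> epath D' u p w.
Proof.
elim: p u => [|e p IH] u //= DD' [De ou h]; split=> //.
  by apply: DD' => //; rewrite mem_head.
by apply: IH h => f fp; apply: DD'; rewrite inE fp orbT.
Qed.

Lemma epath_rev D p u w : (forall e, D e -> D (einv e)) ->
  epath D u p w -> epath D w (rev [seq einv e | e <- p]) u.
Proof.
move=> DV; elim: p u => [|e p IH] u /=; first by move->.
move=> [De ou /IH h]; rewrite rev_cons; apply/epath_rcons.
by split; [exact: h|exact: DV|rewrite tgt_einv].
Qed.

Definition reduced p := sorted (fun e f => f != einv e) p.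

Lemma not_uniq_map (I J : eqType) (h : I -> J) (s : seq I) : ~~ uniq (map h s) ->
  exists s1 x s2 y s3, s = s1 ++ x :: s2 ++ y :: s3 /\ h x = h y.
Proof.
elim: s => //= x s IH; rewrite negb_and negbK => /orP[/mapP [y ys xy]|/IH].
  have [s2 s3] := splitPr ys; by exists [::], x, s2, y, s3.
move=> [s1 [x' [s2 [y [s3 [-> hxy]]]]]].
by exists (x :: s1), x', s2, y, s3.
Qed.

(** A closed reduced path contains a circuit, namely any of its shortest closed
    segments. *)
Lemma reduced_circuit D p u : p <> [::] -> epath D u p u -> reduced p ->
  exists q, circuit D q.
Proof.
have [n] := ubnP (size p); elim: n p u => // n IH p u; rewrite ltnS => sp p0 pp rp.
have [up|/not_uniq_map [s1 [e [s2 [f [s3 [pE ef]]]]]]] := boolP (uniq [seq tgt e | e <- p]).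
  by exists p; split=> //; exists u.
apply: (IH (rcons s2 f) (tgt e)).
- by move: sp; rewrite pE size_rcons !size_cat /= size_cat /=; lia.
- by case: (s2).
- move: pp; rewrite pE => /epath_cat [v _ /= [_ _]].
  by rewrite -cat_rcons => /epath_cat [w h _]; have /epath_rcons [_ _ fw] := h; rewrite {2}ef fw.
- move: rp; rewrite pE /reduced => /cat_sorted2 [_] /= /path_sorted.
  by rewrite -cat_rcons => /cat_sorted2 [].
Qed.

(** Over a tree every closed path backtracks, so that a 1-cochain is a
    coboundary there. *)
Lemma tree_closed_trivial (Lam : groupType) (c : edge Gam -> Lam) D p u :
  (forall e, c (einv e) = (c e)^-1) -> (forall q, ~ circuit D q) ->
  epath D u p u -> foldr (fun e x => c e * x) 1 p = 1.
Proof.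
move=> cV nc; have [n] := ubnP (size p); elim: n p u => // n IH p u; rewrite ltnS => sp pp.
have fc q r : foldr (fun e x => c e * x) 1 (q ++ r) =
    foldr (fun e x => c e * x) 1 q * foldr (fun e x => c e * x) 1 r.
  by elim: q => [|e q IHq] /=; rewrite ?mul1g// IHq mulgA.
have [->//|p0] := eqVneq p [::].
have [rp|nrp] := boolP (reduced p).
  by have [q] := reduced_circuit (elimN eqP p0) pp rp; move/nc.
have [s1 [e [s2 pE]]] : exists s1 e s2, p = s1 ++ e :: einv e :: s2.
  move: nrp {sp pp p0}; elim: p => // e [|f p] //= IHp; rewrite negb_and negbK.
  case/orP=> [/eqP ->|/IHp [s1 [e' [s2 ->]]]]; first by exists [::], e, p.
  by exists (e :: s1), e', s2.
rewrite pE fc /= cV mulVKg -fc; apply: (IH _ u).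
  by move: sp; rewrite pE !size_cat /=; lia.
move: pp; rewrite pE => /epath_cat [v h1 /= [_ ov [_ _ h2]]].
by apply/epath_cat; exists v; rewrite // -ov -(tgt_einv e).
Qed.

Section SpanningTree.
Variable T : subgraph Gam.
Hypothesis Gam_connected : connected_graph Gam.
Hypothesis T_maximal : maximal_subtree T.

Lemma epath_exit (S : set (vert Gam)) p u v : epath setT u p v -> S u -> ~ S v ->
  exists e, S (org e) /\ ~ S (tgt e).
Proof.
elim: p u => [|e p IH] u /=; first by move->.
move=> [_ <- h] Su Sv; have [Se|Se] := pselect (S (tgt e)); first exact: IH Se Sv.
by exists e.
Qed.

(** A maximal subtree contains all the vertices: otherwise an edge leaving it
    can be added, and no circuit arises since its new end has valence one. *)
Section AddEdge.
Variable e : edge Gam.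
Hypothesis oT : sverts T (org e).
Hypothesis tT : ~ sverts T (tgt e).

Let verts' : set (vert Gam) := [set v | sverts T v \/ v = tgt e].
Let edges' : set (edge Gam) := [set f | [\/ sedges T f, f = e | f = einv e]].

Lemma add_edge_einv f : edges' f -> edges' (einv f).
Proof.
case=> [/sedges_einv Tf|->|->]; [exact: Or31|exact: Or33|rewrite einvK; exact: Or32].
Qed.

Lemma add_edge_org f : edges' f -> verts' (org f).
Proof. by case=> [/sedges_org Tf|->|->]; [left|left|right]. Qed.

Let T' := Subgraph add_edge_einv add_edge_org.

Lemma add_edge_out f : edges' f -> org f = tgt e -> f = einv e.
Proof.
case=> [/sedges_org Tf fe|-> oe|//]; first by case: tT; rewrite -fe.
by case: tT; rewrite -oe.
Qed.

Lemma add_edge_in f : edges' f -> tgt f = tgt e -> f = e.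
Proof.
by move=> /add_edge_einv h1 h2; apply: (can_inj (@einvK Gam)); exact: add_edge_out.
Qed.

Lemma add_edge_tree : is_tree T'.
Proof.
have [[v0 Tv0] Tc Tn] := T_maximal.1; split; first by exists v0; left.
- have con u v : sverts T u -> sverts T v -> exists p, epath edges' u p v.
    move=> Tu Tv; have [p hp] := Tc u v Tu Tv; exists p.
    by apply: epath_sub hp => f _ Tf; exact: Or31.
  have ce : edges' e by exact: Or32.
  have ceV : edges' (einv e) by exact: Or33.
  move=> u v /= [Tu|->] [Tv|->]; first exact: con.
  + have [p hp] := con u (org e) Tu oT; exists (rcons p e).
    by apply/epath_rcons.
  + have [p hp] := con (org e) v oT Tv; exists (einv e :: p) => /=.
    by rewrite tgt_einv.
  + by exists [::].
- move=> p [p0 [x px] up rp].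
  have oe : org e <> tgt e by move=> oe; apply: tT; rewrite -oe.
  have ends q f u v : epath edges' u (rcons q f) v -> v = tgt e -> f = e.
    by move=> /epath_rcons [_ Df tf] vE; apply: add_edge_in => //; rewrite tf.
  have starts f q u v : epath edges' u (f :: q) v -> u = tgt e -> f = einv e.
    by move=> /= [Df of_ _] uE; apply: add_edge_out => //; rewrite of_.
  have [ep|ep] := boolP (e \in p).
    move: px up rp p0; have [p1 p2] := splitPr ep.
    case: p2 => [|f p2]; last first.
      move=> /epath_cat [w _ /= [_ _ h]] _; rewrite /reduced => /cat_sorted2 [_] /=.
      by move=> /andP[fe _]; have := starts _ _ _ _ h erefl => fE; rewrite fE eqxx in fe.
    rewrite cats1 => px; have /epath_rcons [h1 _ tx] := px.
    case: p1 h1 px => [/= xo|f p1 h1 _]; first by case: oe; rewrite -xo tx.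
    have fE := starts _ _ _ _ h1 (esym tx); rewrite fE in h1 *.
    case: h1 => _ _; rewrite tgt_einv; elim/last_ind: p1 => [|p1 g _].
      by rewrite /reduced /= einvK eqxx.
    move=> /epath_rcons [_ _ tg]; rewrite /= map_rcons /= tgt_einv map_rcons tg.
    by rewrite mem_rcons inE mem_rcons inE eqxx orbT.
  have [eVp|eVp] := boolP (einv e \in p); last first.
    apply: (Tn p); split=> //; exists x; apply: epath_sub px => f fp.
    by case=> // fE; [move: ep|move: eVp]; rewrite -fE fp.
  move: px ep; have [p1 p2] := splitPr eVp => /epath_cat [w h1 h2].
  rewrite mem_cat negb_or inE negb_or => /and3P[ep1 _ ep2].
  have wE : w = tgt e by case: h2.
  have p1E : p1 = [::].
    elim/last_ind: p1 h1 ep1 => // p1 f _ h1; rewrite mem_rcons inE negb_or.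
    by rewrite (ends _ _ _ _ h1 wE) eqxx.
  have xE : x = tgt e by rewrite -wE; move: h1; rewrite p1E.
  case: h2 => _ _; rewrite tgt_einv; elim/last_ind: p2 ep2 => [_ /= ox|p2 f _].
    by case: oe; rewrite ox xE.
  by rewrite mem_rcons inE negb_or => /andP[/eqP fe _] h2; case: fe; rewrite (ends _ _ _ _ h2 xE).
Qed.

Lemma add_edge_contra : False.
Proof.
have [|sv _] := T_maximal.2 T' add_edge_tree.
  by split=> [v Tv|f Tf]; [left|exact: Or31].
by apply: tT; apply: sv; right.
Qed.

End AddEdge.

Lemma maximal_subtree_spanning v : sverts T v.
Proof.
have [[v0 Tv0] _ _] := T_maximal.1; apply: contrapT => nv.
have [p hp] := Gam_connected v0 v.
have [e [oT tT]] := epath_exit hp Tv0 nv.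
exact: (add_edge_contra oT tT).
Qed.

Lemma tree_path u v : exists p, epath (sedges T) u p v.
Proof. by have [_ Tc _] := T_maximal.1; apply: Tc; exact: maximal_subtree_spanning. Qed.

(** The potential at v is the product of c along a path of the tree from a base
    vertex to v. *)
Lemma tree_potential (Lam : groupType) (c : edge Gam -> Lam) :
  (forall e, c (einv e) = (c e)^-1) ->
  exists tau : vert Gam -> Lam, forall e, sedges T e -> tau (tgt e) = tau (org e) * c e.
Proof.
move=> cV; have [[v0 Tv0] _ Tn] := T_maximal.1.
pose pp p := foldr (fun e x => c e * x) 1 p.
have ppc q r : pp (q ++ r) = pp q * pp r.
  by rewrite /pp; elim: q => [|e q IHq] /=; rewrite ?mul1g// IHq mulgA.
have ppV p : pp (rev [seq einv e | e <- p]) = (pp p)^-1.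
  elim: p => [|e p IH]; first by rewrite /= invg1.
  by rewrite /= rev_cons -cats1 ppc IH /= mulg1 cV invgM.
pose path_to v := sval (cid (tree_path v0 v)).
have pathP v : epath (sedges T) v0 (path_to v) v := svalP (cid (tree_path v0 v)).
exists (fun v => pp (path_to v)) => e Te.
have := @tree_closed_trivial _ c (sedges T)
  (path_to (org e) ++ e :: rev [seq einv e | e <- path_to (tgt e)]) v0 cV Tn.
rewrite -/(pp _) ppc /= -/(pp _) ppV => H.
apply/eqP; rewrite eq_sym -[_ == _](inj_eq (mulIg (pp (path_to (tgt e)))^-1)).
rewrite mulgV -mulgA; apply/eqP/H/epath_cat; exists (org e) => //=; split=> //.
by apply: epath_rev (pathP _); exact: sedges_einv.
Qed.

End SpanningTree.
End Trees.

(** * The vertex groups embed in the fundamental group *)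

Record nat_bij := NatBij {
  nb_fun :> nat -> nat;
  nb_inv : nat -> nat;
  nb_funK : cancel nb_fun nb_inv;
  nb_invK : cancel nb_inv nb_fun }.

Lemma nat_bij_eq (f g : nat_bij) : f =1 g -> f = g.
Proof.
case: f g => f f' fK f'K [g g' gK g'K] /= fg.
have {}fg : f = g by exact/funext.
case: _ / fg in gK g'K *.
have fg' : f' = g' by apply/funext => n; rewrite -[n in LHS]g'K fK.
by case: _ / fg' in gK g'K *; congr NatBij; exact: Prop_irrelevance.
Qed.

HB.instance Definition _ := gen_eqMixin nat_bij.
HB.instance Definition _ := gen_choiceMixin nat_bij.

Definition nat_bij_mul (f g : nat_bij) : nat_bij :=
  NatBij (can_comp (nb_funK f) (nb_funK g)) (can_comp (nb_invK g) (nb_invK f)).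
Definition nat_bij_one : nat_bij := @NatBij id id (fun _ => erefl) (fun _ => erefl).
Definition nat_bij_inv (f : nat_bij) : nat_bij := NatBij (nb_invK f) (nb_funK f).

Lemma nat_bij_mulA : associative nat_bij_mul. Proof. by move=> f g h; exact: nat_bij_eq. Qed.
Lemma nat_bij_mul1g : left_id nat_bij_one nat_bij_mul. Proof. by move=> f; exact: nat_bij_eq. Qed.
Lemma nat_bij_mulg1 : right_id nat_bij_one nat_bij_mul. Proof. by move=> f; exact: nat_bij_eq. Qed.
Lemma nat_bij_mulVg : left_inverse nat_bij_one nat_bij_inv nat_bij_mul.
Proof. by move=> f; apply: nat_bij_eq => n /=; rewrite nb_funK. Qed.
Lemma nat_bij_mulgV : right_inverse nat_bij_one nat_bij_inv nat_bij_mul.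
Proof. by move=> f; apply: nat_bij_eq => n /=; rewrite nb_invK. Qed.

HB.instance Definition _ := isGroup.Build nat_bij
  nat_bij_mulA nat_bij_mul1g nat_bij_mulg1 nat_bij_mulVg nat_bij_mulgV.

Lemma nat_bijM (f g : nat_bij) n : (f * g) n = f (g n). Proof. by []. Qed.
Lemma nat_bijK (f : nat_bij) n : f^-1 (f n) = n. Proof. exact: nb_funK. Qed.

Lemma denumerable_nat (D : set nat) (s : nat -> nat) : injective s ->
  (forall n, D (s n)) -> exists e : nat -> nat,
  injective e /\ forall n, D n <-> exists i, n = e i.
Proof.
move=> sI Ds; have infD : ~ finite_set D.
  move=> finD; have : finite_set (range s) by apply: sub_finite_set finD => _ [n _ <-].
  have := inj_card_eq (A := setT) (f := s) (in2W sI).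
  by rewrite card_eq_le => /andP[_ le]; apply/infiniteP.
have := eq_card_nat (countableP D) infD.
rewrite card_eq_sym => /card_set_bijP [e [eD eI eS]].
exists e; split; first by move=> x y /eI; apply; rewrite inE.
move=> n; split=> [/eS [i _ <-]|[i ->]]; first by exists i.
exact: eD.
Qed.

Section FreeActions.
Variable H : groupType.
Implicit Types (alpha beta : H -> nat_bij).

Definition is_action alpha := forall g h, alpha (g * h) = alpha g * alpha h.
Definition free_action alpha := forall g n, alpha g n = n -> g = 1.
Definition many_orbits alpha :=
  exists s : nat -> nat, forall i j g, alpha g (s i) = s j -> i = j.

Lemma is_action1 alpha : is_action alpha -> alpha 1 = 1.
Proof. by move=> aM; apply: (mulgI (alpha 1)); rewrite -aM !mulg1. Qed.

Lemma is_actionV alpha g : is_action alpha -> alpha g^-1 = (alpha g)^-1.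
Proof.
by move=> aM; apply: (mulgI (alpha g)); rewrite -aM !mulgV is_action1.
Qed.

(** The translation action of H on H * nat, carried over to nat. *)
Lemma free_model : countable [set: H] ->
  exists alpha, [/\ is_action alpha, free_action alpha & many_orbits alpha].
Proof.
move=> cH; have /countable_injP [f fI] : countable [set: H * nat].
  by rewrite -setXTT; apply: countableX => //; exact: countableP.
have {}fI : injective f by move=> x y; apply: fI; rewrite inE.
have [|i|e [eI eS]] := @denumerable_nat (range f) (fun i => f (1, i)).
- by move=> i j /fI [].
- by exists (1, i).
have ed n : exists d, f d = e n by have [_ [|d _ dE]] := eS (e n); [exists n|exists d].
have de d : exists n, f d = e n by apply/eS; exists d.
pose dec n := sval (cid (ed n)); pose enc d := sval (cid (de d)).
have decP n : f (dec n) = e n := svalP (cid (ed n)).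
have encP d : f d = e (enc d) := svalP (cid (de d)).
have decK n : enc (dec n) = n by apply: eI; rewrite -encP decP.
have encK d : dec (enc d) = d by apply: fI; rewrite decP -encP.
pose act g n := enc (g * (dec n).1, (dec n).2).
have actM g h n : act g (act h n) = act (g * h) n by rewrite /act encK mulgA.
have act1 n : act 1 n = n by rewrite /act mul1g -surjective_pairing decK.
have actK g : cancel (act g) (act g^-1) by move=> n; rewrite actM mulVg act1.
have actVK g : cancel (act g^-1) (act g) by move=> n; rewrite actM mulgV act1.
exists (fun g => NatBij (actK g) (actVK g)); split.
- by move=> g h; apply: nat_bij_eq => n; rewrite nat_bijM /= actM.
- move=> g n /= gn; have := encK (g * (dec n).1, (dec n).2).
  rewrite -/(act g n) gn => dn; have := congr1 fst dn => /= /esym dn1.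
  by apply: (mulIg (dec n).1); rewrite mul1g.
- exists (fun i => enc (1, i)) => i j g /= /(congr1 dec).
  by rewrite /act !encK => -[].
Qed.

(** A free action with infinitely many orbits is isomorphic to the translation
    action on H * nat, once the orbits have been numbered. *)
Lemma orbit_coordinates alpha :
  is_action alpha -> free_action alpha -> many_orbits alpha ->
  exists (e : nat -> nat) (dec : nat -> H * nat),
    (forall n, alpha (dec n).1 (e (dec n).2) = n) /\
    forall h i, dec (alpha h (e i)) = (h, i).
Proof.
move=> aM aF [s sO].
pose orb n : set nat := [set m | exists h, m = alpha h n].
have a1 n : alpha 1 n = n by rewrite is_action1.
have orbE h n : orb (alpha h n) = orb n.
  apply/seteqP; split=> m [g ->]; first by exists (g * h); rewrite aM.
  by exists (g * h^-1); rewrite aM nat_bijM is_actionV// nat_bijK.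
pose rep n := xget 0%N (orb n).
have repP n : exists h, rep n = alpha h n.
  by apply: (@xgetPex _ 0%N (orb n)); exists n, 1; rewrite a1.
have repE h n : rep (alpha h n) = rep n by rewrite /rep orbE.
have repK n : rep (rep n) = rep n by have [h hE] := repP n; rewrite {1}hE repE.
have [||e [eI eS]] := @denumerable_nat [set m | rep m = m] (fun i => rep (s i)).
- move=> i j; have [h ->] := repP (s i); have [g ->] := repP (s j).
  move=> /(congr1 (alpha g^-1)); rewrite [in RHS]is_actionV// nat_bijK -nat_bijM -aM.
  exact: sO.
- by move=> n /=; exact: repK.
have eR i : rep (e i) = e i by apply/eS; exists i.
have dE n : exists d : H * nat, alpha d.1 (e d.2) = n.
  have [i iE] : exists i, rep n = e i by apply/eS; exact: repK.
  have [h hE] := repP n; exists (h^-1, i) => /=.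
  by rewrite -iE hE is_actionV// nat_bijK.
pose dec n := sval (cid (dE n)).
have decP n : alpha (dec n).1 (e (dec n).2) = n := svalP (cid (dE n)).
exists e, dec; split=> // h i; have := decP (alpha h (e i)).
case: (dec _) => g j /= gj.
have ij : i = j by apply: eI; rewrite -(eR i) -(eR j) -(repE h) -gj repE.
rewrite ij in gj *; congr (_, _).
have hg : h^-1 * g = 1.
  by apply: (aF _ (e j)); rewrite aM nat_bijM gj is_actionV// nat_bijK.
by rewrite -(mulVKg h g) hg mulg1.
Qed.

Lemma equivariant_bij alpha beta :
  is_action alpha -> free_action alpha -> many_orbits alpha ->
  is_action beta -> free_action beta -> many_orbits beta ->
  exists phi : nat_bij, forall h, alpha h * phi = phi * beta h.
Proof.
move=> aM aF aO bM bF bO.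
have [e [dec [decK eK]]] := orbit_coordinates aM aF aO.
have [e' [dec' [decK' eK']]] := orbit_coordinates bM bF bO.
have K1 : cancel (fun n => alpha (dec' n).1 (e (dec' n).2))
                 (fun n => beta (dec n).1 (e' (dec n).2)).
  by move=> n; rewrite eK /= decK'.
have K2 : cancel (fun n => beta (dec n).1 (e' (dec n).2))
                 (fun n => alpha (dec' n).1 (e (dec' n).2)).
  by move=> n; rewrite eK' /= decK.
exists (NatBij K1 K2) => h; apply: nat_bij_eq => n; rewrite !nat_bijM /=.
have -> : dec' (beta h n) = (h * (dec' n).1, (dec' n).2).
  have -> : beta h n = beta (h * (dec' n).1) (e' (dec' n).2).
    by rewrite bM nat_bijM decK'.
  exact: eK'.
by rewrite /= aM.
Qed.

End FreeActions.

Section GroupCast.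

Definition gcast (H H' : groupType) (E : H = H') (x : H) : H' :=
  eq_rect H (fun K : groupType => K) x H' E.

Lemma gcastM (H H' : groupType) (E : H = H') x y : gcast E (x * y) = gcast E x * gcast E y.
Proof. by case: _ / E. Qed.

Lemma gcast_inj (H H' : groupType) (E : H = H') : injective (gcast E).
Proof. by case: _ / E. Qed.

Lemma gcast_trans (H H' H'' : groupType) (E : H = H') (E' : H' = H'') x :
  gcast E' (gcast E x) = gcast (etrans E E') x.
Proof. by case: _ / E'; case: _ / E. Qed.

End GroupCast.

Section EdgeMaps.
Variables (Gam : serreGraph) (GG : graphOfGroups Gam).
Implicit Types e : edge Gam.

Lemma eflipE e (x : gedge GG e) : eflip x = gcast (esym (gedge_einv GG e)) x.
Proof. by []. Qed.

Lemma eflipM e : {morph @eflip _ GG e : x y / x * y}.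
Proof. by move=> x y; rewrite !eflipE gcastM. Qed.

Lemma eflip_inj e : injective (@eflip _ GG e).
Proof. by move=> x y; rewrite !eflipE => /gcast_inj. Qed.

Lemma emb_orgM e : {morph emb_org GG e : x y / x * y}.
Proof. by move=> x y; rewrite gmulfM. Qed.

Lemma emb_org1 e : emb_org GG e 1 = 1.
Proof. by apply: (mulgI (emb_org GG e 1)); rewrite -emb_orgM !mulg1. Qed.

Lemma emb_orgV e x : emb_org GG e x^-1 = (emb_org GG e x)^-1.
Proof. by apply: (mulgI (emb_org GG e x)); rewrite -emb_orgM !mulgV emb_org1. Qed.

Lemma emb_tgtM e : {morph @emb_tgt _ GG e : x y / x * y}.
Proof. by move=> x y; rewrite /emb_tgt eflipM gmulfM. Qed.

Lemma emb_tgt1 e : @emb_tgt _ GG e 1 = 1.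
Proof. by apply: (mulgI (@emb_tgt _ GG e 1)); rewrite -emb_tgtM !mulg1. Qed.

Lemma emb_tgt_inj e : injective (@emb_tgt _ GG e).
Proof. by move=> x y /emb_org_inj/eflip_inj. Qed.

(** Flipping an edge twice changes nothing, up to the identification of the
    edge with its double inverse; hence the statement for pairs. *)
Lemma emb_tgt_eflip e (x : gedge GG e) :
  existT (gvert GG) (tgt (einv e)) (emb_tgt (eflip x)) =
  existT (gvert GG) (org e) (emb_org GG e x).
Proof.
have gen e' (E : e = e') (E' : gedge GG e = gedge GG e') :
    existT (gvert GG) (org e') (emb_org GG e' (gcast E' x)) =
    existT (gvert GG) (org e) (emb_org GG e x).
  case: _ / E in E' *; congr existT; congr (emb_org _ _ _).
  by rewrite (Prop_irrelevance E' erefl).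
by rewrite /emb_tgt !eflipE gcast_trans; apply: gen; rewrite einvK.
Qed.

End EdgeMaps.

Section Injectivity.
Variables (Gam : serreGraph) (GG : graphOfGroups Gam).
Variables (A : set (edge Gam)) (T : subgraph Gam).
Hypothesis Gam_connected : connected_graph Gam.
Hypothesis G_countable : forall v : vert Gam, countable [set: gvert GG v].
Hypothesis T_maximal : maximal_subtree T.

Notation G := (fundGroup GG A T).
Notation fgv v := (@fg_vert _ GG A T v).

Lemma fg_vertM v (g h : gvert GG v) : fgv v (g * h) = fgv v g * fgv v h.
Proof.
rewrite /fg_vert /pres_gen; apply/esym.
transitivity (pres_word (@Defs.grel _ GG A T) (gvgen A g ++ gvgen A h)); first exact: pres_mulE.
by apply/pres_wordP/gcongr_rel/grel_vert.
Qed.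

Lemma fg_edge_rel (e : A) (x : gedge GG (val e)) :
  fgv _ (emb_org GG _ x) * fg_edge GG T e = fg_edge GG T e * fgv _ (emb_tgt x).
Proof.
transitivity (pres_word (@Defs.grel _ GG A T) (gvgen A (emb_org GG _ x) ++ gegen GG e)).
  exact: pres_mulE.
transitivity (pres_word (@Defs.grel _ GG A T) (gegen GG e ++ gvgen A (emb_tgt x))).
  by apply/pres_wordP/gcongr_rel/grel_edge.
by apply/esym; exact: pres_mulE.
Qed.

Lemma fg_tree_rel e (x : gedge GG e) : sedges T e ->
  fgv _ (emb_org GG _ x) = fgv _ (emb_tgt x).
Proof. by move=> Te; apply/pres_wordP/gcongr_rel/grel_tree. Qed.

Lemma fg_vert1 v : fgv v 1 = 1.
Proof. by apply: (mulgI (fgv v 1)); rewrite -fg_vertM !mulg1. Qed.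

Lemma fg_vertV v (g : gvert GG v) : fgv v g^-1 = (fgv v g)^-1.
Proof. by apply: (mulgI (fgv v g)); rewrite -fg_vertM !mulgV fg_vert1. Qed.

(** The vertex groups embed: free actions of all of them on nat can be
    conjugated so as to agree on the edge groups, because free actions with
    infinitely many orbits of one countable group are all isomorphic. *)
Lemma fg_vert_inj v : injective (fgv v).
Proof.
pose al v := sval (cid (free_model (@G_countable v))).
have alP u : [/\ is_action (al u), free_action (al u) & many_orbits (al u)] :=
  svalP (cid (free_model (@G_countable u))).
pose ao e (x : gedge GG e) := al (org e) (emb_org GG e x).
pose at' e (x : gedge GG e) := al (tgt e) (emb_tgt x).
have raw e : exists phi : nat_bij, forall x, ao e x * phi = phi * at' e x.
  have [oM oF [so oO]] := alP (org e); have [tM tF [st tO]] := alP (tgt e).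
  apply: equivariant_bij.
  - by move=> x y; rewrite /ao gmulfM oM.
  - by move=> x n /oF h; apply: (@emb_org_inj _ GG e); rewrite h emb_org1.
  - by exists so => i j x; exact: oO.
  - by move=> x y; rewrite /at' emb_tgtM tM.
  - move=> x n /tF h; by apply: (@emb_tgt_inj _ _ e); rewrite h emb_tgt1.
  - by exists st => i j x; exact: tO.
pose phi e := sval (cid (raw e)).
have phiP e x : ao e x * phi e = phi e * at' e x := svalP (cid (raw e)) x.
(* choice of one orientation of every edge, so that opposite edges get inverse
   bijections *)
pose s (e : edge Gam) := choose (pred2 e (einv e)) e.
have sV e : s (einv e) = s e.
  rewrite /s (@eq_choose _ _ (pred2 e (einv e))).
    by apply: choose_id; rewrite /= ?eqxx ?orbT.
  by move=> f; rewrite /= einvK orbC.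
have sE e : s e = e \/ s e = einv e.
  have : pred2 e (einv e) (s e) by apply: chooseP; rewrite /= eqxx.
  by move=> /orP[/eqP|/eqP]; [left|right].
pose c (e : edge Gam) := if s e == e then phi e else (phi (einv e))^-1.
have neV (e : edge Gam) : (einv e == e) = false by apply/eqP; exact: einv_neq.
have cV e : c (einv e) = (c e)^-1.
  rewrite /c sV; have [->|->] := sE e; first by rewrite eqxx eq_sym neV einvK.
  by rewrite eqxx neV invgK.
have cP e x : ao e x * c e = c e * at' e x.
  rewrite /c; case: ifP => _; first exact: phiP.
  have := phiP (einv e) (eflip x).
  have -> : at' (einv e) (eflip x) = ao e x.
    by rewrite /at' /ao; have := emb_tgt_eflip x => E; have := congr1 (fun p => al (tag p) (tagged p)) E.
  move=> E; apply: (mulgI (phi (einv e))); rewrite mulgA -E -/(at' e x).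
  by rewrite mulgK mulVKg.
have [tau tauP] := tree_potential Gam_connected T_maximal cV.
pose act (x : ggen GG A) : nat_bij := match x with
  | inl p => tau (tag p) * al (tag p) (tagged p) * (tau (tag p))^-1
  | inr e => tau (org (val e)) * c (val e) * (tau (tgt (val e)))^-1 end.
have wa u n : word_act (fun x => act x) (fun x => (act x)^-1) u n =
    foldr (fun l z => (if l.2 then act l.1 else (act l.1)^-1) * z) 1 u n.
  by elim: u n => [|[x []] u IH] n //=; rewrite IH.
have relP u w : @Defs.grel _ GG A T u w ->
    word_act (fun x => act x) (fun x => (act x)^-1) u =1
    word_act (fun x => act x) (fun x => (act x)^-1) w.
  move=> uw n; rewrite !wa; congr (nb_fun _ n); case: uw => {u w}.
  - move=> u g h /=; rewrite !mulg1; have [aM _ _] := alP u.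
    by rewrite aM !mulgA mulgVK.
  - move=> e x /=; rewrite !mulg1 !mulgA mulgVK; congr (_ * _).
    by rewrite mulgVK -!mulgA; congr (_ * _); exact: cP.
  - move=> e x Te /=; rewrite !mulg1 tauP// invgM !mulgA; congr (_ * _).
    by rewrite -[_ * c e * _]mulgA -cP !mulgA mulgK.
move=> g h gh; have [aM aF _] := alP v.
have actE k n : pres_act (fun x => act x) (fun x => (act x)^-1) (fgv v k) n =
    (tau v * al v k * (tau v)^-1) n.
  by rewrite pres_act_gen//; move=> x z; rewrite /= ?nb_funK ?nb_invK.
have : tau v * al v g * (tau v)^-1 = tau v * al v h * (tau v)^-1.
  by apply: nat_bij_eq => n; rewrite -!actE gh.
move=> /mulIg/mulgI gh'; apply: (mulgI h^-1); rewrite mulVg.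
by apply: (aF _ 0%N); rewrite aM is_actionV// -gh' nat_bijM nat_bijK.
Qed.

End Injectivity.

(** * Cuts of the Bass-Serre tree *)

(** The group of order two, in which edge crossings are counted. *)
Definition parity := bool.
HB.instance Definition _ := Choice.on parity.
HB.instance Definition _ := isGroup.Build parity
  (addbA : associative (addb : parity -> parity -> parity))
  (addFb : left_id (false : parity) addb) (addbF : right_id (false : parity) addb)
  (addbb : left_inverse (false : parity) id addb)
  (addbb : right_inverse (false : parity) id addb).

Section SkewProducts.
Variables (X : choiceType) (rel : gword X -> gword X -> Prop).
Variable c : X -> presGroup rel -> bool.

Definition skew_act (x : X) (z : presGroup rel * bool) : presGroup rel * bool :=
  (pres_gen rel x * z.1, z.2 (+) c x z.1).
Definition skew_inv (x : X) (z : presGroup rel * bool) : presGroup rel * bool :=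
  ((pres_gen rel x)^-1 * z.1, z.2 (+) c x ((pres_gen rel x)^-1 * z.1)).

Hypothesis rel_skew : forall u v, rel u v ->
  word_act skew_act skew_inv u =1 word_act skew_act skew_inv v.

(** Integrating along words a mod 2 cochain on the Cayley graph that vanishes
    around the relators; the group acts on the associated double cover. *)
Lemma skew_primitive : exists F : presGroup rel -> bool,
  F 1 = false /\ forall x g, F (pres_gen rel x * g) = F g (+) c x g.
Proof.
have aK x z : skew_inv x (skew_act x z) = z.
  by case: z => g b; rewrite /skew_inv /skew_act /= mulKg -addbA addbb addbF.
have iK x z : skew_act x (skew_inv x z) = z.
  by case: z => g b; rewrite /skew_inv /skew_act /= mulVKg -addbA addbb addbF.
have w1 u z : (word_act skew_act skew_inv u z).1 = pres_word rel u * z.1.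
  elim: u => [|[x []] u IH] /=; first by rewrite [pres_word _ _](_ : _ = 1)// mul1g.
    rewrite IH mulgA; congr (_ * _); exact: pres_mulE.
  rewrite IH mulgA; congr (_ * _).
  have -> : (pres_gen rel x)^-1 = pres_word rel [:: (x, false)].
    apply: (mulgI (pres_gen rel x)); rewrite mulgV; apply/esym.
    transitivity (pres_word rel ([:: (x, true)] ++ [:: (x, false)])); first exact: pres_mulE.
    by apply/pres_wordP; exact: (gcongr_cancel rel x true).
  exact: pres_mulE.
pose act (g : presGroup rel) := pres_act skew_act skew_inv g (1, false).
have a1 g : (act g).1 = g by rewrite /act /pres_act w1 pres_word_repr mulg1.
exists (fun g => (act g).2); split; first by rewrite /act pres_act1.
move=> x g; rewrite {1}/act pres_actM// pres_act_gen// -/(act g) /skew_act /=.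
by rewrite a1.
Qed.

End SkewProducts.

Section GraphOfMonoids.
Variables (Gam : serreGraph) (GG : graphOfGroups Gam).
Variables (A : set (edge Gam)) (T : subgraph Gam).
Variables (P : forall v : vert Gam, set (gvert GG v)).
Arguments P : clear implicits.
Hypothesis Gam_connected : connected_graph Gam.
Hypothesis G_countable : forall v : vert Gam, countable [set: gvert GG v].
Hypothesis T_maximal : maximal_subtree T.
Hypothesis P_cone : forall v : vert Gam, positive_cone (P v).
Hypothesis P_tree : forall e : edge Gam, sedges T e -> pos_tgt P e = pos_org P e.
Variables Ap Am : set (edge Gam).
Hypothesis A_decomp : A = Ap `|` Am.
Hypothesis P_plus : forall e : edge Gam, Ap e ->
  @emb_tgt Gam GG e @` pos_org P e `<=` P (tgt e).
Hypothesis P_minus : forall e : edge Gam, Am e ->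
  @emb_tgt Gam GG e @` pos_org P e `<=` [set g | P (tgt e) (g^-1)%g].
Hypothesis lcm : condLCM GG A T P.

Local Notation G := (fundGroup GG A T).
Local Notation fgv v := (@fg_vert _ GG A T v).
Implicit Types (e f : edge Gam) (v w : vert Gam) (x y z k p q s : G).

(** Working with subsets of the fundamental group avoids the dependent types of
    the vertex and edge groups. The group of an edge is taken at its origin. *)
Definition VG v : set G := [set x | exists g : gvert GG v, x = fgv v g].
Definition PG v : set G := [set x | exists2 g : gvert GG v, P v g & x = fgv v g].
Definition KG e : set G := [set x | exists h : gedge GG e, x = fgv _ (emb_org GG e h)].
Definition KP e : set G := [set x | KG e x /\ PG (org e) x].

Lemma fgv_inj v : injective (fgv v).
Proof. exact: fg_vert_inj. Qed.

Lemma PG_VG v x : PG v x -> VG v x. Proof. by move=> [g _ ->]; exists g. Qed.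
Lemma VGM v x y : VG v x -> VG v y -> VG v (x * y).
Proof. by move=> [g ->] [h ->]; exists (g * h); rewrite fg_vertM. Qed.
Lemma VGV v x : VG v x -> VG v x^-1.
Proof. by move=> [g ->]; exists g^-1; rewrite fg_vertV. Qed.
Lemma PG1 v : PG v 1.
Proof. by exists 1; [have [[]] := P_cone v|rewrite fg_vert1]. Qed.
Lemma PGM v x y : PG v x -> PG v y -> PG v (x * y).
Proof.
move=> [g Pg ->] [h Ph ->]; exists (g * h); last by rewrite fg_vertM.
by have [[_ PM] _ _] := P_cone v; exact: PM.
Qed.
Lemma PG_total v x : VG v x -> PG v x \/ PG v x^-1.
Proof.
move=> [g ->]; have [_ tot _] := P_cone v; have [Pg|Pg] := tot g.
  by left; exists g.
by right; exists g^-1; rewrite ?fg_vertV.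
Qed.
Lemma PG_fgv v g : PG v (fgv v g) -> P v g.
Proof. by move=> [h Ph /fgv_inj ->]. Qed.

Lemma KG_VG e x : KG e x -> VG (org e) x.
Proof. by move=> [h ->]; exists (emb_org GG e h). Qed.
Lemma KG1 e : KG e 1. Proof. by exists 1; rewrite emb_org1 fg_vert1. Qed.
Lemma KGM e x y : KG e x -> KG e y -> KG e (x * y).
Proof. by move=> [g ->] [h ->]; exists (g * h); rewrite emb_orgM fg_vertM. Qed.
Lemma KGV e x : KG e x -> KG e x^-1.
Proof. by move=> [g ->]; exists g^-1; rewrite emb_orgV fg_vertV. Qed.
Lemma KGMl e x y : KG e x -> KG e (x * y) <-> KG e y.
Proof.
move=> Kx; split=> [Kxy|]; last exact: KGM.
by rewrite -[y](mulKg x); apply: KGM => //; exact: KGV.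
Qed.

Lemma KP1 e : KP e 1. Proof. by split; [exact: KG1|exact: PG1]. Qed.

Lemma KG_einv_sub e : sedges T e -> KG e `<=` KG (einv e).
Proof. by move=> Te x [h ->]; exists (eflip h); rewrite fg_tree_rel. Qed.

Lemma KG_einv e : sedges T e -> KG (einv e) = KG e.
Proof.
move=> Te; apply/seteqP; split; last exact: KG_einv_sub.
by rewrite -{2}[e]einvK; apply: KG_einv_sub; exact: sedges_einv.
Qed.

Lemma KP_tgt e x : sedges T e -> KP e x -> PG (tgt e) x.
Proof.
move=> Te [[h ->] /PG_fgv Ph]; exists (emb_tgt h); last exact: fg_tree_rel.
have : pos_org P e h by []. by rewrite -P_tree.
Qed.

Lemma KP_einv e : sedges T e -> KP (einv e) = KP e.
Proof.
have sub f : sedges T f -> KP f `<=` KP (einv f).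
  by move=> Tf x Kx; split; [rewrite KG_einv//; case: Kx|exact: KP_tgt].
move=> Te; apply/seteqP; split; last exact: sub.
by rewrite -{2}[e]einvK; apply: sub; exact: sedges_einv.
Qed.

Lemma KP_edge (e : A) :
  (forall x, KP (val e) x -> exists2 x', PG (tgt (val e)) x' &
     x * fg_edge GG T e = fg_edge GG T e * x') \/
  (forall x, KP (val e) x -> exists2 x', PG (tgt (val e)) x' &
     x * fg_edge GG T e * x' = fg_edge GG T e).
Proof.
have AE a : A a -> Ap a \/ Am a by rewrite A_decomp.
have [Ae|Ae] := AE _ (set_valP e).
  left=> x [[h ->] /PG_fgv Ph]; exists (fgv _ (emb_tgt h)); last exact: fg_edge_rel.
  by exists (emb_tgt h) => //; apply: P_plus => //; exists h.
right=> x [[h ->] /PG_fgv Ph]; exists (fgv _ (emb_tgt h)^-1).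
  by exists (emb_tgt h)^-1 => //; apply: P_minus => //; exists h.
by rewrite fg_edge_rel -mulgA -fg_vertM mulgV fg_vert1 mulg1.
Qed.

(** Condition (LCM) read in the order x <= y iff x^-1 y lies in the cone: if an
    element of the cone has an upper bound in the edge group then it has a
    least one there. *)
Lemma lcm_min e p : sedges T e \/ A e -> PG (org e) p ->
  (exists2 k, KP e k & PG (org e) (p^-1 * k)) ->
  exists k0, [/\ KP e k0, PG (org e) (p^-1 * k0) &
    forall k, KP e k -> PG (org e) (p^-1 * k) -> KP e (k0^-1 * k)].
Proof.
move=> eTA [a Pa ->] [k Kk [b Pb kb]]; have := lcm eTA Pa => /=.
set PE := _ @` _; set S := [set x | _].
have PE_KP c : PE c <-> KP e (fgv _ c).
  split=> [[h Ph <-]|[[h /fgv_inj ->] /PG_fgv Ph]]; last by exists h.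
  by split; [exists h|exists (emb_org GG e h)].
have Sb : S b by split=> //; apply/PE_KP; rewrite fg_vertM -kb mulVKg.
move=> [S0|[q Pq SE]]; first by move: Sb; rewrite S0.
have Sq : S q by rewrite SE; exists 1; rewrite ?mulg1//; apply/PE_KP; rewrite fg_vert1; exact: KP1.
exists (fgv _ (a * q)); split; first by apply/PE_KP; case: Sq.
  by rewrite fg_vertM mulKg; exists q.
move=> k' Kk' [c Pc k'c].
have k'E : k' = fgv _ (a * c) by rewrite fg_vertM -k'c mulVKg.
have : S c by split=> //; apply/PE_KP; rewrite -k'E.
rewrite SE => -[y PEy cE].
by rewrite k'E -cE mulgA [in X in _ * X]fg_vertM mulKg; apply/PE_KP.
Qed.

(** An edge of the Bass-Serre tree over e0 separates it, and F tells the two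
    sides apart: it is the parity of the number of times that this edge is
    crossed on the way from the base to the translate by the inverse of x.
    Vertex groups do not move the part of the tree over T, so that only the
    generators from A change F. *)
Lemma cut_edge (e0 : A) : exists F : G -> bool, [/\ F 1 = false,
  forall v s x, VG v s -> F (s * x) = F x &
  forall (e : A) x, F (fg_edge GG T e * x) =
    F x (+) `[< e = e0 /\ KG (val e0) (fg_edge GG T e * x) >]].
Proof.
pose c (t : ggen GG A) (x : G) : bool := match t with
  | inl _ => false
  | inr e => `[< e = e0 /\ KG (val e0) (fg_edge GG T e * x) >] end.
have [|F [F1 FM]] := @skew_primitive _ _ c.
  move=> u w; case=> {u w}.
  - move=> v a b [x d]; rewrite /word_act /= /skew_act /= !addbF mulgA.
    by congr (_, _); rewrite -[LHS]/(fgv v a * fgv v b * x) -fg_vertM.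
  - move=> e a [x d]; rewrite /word_act /= /skew_act /= !addbF !mulgA.
    have ee := fg_edge_rel T a; congr (_, _).
      by rewrite -[LHS]/(fgv _ (emb_org GG _ a) * fg_edge GG T e * x) ee.
    congr (_ (+) _); apply: asbool_equiv_eq.
    have Ka : KG (val e) (fgv _ (emb_org GG _ a)) by exists a.
    have eE : fg_edge GG T e * (fgv _ (emb_tgt a) * x) =
        fgv _ (emb_org GG _ a) * (fg_edge GG T e * x) by rewrite !mulgA ee.
    rewrite -mulgA -/(fgv _ (emb_tgt a)) eE.
    by split=> -[ee0]; rewrite -ee0 => Kx; split=> //; apply/(KGMl _ Ka).
  - move=> e a Te [x d]; rewrite /word_act /= /skew_act /= !addbF.
    by congr (_, _); congr (_ * _); exact: fg_tree_rel.
exists F; split; [exact: F1|move=> v s x [a ->]; by have := FM (inl (existT _ v a)) x; rewrite addbF|].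
by move=> e x; exact: (FM (inr e)).
Qed.

(** On which side of the edge e of the Bass-Serre tree lies the vertex of type
    w of the translate z T of the maximal tree? The base edge itself joins a
    vertex with n = false to one with n = true; a translate that does not
    contain it lies entirely on one side. *)
Definition beyond e (n : vert Gam -> bool) (side : G -> bool) z w : bool :=
  if `[< KG e z >] then n w else side z.

(** For an edge over T the translates of T can contain the edge itself. With n
    the parity of crossings of e on a path in T, a vertex group element s at v
    moves the base along the path to v and back along its translate by s, and
    so crosses the edge n v times for each of the two that contains it. *)
Lemma cut_tree e : sedges T e -> exists n side, [/\ n (org e) = false,
  forall f, sedges T f -> n (tgt f) = n (org f) (+) ((f == e) || (f == einv e)) &
  forall z w s, VG w s -> beyond e n side (z * s) w = beyond e n side z w].
Proof.
move=> Te; pose c f : parity := (f == e) || (f == einv e).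
have cV f : c (einv f) = (c f)^-1.
  rewrite -[RHS]/(c f) /c orbC (inj_eq (can_inj (@einvK Gam))); congr (_ || _).
  by rewrite -(inj_eq (can_inj (@einvK Gam))) einvK.
have [tau tauP] := tree_potential Gam_connected T_maximal cV.
pose n v : bool := (tau v : bool) (+) tau (org e).
have no : n (org e) = false by rewrite /n addbb.
have nt f : sedges T f -> n (tgt f) = n (org f) (+) ((f == e) || (f == einv e)).
  by move=> Tf; rewrite /n tauP// -[tau _ * c f]/((tau (org f) : bool) (+) c f) addbAC.
pose kap x := `[< KG e x >].
pose d (t : ggen GG A) (x : G) : bool := match t with
  | inl p => n (tag p) && (kap x (+) kap (fgv _ (tagged p) * x))
  | inr a => (n (tgt (val a)) && kap x) (+) (n (org (val a)) && kap (fg_edge GG T a * x)) end.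
have [|F [F1 FM]] := @skew_primitive _ _ d.
  move=> u w; case=> {u w}.
  - move=> v a b [x t]; rewrite /word_act /= /skew_act /= !mulgA.
    have ab : fgv v a * fgv v b = fgv v (a * b) by rewrite -fg_vertM.
    congr (_, _); first by rewrite -[LHS]/(fgv v a * fgv v b * x) ab.
    rewrite -/(fgv v b) ab.
    by case: (n v) (kap x) (kap (_ * x)) (kap (_ * x)) t => [] [] [] [] [].
  - move=> a h [x t]; rewrite /word_act /= /skew_act /= !mulgA.
    have ee := fg_edge_rel T h; congr (_, _).
      by rewrite -[LHS]/(fgv _ (emb_org GG _ h) * fg_edge GG T a * x) ee.
    rewrite -/(fgv _ (emb_tgt h)) -/(fgv _ (emb_org GG _ h)) -/(fg_edge GG T a) -ee.
    move: (n (org _)) (n (tgt _)) (kap x) (kap (fg_edge GG T a * x)).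
    move: (kap (fgv _ (emb_tgt h) * x)).
    move: (kap (fgv _ (emb_org GG _ h) * fg_edge GG T a * x)) t.
    by move=> [] [] [] [] [] [] [].
  - move=> f h Tf [x t]; rewrite /word_act /= /skew_act /=.
    have hh := fg_tree_rel A h Tf.
    congr (_, _); first by congr (_ * _); exact: hh.
    congr (_ (+) _); rewrite -hh nt//; case: (boolP (_ || _)) => fe; last by rewrite addbF.
    have Kh : KG e (fgv _ (emb_org GG f h)).
      by case/orP: fe => /eqP fE; [|rewrite -KG_einv//]; rewrite -fE; exists h.
    have -> : kap (fgv _ (emb_org GG f h) * x) = kap x.
      by apply: asbool_equiv_eq; exact: KGMl.
    by rewrite addbb !andbF.
have FV v s x : VG v s -> F (s * x) = F x (+) (n v && (kap x (+) kap (s * x))).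
  by move=> [a ->]; exact: (FM (inl (existT _ v a))).
have kapV x : kap x^-1 = kap x.
  by apply: asbool_equiv_eq; split=> /KGV //; rewrite invgK.
have FK x : KG e x -> F x^-1 = false.
  move=> Kx; have := FV (org e) x^-1 1; rewrite mulg1 no andFb addbF F1; apply.
  exact: VGV (KG_VG Kx).
exists n, (fun z => F z^-1); split=> // z w s Vs.
have kP x : reflect (KG e x) (kap x) := asboolP _.
have := FV w s^-1 z^-1 (VGV Vs); rewrite -invgM !kapV.
rewrite /beyond -/(kap z) -/(kap (z * s)).
case: (kP z) => Kz; case: (kP (z * s)) => Kzs /=; rewrite ?andbT ?andbF ?addbF //.
  by rewrite FK.
by rewrite (FK _ Kzs); move: (F z^-1) (n w) => [] [].
Qed.

(** The exponent sum of the letters in A. *)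

Lemma level_exists : exists L : G -> int, [/\ L 1 = 0%R,
  forall v s x, VG v s -> L (s * x) = L x &
  forall (a : A) x, L (fg_edge GG T a * x) = (L x + 1)%R].
Proof.
pose act (t : ggen GG A) (i : int) : int := if t is inr _ then (i + 1)%R else i.
pose inv (t : ggen GG A) (i : int) : int := if t is inr _ then (i - 1)%R else i.
have aK t i : inv t (act t i) = i by case: t => //= a; rewrite GRing.addrK.
have iK t i : act t (inv t i) = i by case: t => //= a; rewrite GRing.subrK.
have rP (u u' : gword (ggen GG A)) : Defs.grel T u u' -> word_act act inv u =1 word_act act inv u'.
  by case.
exists (fun g => pres_act act inv g 0%R); split; first by rewrite pres_act1.
- by move=> v s x [a ->]; rewrite pres_actM// pres_act_gen.
- by move=> a x; rewrite pres_actM// pres_act_gen.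
Qed.

(** * The monoid P_T *)

Definition PT : set G := gen_submonoid (@gensPT _ GG A T P).

Lemma PT1 : PT 1. Proof. exact: gen_submonoid1. Qed.
Lemma PTM x y : PT x -> PT y -> PT (x * y). Proof. exact: gen_submonoidM. Qed.
Lemma PG_PT v x : PG v x -> PT x.
Proof. by move=> Px; apply: gen_submonoid_sub; exists v. Qed.
Lemma KP_PT e x : KP e x -> PT x. Proof. by move=> [_ /PG_PT]. Qed.

Lemma PT_ind (C : set G) : C 1 -> (forall v s y, PG v s -> C y -> C (s * y)) ->
  PT `<=` C.
Proof. by move=> C1 CM; apply: gen_submonoid_ind => // s y [v Ps]; exact: CM Ps. Qed.

(** The order x <= y iff x^-1 y lies in P_T is generated by the orders of the
    translates of the vertex groups; a chain from one side of an edge of the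
    Bass-Serre tree to the other has to meet the edge. *)
Lemma interpolate e n side p : (forall z w s, VG w s ->
    beyond e n side (z * s) w = beyond e n side z w) -> PT p ->
  forall y, ~ KG e y -> ~ KG e (y * p) -> side y <> side (y * p) ->
  exists k, [/\ KG e k, PT (y^-1 * k) & PT (k^-1 * (y * p))].
Proof.
move=> cut Pp; suff [] : PT p /\ forall y, ~ KG e y -> ~ KG e (y * p) ->
  side y <> side (y * p) -> exists k, [/\ KG e k, PT (y^-1 * k) & PT (k^-1 * (y * p))] by [].
move: p Pp; apply: PT_ind; first by split=> [|y _ _]; [exact: PT1|rewrite mulg1].
move=> v s p Ps [PTp IH]; have Ts := PG_PT Ps; split; first exact: PTM.
move=> y Ky; rewrite mulgA => Kysp yp.
have [Kys|Kys] := pselect (KG e (y * s)).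
  by exists (y * s); split=> //; rewrite mulKg.
have sys : side (y * s) = side y.
  have := cut y v s (PG_VG Ps); rewrite /beyond.
  by case: asboolP => // _; case: asboolP.
have [|k [Kk k1 k2]] := IH (y * s) Kys Kysp; first by rewrite sys.
exists k; split=> //; have -> : y^-1 * k = s * ((y * s)^-1 * k); last exact: PTM.
by rewrite invgM -mulgA mulVKg.
Qed.

(** The edge paths of T decorated with elements of the cones of the vertices they
    visit represent the elements of P_T, with any prescribed initial vertex.
    Paths may backtrack; their length measures progress in the inductions. *)
Inductive pword : nat -> vert Gam -> G -> Prop :=
| pword0 v x : PG v x -> pword 0 v x
| pwordS n e x y : sedges T e -> PG (org e) x -> pword n (tgt e) y ->
    pword n.+1 (org e) (x * y).

Lemma pword_PT n v x : pword n v x -> PT x.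
Proof. by elim=> [{}v {}x /PG_PT//|{}n e {}x y _ /PG_PT Px _]; exact: PTM. Qed.

Lemma pword_PGl n v a x : PG v a -> pword n v x -> pword n v (a * x).
Proof.
move=> + px; elim: px a => [{}v {}x Px|{}n e {}x y Te Px py _] a Pa.
  by apply: pword0; exact: PGM.
by rewrite mulgA; apply: pwordS => //; exact: PGM.
Qed.

Lemma pword_move n v w x (p : seq (edge Gam)) : epath (sedges T) w p v -> pword n v x ->
  exists m, pword m w x.
Proof.
elim: p w => [|e p IH] w /=; first by move=> ->; exists n.
move=> [Te <- h] px; have [m pm] := IH _ h px; exists m.+1.
by rewrite -[x]mul1g; apply: pwordS => //; exact: PG1.
Qed.

Lemma PT_pword v x : PT x -> exists n, pword n v x.
Proof.
move=> PTx; move: x PTx v; apply: PT_ind => [v|w s y Ps IH v].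
  by exists 0%N; apply: pword0; exact: PG1.
have [n py] := IH w; have [p hp] := tree_path Gam_connected T_maximal v w.
exact: pword_move hp (pword_PGl Ps py).
Qed.

(** Only a step over the edge itself leads from one side to the other, so a path
    changing sides splits at such a step into two shorter paths. *)
Lemma pword_cross e n side m w a x : n (org e) = false ->
  (forall f, sedges T f -> n (tgt f) = n (org f) (+) ((f == e) || (f == einv e))) ->
  (forall z w s, VG w s -> beyond e n side (z * s) w = beyond e n side z w) ->
  pword m w x -> beyond e n side a w = true -> ~ KG e (a * x) -> side (a * x) = false ->
  exists m1 m2 x1 x2, [/\ x = x1 * x2, (m1 < m)%N /\ pword m1 w x1, KG e (a * x1) &
    (m2 < m)%N /\ pword m2 (org e) x2].
Proof.
move=> no nt cut px; elim: px a => {m w x} [v x Px|m f x y Tf Px py IH] a aw Kax sax.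
  have := cut a v x (PG_VG Px); rewrite aw /beyond.
  by case: asboolP => // _; rewrite sax.
have axw : beyond e n side (a * x) (org f) = true by rewrite cut//; exact: PG_VG.
have step : beyond e n side (a * x) (tgt f) = true ->
    exists m1 m2 x1 x2, [/\ x * y = x1 * x2, (m1 < m.+1)%N /\ pword m1 (org f) x1,
      KG e (a * x1) & (m2 < m.+1)%N /\ pword m2 (org e) x2].
  move=> axt; rewrite mulgA in Kax sax.
  have [m1 [m2 [x1 [x2 [yE [lt1 p1] K1 [lt2 p2]]]]]] := IH _ axt Kax sax.
  exists m1.+1, m2, (x * x1), x2; rewrite yE !mulgA; split=> //.
    by split=> //; exact: pwordS.
  by split=> //; exact: ltnW.
have [Kx|Kx] := pselect (KG e (a * x)); last first.
  by apply: step; move: axw; rewrite /beyond; case: asboolP.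
move: axw; rewrite /beyond; case: asboolP => // _ nf.
have [fe|fe] := boolP ((f == e) || (f == einv e)); last first.
  by apply: step; rewrite /beyond; case: asboolP => // _; rewrite nt// nf (negbTE fe).
case/orP: fe nf => /eqP fE; first by rewrite fE no.
move=> _; exists 0%N, m, x, y; split=> //; first by split=> //; exact: pword0.
by split=> //; rewrite -(tgt_einv e) -fE.
Qed.

Lemma side_VG e n side y : (forall z w s, VG w s ->
    beyond e n side (z * s) w = beyond e n side z w) ->
  VG (org e) y -> ~ KG e y -> n (org e) = false -> side y = false.
Proof.
move=> cut Vy Ky no; have := cut 1 (org e) y Vy; rewrite mul1g /beyond.
case: asboolP => // _ ->; case: asboolP => // -[]; exact: KG1.
Qed.

Lemma beyond1_tgt e n side : sedges T e -> n (org e) = false ->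
  (forall f, sedges T f -> n (tgt f) = n (org f) (+) ((f == e) || (f == einv e))) ->
  beyond e n side 1 (tgt e) = true.
Proof.
move=> Te no nt; rewrite /beyond; case: asboolP => [_|[]]; last exact: KG1.
by rewrite nt// no eqxx.
Qed.

(** P_T meets each vertex group in its cone only: a path leading back to its
    origin crosses its first edge twice, and the loop in between can be
    replaced by an edge group element, positive by induction. *)
Lemma pword_VG n v x : pword n v x -> VG v x -> PG v x.
Proof.
have [N] := ubnP n; elim: N n v x => // N IH n v x; rewrite ltnS => nN px.
case: px nN => {n v x} [//|n e x y Te Px py nN Vxy].
have Vy : VG (org e) y by rewrite -(mulKg x y); apply: VGM => //; exact: VGV (PG_VG Px).
have [Ky|Ky] := pselect (KG e y).
  have Py : PG (tgt e) y by apply: (IH n) => //; apply: (@KG_VG (einv e)); rewrite KG_einv.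
  have [_ Py'] : KP e y by rewrite -KP_einv//; split; rewrite ?KG_einv.
  exact: PGM.
have [nn [side [no nt cut]]] := cut_tree Te.
have sy := side_VG cut Vy Ky no.
have [||m1 [m2 [y1 [y2 [yE [lt1 p1] K1 [lt2 p2]]]]]] :=
    pword_cross no nt cut py (beyond1_tgt side Te no nt).
- by rewrite mul1g.
- by rewrite mul1g.
rewrite mul1g in K1.
have Py1 : PG (tgt e) y1.
  apply: (IH m1) => //; first exact: leq_trans lt1 (ltnW nN).
  by apply: (@KG_VG (einv e)); rewrite KG_einv.
have [_ Py1'] : KP e y1 by rewrite -KP_einv//; split; rewrite ?KG_einv.
have Py2 : PG (org e) y2.
  apply: (IH m2) => //; first exact: leq_trans lt2 (ltnW nN).
  by rewrite -(mulKg y1 y2) -yE; apply: VGM => //; exact: VGV (PG_VG Py1').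
by rewrite yE; do !apply: PGM.
Qed.

Lemma PT_VG v x : PT x -> VG v x -> PG v x.
Proof. by move=> /(PT_pword v) [n]; exact: pword_VG. Qed.

Lemma PT_KG e x : PT x -> KG e x -> KP e x.
Proof. by move=> Px Kx; split=> //; apply: PT_VG => //; exact: KG_VG. Qed.

Lemma PT_trans x y z : PT (x^-1 * y) -> PT (y^-1 * z) -> PT (x^-1 * z).
Proof. by move=> xy yz; have := PTM xy yz; rewrite -mulgA mulVKg. Qed.

Lemma VG_div v x y : VG v x -> VG v y -> VG v (x^-1 * y).
Proof. by move=> Vx Vy; apply: VGM => //; exact: VGV. Qed.

(** By induction along a path from v to y. If y lies beyond the first edge e of
    the path, elements above y in the group of v lie above elements of the edge
    group, and the smallest of these is found from the smallest element at the
    other end of e by condition (LCM). *)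
Lemma vertex_min n v y : pword n v y -> (exists2 z, VG v z & PT (y^-1 * z)) ->
  exists m, [/\ PG v m, PT (y^-1 * m) &
    forall z, VG v z -> PT (y^-1 * z) -> PG v (m^-1 * z)].
Proof.
have [N] := ubnP n; elim: N n v y => // N IH n v y; rewrite ltnS => nN py.
have base u x : PG u x -> exists m, [/\ PG u m, PT (x^-1 * m) &
    forall z, VG u z -> PT (x^-1 * z) -> PG u (m^-1 * z)].
  move=> Px; exists x; split=> //; first by rewrite mulVg; exact: PT1.
  by move=> z Vz PTz; apply: PT_VG => //; apply: VG_div => //; exact: PG_VG.
case: py nN => {n v y} [v y Py _ _|n e p y Te Pp py nN [z Vz yz]]; first exact: base.
have [Ky|Ky] := pselect (KG e y).
  by apply: base; apply: PGM => //; case: (PT_KG (pword_PT py) Ky).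
have [nn [side [no nt cut]]] := cut_tree Te.
have [sy|sy] := boolP (side y); last first.
  have [||m1 [m2 [y1 [y2 [yE [lt1 p1] K1 [lt2 p2]]]]]] :=
      pword_cross no nt cut py (beyond1_tgt side Te no nt).
  - by rewrite mul1g.
  - by rewrite mul1g; exact: negbTE.
  rewrite mul1g in K1; have [_ Py1] := PT_KG (pword_PT p1) K1.
  apply: (IH m2); first exact: leq_trans lt2 (ltnW nN).
    by rewrite yE; do 2!apply: pword_PGl => //.
  by exists z.
(* y lies beyond e and z' does not, so a chain from y to z' meets the edge *)
have edge_below z' : VG (org e) z' -> PT (y^-1 * z') ->
    exists k, [/\ KG e k, PT (y^-1 * k) & PT (k^-1 * z')].
  move=> Vz' yz'; have [Kz|Kz] := pselect (KG e z').
    by exists z'; split=> //; rewrite mulVg; exact: PT1.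
  have [||k] := interpolate cut yz' Ky; rewrite ?mulVKg//; last by exists k.
  by rewrite (side_VG cut Vz' Kz no) sy.
have Vp z' : VG (org e) z' -> VG (org e) (p^-1 * z').
  by move=> Vz'; apply: VG_div => //; exact: PG_VG.
have py' z' : (p * y)^-1 * z' = y^-1 * (p^-1 * z') by rewrite invgM mulgA.
have Kt k : KG e k -> VG (tgt e) k.
  by move=> Kk; apply: (@KG_VG (einv e)); rewrite KG_einv.
rewrite py' in yz; have [k [Kk yk kz]] := edge_below _ (Vp _ Vz) yz.
have PTy := pword_PT py.
have KPk k' : KG e k' -> PT (y^-1 * k') -> KP e k'.
  by move=> Kk' yk'; apply: PT_KG => //; rewrite -(mulVKg y k'); exact: PTM.
have [||mw [Pmw ymw mwmin]] := IH n _ y _ py; first exact: leq_trans nN.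
  by exists k => //; exact: Kt.
have TeV := sedges_einv Te.
have [|k0 [Kk0 mk0 k0min]] := @lcm_min (einv e) mw (or_introl TeV) Pmw.
  exists k; first by rewrite KP_einv//; exact: KPk.
  by apply: mwmin => //; exact: Kt.
rewrite KP_einv// in Kk0; have yk0 : PT (y^-1 * k0) by apply: PT_trans ymw (PG_PT mk0).
exists (p * k0); split; first by apply: PGM => //; case: Kk0.
  by rewrite py' mulKg.
move=> z' Vz'; rewrite py' => yz'; have [k' [Kk' yk' kz']] := edge_below _ (Vp _ Vz') yz'.
rewrite invgM -mulgA; apply: PT_VG; last first.
  by apply: VG_div; [case: Kk0 => /KG_VG|exact: Vp].
apply: (PT_trans (y := k')) kz'; apply: KP_PT (k0min k' _ _).
  by rewrite KP_einv//; exact: KPk.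
by apply: mwmin => //; exact: Kt.
Qed.

(** * Least upper bounds *)

Definition is_lub (S : set G) x y m := [/\ S (x^-1 * m), S (y^-1 * m) &
  forall u, S (x^-1 * u) -> S (y^-1 * u) -> S (m^-1 * u)].
Definition joinable (S : set G) x y := (exists u, S (x^-1 * u) /\ S (y^-1 * u)) ->
  exists m, is_lub S x y m.

Lemma joinable_sym S x y : joinable S x y -> joinable S y x.
Proof.
move=> H [u [yu xu]]; have [|m [m1 m2 m3]] := H; first by exists u.
by exists m; split=> // w wy wx; exact: m3.
Qed.

Lemma joinable_mull S g x y : joinable S x y -> joinable S (g * x) (g * y).
Proof.
move=> H [u]; rewrite !invgM -!mulgA => -[xu yu].
have [|m [m1 m2 m3]] := H; first by exists (g^-1 * u).
exists (g * m); split; rewrite ?invgM -?mulgA ?mulKg//.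
by move=> w; rewrite ?invgM -!mulgA; exact: m3.
Qed.

Lemma joinable_le (S : set G) x y : S 1 -> (forall a b, S a -> S b -> S (a * b)) ->
  S (x^-1 * y) -> joinable S x y.
Proof. by move=> S1 SM xy _; exists y; split=> //; rewrite mulVg. Qed.

(** Joining x * x' with y amounts to joining x with y and then x' with the
    quotient of the join by x; it therefore suffices to treat generators. *)
Lemma joinableM (S : set G) x x' : (forall a b, S a -> S b -> S (a * b)) -> S x' ->
  (forall y, S y -> joinable S x y) -> (forall y, S y -> joinable S x' y) ->
  forall y, S y -> joinable S (x * x') y.
Proof.
move=> SM Sx' Hx Hx' y Sy [u [xxu yu]].
have xu (w : G) : S ((x * x')^-1 * w) -> S (x^-1 * w).
  by move=> h; have := SM _ _ Sx' h; rewrite invgM -mulgA mulVKg.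
have [|m1 [xm1 ym1 m1P]] := Hx y Sy; first by exists u; split=> //; exact: xu.
have E (w : G) : (x^-1 * m1)^-1 * (x^-1 * w) = m1^-1 * w by rewrite invgM invgK -mulgA mulVKg.
have [|m2 [xm2 ym2 m2P]] := Hx' _ xm1.
  exists (x^-1 * u); rewrite E; split; first by rewrite mulgA -invgM.
  by apply: m1P => //; exact: xu.
rewrite -(mulKg x m2) E in ym2.
exists (x * m2); split; first by rewrite invgM -mulgA mulKg.
  by have := SM _ _ ym1 ym2; rewrite -mulgA mulVKg.
move=> w xw yw; rewrite invgM -mulgA; apply: m2P; first by rewrite mulgA -invgM.
by rewrite E; apply: m1P => //; exact: xu.
Qed.

(** An element of a cone and one of P_T, incomparable but bounded above: the
    upper bounds then all lie above the smallest element of the first edge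
    group above s, which therefore can replace s. *)
Lemma vertex_joinable n v s y : pword n v y -> PG v s -> joinable PT s y.
Proof.
have [N] := ubnP n; elim: N n v s y => // N IH n v s y; rewrite ltnS => nN py.
have comparable u a b : PG u a -> PG u b -> joinable PT a b.
  move=> Pa Pb; have [ab|ba] : PG u (a^-1 * b) \/ PG u (b^-1 * a).
    have [|h|h] := @PG_total u (a^-1 * b); first by apply: VG_div; exact: PG_VG.
      by left.
    by right; move: h; rewrite invgM invgK.
  - by apply: joinable_le (PG_PT ab); [exact: PT1|exact: PTM].
  - by apply/joinable_sym/(joinable_le _ _ (PG_PT ba)); [exact: PT1|exact: PTM].
case: py s nN => {n v y} [v y Py s _ Ps|n e p y Te Pp py s nN Ps]; first exact: (comparable v).
have [sp|ps] : PG (org e) (s^-1 * p) \/ PG (org e) (p^-1 * s).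
    have [|h|h] := @PG_total (org e) (s^-1 * p); first by apply: VG_div; exact: PG_VG.
      by left.
    by right; move: h; rewrite invgM invgK.
  apply: joinable_le; [exact: PT1|exact: PTM|].
  by rewrite mulgA; apply: PTM; [exact: PG_PT sp|exact: pword_PT py].
rewrite -(mulVKg p s); apply: joinable_mull; move: (p^-1 * s) ps => {Ps}s Ps.
have Kt k : KP e k -> PG (tgt e) k by exact: KP_tgt.
have [Ks|Ks] := pselect (KG e s).
  by apply: (IH n _ _ _ _ py); [exact: nN|exact: Kt].
have [Ky|Ky] := pselect (KG e y).
  by apply: (comparable (org e)) => //; case: (PT_KG (pword_PT py) Ky).
have [nn [side [no nt cut]]] := cut_tree Te.
have [sy|sy] := boolP (side y); last first.
  have [||m1 [m2 [y1 [y2 [yE [lt1 p1] K1 [lt2 p2]]]]]] :=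
      pword_cross no nt cut py (beyond1_tgt side Te no nt).
  - by rewrite mul1g.
  - by rewrite mul1g; exact: negbTE.
  rewrite mul1g in K1; have [_ Py1] := PT_KG (pword_PT p1) K1.
  apply: (IH m2 (org e)) => //; first exact: leq_trans lt2 (ltnW nN).
  by rewrite yE; apply: pword_PGl.
have Vs := PG_VG Ps; have ss := side_VG cut Vs Ks no.
have [ys|ys] := pselect (PT (y^-1 * s)).
  by apply/joinable_sym/joinable_le; [exact: PT1|exact: PTM|].
have above u : PT (s^-1 * u) -> PT (y^-1 * u) ->
    exists k, [/\ KP e k, PG (org e) (s^-1 * k) & PT (k^-1 * u)].
  move=> su yu; suff [k [Kk sk ku]] : exists k, [/\ KG e k, PT (s^-1 * k) & PT (k^-1 * u)].
    have sk' : PG (org e) (s^-1 * k).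
      by apply: PT_VG => //; apply: VG_div => //; exact: KG_VG.
    exists k; split=> //; split=> //; rewrite -(mulVKg s k); exact: PGM.
  have [Ku|Ku] := pselect (KG e u); first by exists u; rewrite mulVg; split=> //; exact: PT1.
  have [su1|su1] := boolP (side u).
    have [||k] := interpolate cut su Ks; rewrite ?mulVKg//; last by exists k.
    by rewrite ss su1.
  have [||k [Kk yk ku]] := interpolate cut yu Ky; rewrite ?mulVKg//.
    by rewrite sy (negbTE su1).
  rewrite mulVKg in ku; exists k; split=> //.
  have [|h|h] := @PG_total (org e) (s^-1 * k); first by apply: VG_div => //; exact: KG_VG.
    exact: PG_PT h.
  by case: ys; apply: PT_trans yk _; rewrite invgM invgK in h; exact: PG_PT h.
move=> [u0 [su0 yu0]]; have [k [Kk sk ku0]] := above _ su0 yu0.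
have [|k0 [Kk0 sk0 k0min]] := @lcm_min e s (or_introl Te) Ps; first by exists k.
have k0u u : PT (s^-1 * u) -> PT (y^-1 * u) -> PT (k0^-1 * u).
  move=> su yu; have [k' [Kk' sk' ku']] := above _ su yu.
  by apply: PT_trans ku'; exact: KP_PT (k0min _ Kk' sk').
have [|m [k0m ym mmin]] := IH n _ k0 y nN py (Kt _ Kk0).
  by exists u0; split=> //; exact: k0u.
exists m; split=> //; first exact: PT_trans (PG_PT sk0) k0m.
by move=> u su yu; apply: mmin => //; exact: k0u.
Qed.

Lemma PT_joinable x y : PT x -> PT y -> joinable PT x y.
Proof.
move=> PTx; suff [_] : PT x /\ forall y, PT y -> joinable PT x y by apply.
move: x PTx {y}; apply: PT_ind.
  split; first exact: PT1.
  by move=> y Py; apply: joinable_le; [exact: PT1|exact: PTM|rewrite invg1 mul1g].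
move=> v s x Ps [Px Hx]; split; first by apply: PTM => //; exact: PG_PT Ps.
apply: joinableM => //; first exact: PTM.
by move=> y /(PT_pword v) [n py]; exact: vertex_joinable py Ps.
Qed.

(** * The monoid P *)

Local Notation ed a := (fg_edge GG T a).
Implicit Types (a b : A).

Definition PP : set G := gen_submonoid (@gensP _ GG A T P).

Lemma PP1 : PP 1. Proof. exact: gen_submonoid1. Qed.
Lemma PPM x y : PP x -> PP y -> PP (x * y). Proof. exact: gen_submonoidM. Qed.
Lemma PT_PP x : PT x -> PP x.
Proof.
move: x; apply: PT_ind => [|v s y [g Pg ->]]; first exact: PP1.
by apply: PPM; apply: gen_submonoid_sub; left; exists v, g.
Qed.
Lemma PP_edge a : PP (ed a).
Proof. by apply: gen_submonoid_sub; right; exists a. Qed.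

Inductive positive_word : G -> Prop :=
| positive_word0 x : PT x -> positive_word x
| positive_wordS x a y : PT x -> positive_word y -> positive_word (x * ed a * y).

Lemma positive_wordP x : PP x <-> positive_word x.
Proof.
split; last first.
  elim=> [{}x|{}x a y Px _ Py]; first exact: PT_PP.
  by apply: PPM => //; apply: PPM; [exact: PT_PP|exact: PP_edge].
move: x; apply: gen_submonoid_ind => [|s y [[v Ps]|[a _ <-]] py].
- by apply: positive_word0; exact: PT1.
- have Ts : PT s by apply: PG_PT; exact: Ps.
  case: py => [x Px|x a z Px pz]; first by apply: positive_word0; exact: PTM.
  by rewrite !mulgA; apply: positive_wordS => //; exact: PTM.
- by rewrite -[ed a]mul1g; apply: positive_wordS => //; exact: PT1.
Qed.

Section Level.
Variable L : G -> int.
Hypothesis L1 : L 1 = 0%R.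
Hypothesis LV : forall v s x, VG v s -> L (s * x) = L x.
Hypothesis LA : forall a x, L (ed a * x) = (L x + 1)%R.

Lemma level_PTl x y : PT x -> L (x * y) = L y.
Proof.
move=> Px; move: x Px y; apply: PT_ind => [y|v s x Ps IH y]; first by rewrite mul1g.
by rewrite -mulgA (LV _ (PG_VG Ps)).
Qed.

Lemma level_PT x : PT x -> L x = 0%R.
Proof. by move=> Px; rewrite -[x]mulg1 level_PTl. Qed.

Lemma level_ge0 x : positive_word x -> (0 <= L x)%R.
Proof.
elim=> [{}x /level_PT ->//|{}x a y Px _ Ly].
by rewrite -mulgA level_PTl// LA; lia.
Qed.

Lemma level_edge x a y : positive_word y -> PT x -> (0 < L (x * ed a * y))%R.
Proof. by move=> /level_ge0 Ly Px; rewrite -mulgA level_PTl// LA; lia. Qed.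

Lemma level_VG v x : VG v x -> L x = 0%R.
Proof. by move=> Vx; rewrite -[x]mulg1 (LV _ Vx). Qed.

End Level.

Lemma PT_edge_absurd x a y : positive_word y -> PT x -> ~ PT (x * ed a * y).
Proof.
have [L [L1 LV LA]] := level_exists; move=> py Px /(level_PT L1 LV) L0.
by have := level_edge L1 LV LA a py Px; rewrite L0.
Qed.

(** The first letter from A of an element of P is well defined, and so is the
    coset of the edge group in which it is read. *)
Lemma edge_split x x' a a' y y' : PT x -> PT x' -> positive_word y -> positive_word y' ->
  x * ed a * y = x' * ed a' * y' -> a = a' /\ KG (val a) (x^-1 * x').
Proof.
move=> Px Px' py py' E.
have [F [F1 FV FA]] := cut_edge a; have [L [L1 LV LA]] := level_exists.
have FP p z : PT p -> F (p * z) = F z.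
  move=> Pp; move: p Pp z; apply: PT_ind => [z|v s p Ps IH z]; first by rewrite mul1g.
  by rewrite -mulgA (FV _ _ _ (PG_VG Ps)).
have FPV p z : PT p -> F (p^-1 * z) = F z by move=> Pp; rewrite -(FP p) ?mulVKg.
have low u z : positive_word u -> (L z < 0)%R -> F (u^-1 * z) = F z.
  move=> pu; elim: pu z => {u} [u Pu z _|u b w Pu _ IH z Lz]; first exact: FPV.
  have Luz : L (u^-1 * z) = L z by rewrite -(level_PTl LV (u^-1 * z) Pu) mulVKg.
  have -> : (u * ed b * w)^-1 * z = w^-1 * ((ed b)^-1 * (u^-1 * z)).
    by rewrite !invgM !mulgA.
  have Lb : L ((ed b)^-1 * (u^-1 * z)) = (L z - 1)%R.
    by have := LA b ((ed b)^-1 * (u^-1 * z)); rewrite mulVKg Luz; lia.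
  rewrite IH; last by rewrite Lb; lia.
  have := FA b ((ed b)^-1 * (u^-1 * z)); rewrite mulVKg FPV// => ->.
  case: asboolP => [[_ /KG_VG/(level_VG L1 LV)]|_]; last by rewrite addbF.
  by rewrite Luz => L0; move: Lz; rewrite L0.
have first_letter p b u : positive_word u -> F p^-1 = false -> L p^-1 = 0%R ->
    F ((p * ed b * u)^-1) = `[< b = a /\ KG (val a) p^-1 >].
  move=> pu Fp Lp; have -> : (p * ed b * u)^-1 = u^-1 * ((ed b)^-1 * p^-1).
    by rewrite !invgM.
  have Lb : L ((ed b)^-1 * p^-1) = (-1)%R.
    by have := LA b ((ed b)^-1 * p^-1); rewrite mulVKg Lp; lia.
  rewrite low ?Lb//; have := FA b ((ed b)^-1 * p^-1); rewrite mulVKg Fp.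
  by case: (F ((ed b)^-1 * p^-1)); case: `[< _ >].
have LPV p z : PT p -> L (p^-1 * z) = L z.
  by move=> Pp; rewrite -(level_PTl LV (p^-1 * z) Pp) mulVKg.
have E' : ed a * y = (x^-1 * x') * ed a' * y'.
  have -> : x^-1 * x' * ed a' * y' = x^-1 * (x' * ed a' * y') by rewrite !mulgA.
  by rewrite -E -!mulgA mulKg.
have H : F ((ed a * y)^-1) = true.
  have := first_letter 1 a y py; rewrite mul1g invg1 => ->//.
  by apply/asboolP; split=> //; exact: KG1.
have V : (x^-1 * x')^-1 = x'^-1 * x by rewrite invgM invgK.
have x0 : x = x * 1 by rewrite mulg1.
rewrite E' first_letter// in H; last 2 first.
- by rewrite V x0 FPV// FP.
- by rewrite V x0 LPV// (level_PTl LV).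
by move/asboolP: H => [-> /KGV]; rewrite invgK.
Qed.

(** Translates of P_T that overlap lie in a common one: edge groups are totally
    ordered, so of two decompositions x e y of an element, one has the longer
    tail. *)
Lemma PP_directed q q' z z' : PT q -> PT q' -> PP z -> PP z' -> q * z = q' * z' ->
  exists r r' t : G, [/\ PT r, PT r', PP t & z = r * t /\ z' = r' * t].
Proof.
move=> Pq Pq' /positive_wordP pz /positive_wordP pz' E.
case: pz E => {z} [z Pz|x a y Px py] E.
  case: pz' E => {z'} [z' Pz' _|x' a' y' Px' py' E].
    by exists z, z', 1; split=> //; [exact: PP1|rewrite !mulg1].
  have : PT (q' * x' * ed a' * y').
    have -> : q' * x' * ed a' * y' = q * z by rewrite E !mulgA.
    exact: PTM.
  by move/(PT_edge_absurd py' (PTM Pq' Px')).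
case: pz' E => {z'} [z' Pz' E|x' a' y' Px' py' E].
  have : PT (q * x * ed a * y).
    have -> : q * x * ed a * y = q' * z' by rewrite -E !mulgA.
    exact: PTM.
  by move/(PT_edge_absurd py (PTM Pq Px)).
have {}E : (q * x) * ed a * y = (q' * x') * ed a' * y' by move: E; rewrite !mulgA.
have [aa' Kk] := edge_split (PTM Pq Px) (PTM Pq' Px') py py' E.
rewrite -aa' in E *; set k := _ * _ in Kk.
have Ek : ed a * y = k * (ed a * y').
  have -> : k * (ed a * y') = (q * x)^-1 * (q' * x' * ed a * y') by rewrite /k !mulgA.
  by rewrite -E -(mulgA (q * x)) mulKg.
clearbody k; have Py := PPM (PP_edge a) (iffRL (positive_wordP _) py).
have Py' := PPM (PP_edge a) (iffRL (positive_wordP _) py').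
have [Pk|Pk] := PG_total (KG_VG Kk).
  exists (x * k), x', (ed a * y'); split=> //; first by apply: PTM => //; exact: PG_PT Pk.
  by rewrite -(mulgA x) Ek !mulgA.
exists x, (x' * k^-1), (ed a * y); split=> //; first by apply: PTM => //; exact: PG_PT Pk.
by rewrite -!mulgA Ek mulKg.
Qed.

(** The level is additive and nonnegative on P, and vanishes exactly on P_T. *)
Lemma PT_face x y : PP x -> PP y -> PT (x * y) -> PT x /\ PT y.
Proof.
move=> /positive_wordP px /positive_wordP py.
have [L [L1 LV LA]] := level_exists.
have LM (u w : G) : positive_word u -> L (u * w) = (L u + L w)%R.
  move=> pu; elim: pu w => {u} [u Pu w|u a t Pu _ IH w].
    by rewrite (level_PTl LV)// (level_PT L1 LV Pu) GRing.add0r.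
  by rewrite -!mulgA !(level_PTl LV _ Pu) !LA IH; lia.
have L0 u : positive_word u -> L u = 0%R -> PT u.
  by case=> // t a w Pt pw Lt; have := level_edge L1 LV LA a pw Pt; rewrite Lt.
move=> /(level_PT L1 LV); rewrite LM// => Lxy.
have := level_ge0 L1 LV LA px; have := level_ge0 L1 LV LA py => Ly Lx.
by split; apply: L0 => //; lia.
Qed.

(** Upper bounds in P of two elements of P_T are right multiples of upper bounds
    in P_T, because the translates of P_T form directed families. *)
Lemma PT_joinable_PP x y : PT x -> PT y -> (exists u, PP (x^-1 * u) /\ PP (y^-1 * u)) ->
  exists m, [/\ PT (x^-1 * m), PT (y^-1 * m) &
    forall u, PP (x^-1 * u) -> PP (y^-1 * u) -> PP (m^-1 * u)].
Proof.
move=> Px Py [u [xu yu]].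
have common (w : G) : PP (x^-1 * w) -> PP (y^-1 * w) -> exists u', [/\ PT (x^-1 * u'),
    PT (y^-1 * u') & PP (u'^-1 * w)].
  move=> xw yw; have [|r [r' [t [Pr Pr' Pt [E E']]]]] := PP_directed Px Py xw yw.
    by rewrite !mulVKg.
  have xyr : x * r = y * r'.
    by apply: (mulIg t); rewrite -!mulgA -E -E' !mulVKg.
  exists (x * r); split; [by rewrite mulKg|by rewrite xyr mulKg|].
  by rewrite invgM -mulgA E mulKg.
have [u' [xu' yu' _]] := common u xu yu.
have [|m [xm ym mP]] := PT_joinable Px Py; first by exists u'.
exists m; split=> // w xw yw; have [w' [xw' yw' ww']] := common w xw yw.
have := PPM (PT_PP (mP w' xw' yw')) ww'; by rewrite -mulgA mulVKg.
Qed.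

(** By induction on the number of letters of y from A. With y = y0 a y1, the join
    z of s and y0 is replaced by the least element k0 of the edge group above
    it. If a preserves the order then k0 a = a k' and k' is joined with y1; if a
    reverses it then k0 <= a, so that y is an upper bound already. *)
Lemma PT_PP_joinable s y : positive_word y -> PT s -> joinable PP s y.
Proof.
move=> py; elim: py s => {y} [y Py|y0 a y1 Py0 py1 IH] s Ps.
  move=> /(PT_joinable_PP Ps Py) [m [sm ym mP]].
  by exists m; split=> //; exact: PT_PP.
move=> [u [su yu]]; have Py1 := iffRL (positive_wordP _) py1.
have y0u (w : G) : PP ((y0 * ed a * y1)^-1 * w) -> PP (y0^-1 * w).
  move=> h; have := PPM (PPM (PP_edge a) Py1) h.
  by rewrite !invgM -!mulgA mulVKg mulVKg.
have [|m [sm ym mP]] := PT_joinable_PP Ps Py0; first by exists u; split=> //; exact: y0u.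
have [z [Pz zE]] : exists z, PT z /\ m = y0 * z by exists (y0^-1 * m); rewrite mulVKg.
(* both z and a * y1 divide y0^-1 * w, so that its first letter from A is a
   and it is read in the coset of the trivial element *)
have split_u (w : G) : PP (s^-1 * w) -> PP ((y0 * ed a * y1)^-1 * w) ->
    exists k t : G, [/\ KP (val a) k, PT (z^-1 * k), PP t & y0^-1 * w = k * ed a * t].
  move=> sw yw; have mw := mP w sw (y0u w yw).
  have wE : y0^-1 * w = 1 * ed a * (y1 * ((y0 * ed a * y1)^-1 * w)).
    by rewrite mul1g !invgM -!mulgA mulVKg mulVKg.
  have pw := iffLR (positive_wordP _) (PPM Py1 yw).
  have zw : y0^-1 * w = z * (m^-1 * w) by rewrite zE invgM -!mulgA mulVKg.
  case: (iffLR (positive_wordP _) mw) zw => [v Pv|x b v Px pv] zw.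
    by case: (@PT_edge_absurd 1 a _ pw PT1); rewrite -wE zw; exact: PTM.
  rewrite !mulgA in zw; have [ba Kx] := edge_split (PTM Pz Px) PT1 pv pw (etrans (esym zw) wE).
  rewrite mulg1 in Kx; rewrite ba in zw Kx.
  exists (z * x), v; split=> //; last exact: iffRL (positive_wordP _) pv.
    by apply: PT_KG; [exact: PTM|rewrite -[z * x]invgK; exact: KGV].
  by rewrite mulKg.
have [k [v [Kk zk _ _]]] := split_u u su yu.
have [n pz] := PT_pword (org (val a)) Pz.
have [|mz [Pmz zmz mzP]] := vertex_min pz; first by exists k => //; apply: KG_VG; case: Kk.
have Aa : sedges T (val a) \/ A (val a) by right; exact: set_valP.
have [|k0 [Kk0 mk0 k0P]] := lcm_min Aa Pmz.
  by exists k => //; apply: mzP => //; apply: KG_VG; case: Kk.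
have {}k0P (w : G) : PP (s^-1 * w) -> PP ((y0 * ed a * y1)^-1 * w) ->
    exists h t : G, [/\ KP (val a) h, PP t & y0^-1 * w = k0 * h * ed a * t].
  move=> sw yw; have [k' [v' [Kk' zk' Pv' wE]]] := split_u w sw yw.
  exists (k0^-1 * k'), v'; rewrite mulVKg; split=> //; apply: k0P => //.
  by apply: mzP => //; apply: KG_VG; case: Kk'.
have zk0 : PT (z^-1 * k0) by apply: PT_trans zmz (PG_PT mk0).
have y1w (w : G) : (y0 * ed a * y1)^-1 * w = y1^-1 * ((ed a)^-1 * (y0^-1 * w)).
  by rewrite !invgM !mulgA.
have [plus|minus] := KP_edge a.
  have [k' Pk' k'E] := plus _ Kk0.
  have k'w (w : G) : PP (s^-1 * w) -> PP ((y0 * ed a * y1)^-1 * w) ->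
      PP (k'^-1 * ((ed a)^-1 * (y0^-1 * w))).
    move=> sw yw; have [h [t [Kh Pt ->]]] := k0P w sw yw.
    have [h' Ph' h'E] := plus _ Kh.
    rewrite -(mulgA k0) h'E (mulgA k0) k'E -!mulgA !mulKg.
    by apply: PPM => //; apply: PT_PP; exact: PG_PT Ph'.
  have [|m' [k'm' y1m' m'P]] := IH k' (PG_PT Pk').
    by exists ((ed a)^-1 * (y0^-1 * u)); split; [exact: k'w|rewrite -y1w].
  exists (y0 * (ed a * m')); split.
  - have -> : s^-1 * (y0 * (ed a * m')) = (s^-1 * m) * ((z^-1 * k0) * (ed a * (k'^-1 * m'))).
      rewrite zE -!mulgA mulVKg; congr (_ * (_ * _)).
      by rewrite !mulgA k'E -!mulgA mulVKg.
    apply: PPM; first exact: PT_PP.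
    apply: PPM; first exact: PT_PP.
    by apply: PPM => //; exact: PP_edge.
  - by rewrite y1w !mulKg.
  - by move=> w sw yw; rewrite !invgM -!mulgA; apply: m'P; [exact: k'w|rewrite -y1w].
have [k' Pk' k'E] := minus _ Kk0.
apply: joinable_le; [exact: PP1|exact: PPM| |by exists u].
have -> : s^-1 * (y0 * ed a * y1) = (s^-1 * m) * ((z^-1 * k0) * (ed a * (k' * y1))).
  rewrite zE -!mulgA mulVKg; congr (_ * (_ * _)).
  by rewrite !mulgA k'E.
apply: PPM; first exact: PT_PP.
apply: PPM; first exact: PT_PP.
apply: PPM; first exact: PP_edge.
by apply: PPM => //; apply: PT_PP; exact: PG_PT Pk'.
Qed.

(** If y starts with k a, k in the edge group, then a and y are comparable when a
    preserves the order; otherwise k a k' = a for some k' in the cone, and the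
    task is to join k' with the rest of y. *)
Lemma edge_joinable a y : positive_word y -> joinable PP (ed a) y.
Proof.
have pa : positive_word (ed a).
  have -> : ed a = 1 * ed a * 1 by rewrite mul1g mulg1.
  by apply: positive_wordS; [exact: PT1|apply: positive_word0; exact: PT1].
case=> {y} [y Py|y0 b y1 Py0 py1]; first exact/joinable_sym/PT_PP_joinable.
move=> [u [au yu]]; have Py1 := iffRL (positive_wordP _) py1.
have pu1 := iffLR (positive_wordP _) au.
have pu2 := iffLR (positive_wordP _) (PPM Py1 yu).
have uE : 1 * ed a * ((ed a)^-1 * u) = y0 * ed b * (y1 * ((y0 * ed b * y1)^-1 * u)).
  by rewrite mul1g mulVKg !invgM -!mulgA mulVKg mulVKg mulVKg.
have [ab Ky0] := edge_split PT1 Py0 pu1 pu2 uE.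
rewrite -ab invg1 mul1g in yu Ky0 *; have {}Ky0 := PT_KG Py0 Ky0.
have y1w (w : G) : (y0 * ed a * y1)^-1 * w = y1^-1 * ((ed a)^-1 * (y0^-1 * w)).
  by rewrite !invgM !mulgA.
have [plus|minus] := KP_edge a.
  have [k' Pk' k'E] := plus _ Ky0; apply: joinable_le; [exact: PP1|exact: PPM| |by exists u].
  rewrite k'E -!mulgA mulKg; apply: PPM => //.
  by apply: PT_PP; exact: PG_PT Pk'.
have [k' Pk' k'E] := minus _ Ky0.
have conj (w : G) : (ed a)^-1 * (y0^-1 * w) = k' * ((ed a)^-1 * w).
  rewrite !mulgA; congr (_ * _); apply: (mulgI (y0 * ed a)).
  by rewrite [LHS]mulgA mulgK mulgV [RHS]mulgA k'E mulgV.
have [|m' [k'm' y1m' m'P]] := PT_PP_joinable py1 (PG_PT Pk').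
  by exists (k' * ((ed a)^-1 * u)); rewrite mulKg -conj -y1w.
exists (ed a * (k'^-1 * m')); split; first by rewrite mulKg.
  by rewrite y1w conj mulKg mulVKg.
move=> w aw yw; rewrite !invgM invgK -!mulgA; apply: m'P; first by rewrite mulKg.
by rewrite -conj -y1w.
Qed.

Lemma PP_joinable x y : PP x -> PP y -> joinable PP x y.
Proof.
move=> /positive_wordP px; elim: px y => {x} [x Px y Py|x a t Px pt IH y Py].
  by apply: PT_PP_joinable => //; exact: iffLR (positive_wordP _) Py.
have Pt := iffRL (positive_wordP _) pt.
apply: joinableM => //; first exact: PPM.
apply: joinableM => //; first exact: PPM.
- exact: PP_edge.
- by move=> z Pz; apply: PT_PP_joinable => //; exact: iffLR (positive_wordP _) Pz.
- by move=> z Pz; apply: edge_joinable; exact: iffLR (positive_wordP _) Pz.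
Qed.

End GraphOfMonoids.

Local Close Scope group_scope.

(** * The theorem *)

Theorem proposition7p2 (R : realType)
    (Gam : serreGraph) (Gam_connected : connected_graph Gam)
    (GG : graphOfGroups Gam)
    (V_countable : countable [set: vert Gam])
    (E_countable : countable [set: edge Gam])
    (G_countable : forall v : vert Gam, countable [set: gvert GG v])
    (A : set (edge Gam)) (T : subgraph Gam)
    (T_maximal : maximal_subtree T)
    (E_decomp : A `|` (@einv Gam) @` A `|` sedges T = setT)
    (A_Abar_disj : A `&` (@einv Gam) @` A = set0)
    (A_T_disj : A `&` sedges T = set0)
    (Abar_T_disj : (@einv Gam) @` A `&` sedges T = set0)
    (P : forall v : vert Gam, set (gvert GG v))
    (P_cone : forall v : vert Gam, positive_cone (P v))
    (P_tree : forall e : edge Gam, sedges T e -> pos_tgt P e = pos_org P e)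
    (Ap Am : set (edge Gam))
    (A_decomp : A = Ap `|` Am) (Ap_Am_disj : Ap `&` Am = set0)
    (P_plus : forall e : edge Gam, Ap e ->
      @emb_tgt Gam GG e @` pos_org P e `<=` P (tgt e))
    (P_minus : forall e : edge Gam, Am e ->
      @emb_tgt Gam GG e @` pos_org P e `<=` [set g | P (tgt e) (g^-1)%g])
    (lcm : condLCM GG A T P) :
  nuclear (cstar_lambda R (monP GG A T P)) ->
  nuclear (cstar_lambda R (monPT GG A T P)).
Proof.
pose PTs : set (fundGroup GG A T) := @PT _ GG A T P.
pose PPs : set (fundGroup GG A T) := @PP _ GG A T P.
have incl (x : monPT GG A T P) : val x \in gen_submonoid (@gensP _ GG A T P).
  apply: mem_set; apply: PT_PP. exact: (set_valP x).
pose io (x : monPT GG A T P) : monP GG A T P := SigSub (incl x).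
have valio x : val (io x) = val x by [].
have PPval (x : monP GG A T P) : PPs (val x) by exact: set_valP.
have PTval (x : monPT GG A T P) : PTs (val x) by exact: set_valP.
have mkP x : PPs x -> exists x' : monP GG A T P, val x' = x.
  by move=> Px; exists (SigSub (mem_set Px)).
have mkT x : PTs x -> exists x' : monPT GG A T P, val x' = x.
  by move=> Px; exists (SigSub (mem_set Px)).
have vM (x y : monP GG A T P) : val (x * y)%g = (val x * val y)%g by exact: valM.
have vMT (x y : monPT GG A T P) : val (x * y)%g = (val x * val y)%g by exact: valM.
apply: (@nuclear_submonoid R _ _ io).
- by move=> x y /(congr1 val) /=; exact: val_inj.
- by move=> x y; apply: val_inj; rewrite vM !valio vMT.
- exact: val_inj.
- by move=> p x y /(congr1 val); rewrite !vM => /mulgI/val_inj.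
- by move=> p x y /(congr1 val); rewrite !vM => /mulIg/val_inj.
- move=> p q [x [y /(congr1 val)]]; rewrite !vM => xy.
  have [|m [pm qm mP]] := PP_joinable Gam_connected G_countable T_maximal P_cone
      P_tree A_decomp P_plus P_minus lcm (PPval p) (PPval q).
    exists (val p * val x)%g; rewrite mulKg xy mulKg; split; exact: PPval.
  have [a aE] := mkP _ pm; have [b bE] := mkP _ qm.
  exists a, b; split; first by apply: val_inj; rewrite !vM aE bE !mulVKg.
  move=> u v /(congr1 val); rewrite !vM => uv.
  have [c cE] : exists c : monP GG A T P, val c = (m^-1 * (val p * val u))%g.
    apply: mkP; apply: mP; first by rewrite mulKg; exact: PPval.
    by rewrite uv mulKg; exact: PPval.
  exists c; split; apply: val_inj; rewrite vM cE.
    by rewrite aE -mulgA mulVKg mulKg.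
  by rewrite bE -mulgA mulVKg uv mulKg.
- move=> x y q /(congr1 val); rewrite vM valio => xy.
  have [|Px Py] := PT_face (PPval x) (PPval y); first by rewrite xy; exact: PTval.
  have [x' xE] := mkT _ Px; have [y' yE] := mkT _ Py.
  by exists x', y'; split; apply: val_inj; rewrite valio.
- move=> q q' z z' /(congr1 val); rewrite !vM !valio => E.
  have [r [r' [w [Pr Pr' Pw [zE zE']]]]] := PP_directed P_cone (PTval q) (PTval q') (PPval z) (PPval z') E.
  have [s sE] := mkT _ Pr; have [s' sE'] := mkT _ Pr'; have [t tE] := mkP _ Pw.
  exists s, s', t; split; apply: val_inj; rewrite vM valio ?sE ?sE' tE //.
Qed.
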